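(* Let $\mathcal{R}$ be a unibranch plane curve singularity ring over a finite field $\mathbb{F}_q$ with valuation semigroup $\Gamma$, let $\delta=|\mathbb{Z}_+\setminus\Gamma|$, and let $\delta\ge1$. Assume that for every standard $\Gamma$-module $\Delta$ the number $|\mathcal{J}_0(\Delta)|$ of $\mathbb{F}_q$-points of the Piontkowski cell of $\Delta$ is a polynomial in terms of $q$ (this holds conjecturally for any plane curve singularity). (i) Any monomials $q^it^j$ in $\mathcal{H}^{mot}(q,t,a=0)$ satisfy $i\ge j$, and $i=j$ holds only for the $\Delta$ of the form $\Gamma\cup\{n+\mathbb{Z}_+\}$ with $n\ge0$. The sum of such extremal ($i=j$) monomials in $\mathcal{H}^{mot}(q,t,a=0)$ is $\sum_{i=0}^{\delta}q^it^i$. (ii) Let $\mathcal{H}^{mot}_\dagger=\mathcal{H}^{mot}(q,t,a=-t/q)$. It is a sum of monomials $\pm q^it^j$ with $i,j\ge0$ such that $i+1\ge j$. The extremal terms (those with $i+1=j$) can be only due to modules of $q$-rank $2$ contributing $q^it^i$ to $\mathcal{H}^{mot}(q,t,a=0)$ or modules of $q$-rank $3$ contributing $q^it^i$ to $\mathcal{H}^{mot}(q,t,a=0)$. Respectively, they contribute to $\mathcal{H}^{mot}_\dagger$ the terms $-t(q^it^i)$, for $0\le i\le\delta-1$, in the case of $q$-rank $2$, and the terms $+t^2q(q^it^i)$, for $0\le i\le\delta-3$, in the case of $q$-rank $3$. Their total contribution to $\mathcal{H}^{mot}_\dagger$ is then $-t$ if $\delta=1$, and $-t-t^{\delta}q^{\delta-1}$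 otherwise.
   Context: A unibranch plane curve singularity ring over a field $\mathbb{F}$ is $\mathcal{R}=\mathbb{F}[[x,y]]\subset\mathcal{O}=\mathbb{F}[[z]]$ (all power series in the two elements $x,y$), where $x,y\in z\mathcal{O}$ and the field of fractions of $\mathcal{R}$ is $\mathbb{F}((z))$. Here $\mathbb{F}=\mathbb{F}_q$; polynomiality in $q$ is understood with $q$ varying by passing to finite extensions of the base field, keeping the same $x,y$. Let $\nu_z$ be the $z$-adic valuation, $\Gamma=\{\nu_z(f)\mid 0\ne f\in\mathcal{R}\}$, $\mathbb{Z}_+=\{0,1,2,\ldots\}$, $\delta=|\mathbb{Z}_+\setminus\Gamma|=\dim(\mathcal{O}/\mathcal{R})$, and $\mathfrak{m}=\mathcal{R}\cap z\mathcal{O}$ (the maximal ideal of $\mathcal{R}$). A standard module is an $\mathcal{R}$-submodule $M\subset\mathcal{O}$ containing an element of the form $1+z(\cdots)$; put $\Delta(M)=\{\nu_z(v)\mid 0\ne v\in M\}$, $\deg(M)=\dim(\mathcal{O}/M)=|\mathbb{Z}_+\setminus\Delta(M)|$, and let the $q$-rank of $M$ be $rk_q(M)=\dim_{\mathbb{F}_q}(M/\mathfrak{m}M)$. A standard $\Gamma$-module is a set $\Delta\subset\mathbb{Z}_+$ with $0\in\Delta$ and $\Gamma+\Delta\subset\Delta$. The Piontkowski cell of $\Delta$ is $\mathcal{J}_0(\Delta)=\{M\text{ standard}\mid\Delta(M)=\Delta\}$ (possibly empty), and $|\mathcal{J}_0(\Delta)|$ is the number of such $M\subset\mathbb{F}_q[[z]]$.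 For $\ell\ge0$, a standard $\ell$-flag is a chain $M_0\subset\cdots\subset M_\ell\subset\mathcal{O}$ of $\mathcal{R}$-submodules with $M_0$ standard, $\dim M_i/M_{i-1}=1$, $\Delta(M_i)=\Delta(M_{i-1})\cup\{g_i\}$ (disjoint union) for $1\le i\le\ell$, and $g_1<\cdots<g_\ell$. The motivic superpolynomial is $\mathcal{H}^{mot}(q,t,a)=\sum_{\ell\ge0}\sum_{\{M_0\subset\cdots\subset M_\ell\}}t^{\deg(M_\ell)}a^\ell$, summed over all standard flags over $\mathbb{F}_q$. Equivalently, $\mathcal{H}^{mot}(q,t,a)=\sum_M t^{\deg(M)}\prod_{i=1}^{rk_q(M)-1}(1+q^ia)$ over all standard $M$ (an empty product is $1$). In particular, $\mathcal{H}^{mot}(q,t,a=0)=\sum_\Delta|\mathcal{J}_0(\Delta)|\,t^{|\mathbb{Z}_+\setminus\Delta|}$, summed over standard $\Gamma$-modules $\Delta$.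
   Formalization: ''Of q-rank 2 (3)'' is read as q-rank at least 2 (3), the coefficient of q^it^i being taken modulo q^{i+1}; the q-rank 3 range and the total are claimed only if 2 is not in Γ or δ≤2, being false for Γ=<2,2δ+1>, δ≥3 (e.g. F[[z^2,z^7]]), where corrected values are proved. *)

(* Defs.v *)
From HB Require Import structures.
From mathcomp Require Import all_boot all_order all_algebra.
From mathcomp Require Import finmap.
From mathcomp Require Import all_classical.

Set Implicit Arguments.
Unset Strict Implicit.
Unset Printing Implicit Defensive.
Import GRing.Theory Num.Theory.
Local Open Scope classical_set_scope.
Local Open Scope ring_scope.

(* Formal power series F[[z]]: f n is the coefficient of z^n.  Addition and
   scaling are pointwise; multiplication is the Cauchy product. *)
Definition series (F : comNzRingType) := nat -> F.

HB.instance Definition _ (F : comNzRingType) :=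
  GRing.Lmodule.copy (series F) (nat -> F^o).

Section SeriesRing.
Variable F : comNzRingType.
Implicit Types f g h : series F.

Definition series_one : series F := fun n => (n == 0%N)%:R.
Definition series_mul f g : series F :=
  fun n => \sum_(i < n.+1) f i * g (n - i)%N.

Definition series_trunc (N : nat) f : {poly F} := \poly_(i < N.+1) f i.

Lemma coef_series_trunc N f i :
  (i <= N)%N -> (series_trunc N f)`_i = f i.
Proof. by move=> iN; rewrite coef_poly ltnS iN. Qed.

Lemma series_mul_trunc N f g n : (n <= N)%N ->
  series_mul f g n = (series_trunc N f * series_trunc N g)`_n.
Proof.
move=> nN; rewrite coefM; apply: eq_bigr => i _.
rewrite !coef_series_trunc ?(leq_trans (leq_subr _ _) nN) //.
by rewrite (leq_trans _ nN) // -ltnS ltn_ord.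
Qed.

Lemma series_mulC : commutative series_mul.
Proof.
by move=> f g; apply/funext => n; rewrite !(series_mul_trunc _ _ (leqnn n)) mulrC.
Qed.

Lemma series_mulA : associative series_mul.
Proof.
move=> f g h; apply/funext => n.
transitivity (series_trunc n f * (series_trunc n g * series_trunc n h))`_n.
  rewrite coefM; apply: eq_bigr => i _; have ilen : (i <= n)%N by rewrite -ltnS.
  by rewrite coef_series_trunc // (series_mul_trunc _ _ (leq_subr _ _)).
rewrite mulrA coefM; apply: eq_bigr => i _; have ilen : (i <= n)%N by rewrite -ltnS.
by rewrite (series_mul_trunc _ _ ilen) coef_series_trunc // leq_subr.
Qed.

Lemma series_mul1 : left_id series_one series_mul.
Proof.
move=> f; apply/funext => n; rewrite /series_mul big_ord_recl subn0 mul1r.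
by rewrite big1 ?addr0 // => i _; rewrite /series_one /= mul0r.
Qed.

Lemma series_mulDl : left_distributive series_mul +%R.
Proof.
move=> f g h; apply/funext => n.
transitivity (series_mul f h n + series_mul g h n) => //.
by rewrite -big_split; apply: eq_bigr => i _; exact: mulrDl.
Qed.

Lemma series_one_neq0 : series_one != 0 :> series F.
Proof.
by apply/eqP => /(congr1 (fun f : series F => f 0%N))/eqP; rewrite oner_eq0.
Qed.

End SeriesRing.

HB.instance Definition _ (F : comNzRingType) :=
  GRing.Zmodule_isComNzRing.Build (series F) (@series_mulA F) (@series_mulC F)
    (@series_mul1 F) (@series_mulDl F) (@series_one_neq0 F).

Definition base_change (F L : comNzRingType) (iota : F -> L) (f : series F) :
  series L := fun n => iota (f n).

Definition gaps (D : set nat) : nat := #|` fset_set (~` D)|.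

Section Branch.
Variable F : fieldType.
Implicit Types (f g x y : series F) (M N : set (series F)) (D : set nat).

(* f != 0 and its z-adic valuation is n *)
Definition has_valuation f (n : nat) : Prop :=
  f n != 0 /\ forall k, (k < n)%N -> f k = 0.

Definition Delta M : set nat := [set n | exists2 f, M f & has_valuation f n].

(* F[[x,y]], for x and y without constant term: the coefficient of z^n in
   x^i y^j vanishes unless i + j <= n, so the double sum over all i, j is
   finite in each degree. *)
Definition branch_ring x y : set (series F) :=
  [set f | exists c : nat -> nat -> F, forall n,
     f n = \sum_(i < n.+1) \sum_(j < n.+1) c i j * (x ^+ i * y ^+ j) n].

(* The last condition says that Frac(F[[x,y]]) is all of F((z)) = Frac(F[[z]]):
   every fraction f/g of power series equals a fraction a/b over F[[x,y]]. *)
Definition unibranch_plane x y : Prop :=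
  [/\ x 0%N = 0, y 0%N = 0 &
    forall f g, g != 0 -> exists a b,
      [/\ branch_ring x y a, branch_ring x y b, b != 0 & f * b = a * g]].

Definition Gamma x y : set nat := Delta (branch_ring x y).

Definition delta x y : nat := gaps (Gamma x y).

Definition max_ideal x y : set (series F) :=
  [set f | branch_ring x y f /\ f 0%N = 0].

Definition is_submodule x y M : Prop :=
  [/\ M 0, forall f g, M f -> M g -> M (f + g) &
    forall r f, branch_ring x y r -> M f -> M (r * f)].

Definition standard x y M : Prop :=
  is_submodule x y M /\ exists2 f, M f & f 0%N = 1.

(* v_0, ..., v_{d-1} in M represent a basis of the F-vector space M/N *)
Definition basis_mod N M (d : nat) (v : 'I_d -> series F) : Prop :=
  (forall i, M (v i)) /\
  forall f, M f -> exists! c : 'rV[F]_d, N (f - \sum_i c 0 i *: v i).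

(* dim (M/N); meaningful when this dimension is finite, which is the case for
   all the quotients considered below *)
Definition dim_quot N M : nat :=
  get [set d | exists v : 'I_d -> series F, basis_mod N M v].

Definition deg M : nat := dim_quot M setT.

Definition max_ideal_mul x y M : set (series F) :=
  [set f | exists n (a v : 'I_n -> series F),
     [/\ forall i, max_ideal x y (a i), forall i, M (v i) &
       f = \sum_i a i * v i]].

Definition qrank x y M : nat := dim_quot (max_ideal_mul x y M) M.

(* the Piontkowski cell *)
Definition J0 x y D : set (set (series F)) :=
  [set M | standard x y M /\ Delta M = D].

(* A flag M_0 < ... < M_l is encoded as (M_0, [:: M_1; ...; M_l]). *)
Definition flag_nth (fl : set (series F) * seq (set (series F))) (i : nat) :
  set (series F) := nth fl.1 (fl.1 :: fl.2) i.

Definition flag_length (fl : set (series F) * seq (set (series F))) : nat :=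
  size fl.2.

Definition standard_flag x y : set (set (series F) * seq (set (series F))) :=
  [set fl | standard x y (flag_nth fl 0) /\
   exists g : nat -> nat,
    (forall i, (1 <= i <= flag_length fl)%N ->
      [/\ is_submodule x y (flag_nth fl i),
          flag_nth fl i.-1 `<=` flag_nth fl i,
          dim_quot (flag_nth fl i.-1) (flag_nth fl i) = 1%N,
          Delta (flag_nth fl i) = Delta (flag_nth fl i.-1) `|` [set g i] &
          ~ Delta (flag_nth fl i.-1) (g i)]) /\
    (forall i j, (1 <= i)%N -> (i < j)%N -> (j <= flag_length fl)%N ->
      (g i < g j)%N)].

(* The motivic superpolynomial over the finite field F, evaluated at t and a
   in any commutative ring A; the variable q is specialized to #|F|. *)
Definition Hmot (A : comNzRingType) x y (t a : A) : A :=
  \sum_(fl \in standard_flag x y)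
     t ^+ deg (flag_nth fl (flag_length fl)) * a ^+ flag_length fl.

(* sum of t^deg(M) over the standard modules of q-rank at least r *)
Definition rank_ge_sum x y (r : nat) : {poly rat} :=
  \sum_(M \in [set M | standard x y M /\ (r <= qrank x y M)%N]) ('X^(deg M) : {poly rat}).

End Branch.

(* standard G-modules for a semigroup G *)
Definition standard_gamma (G : set nat) : set (set nat) :=
  [set D | D 0%N /\ forall m n, G m -> D n -> D (m + n)%N].

(* {poly {poly rat}} is Q[q][t]: the outer variable is t, the inner one is q,
   and H`_j`_i is the coefficient of q^i t^j in H. *)
Definition mono (i j : nat) : {poly {poly rat}} := ('X^i)%:P * 'X^j.

Definition at_q (q : rat) (H : {poly {poly rat}}) : {poly rat} :=
  map_poly (horner_eval q) H.

(* the part of H made of its monomials q^i t^j with i + k = j *)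
Definition diagonal_part (k : nat) (H : {poly {poly rat}}) : {poly {poly rat}} :=
  \sum_(j < size H) \sum_(i < size H`_j | (i + k == j)%N)
     (H`_j`_i)%:P%:P * mono i j.

Definition congr_mod (N : nat) (a b : rat) : Prop :=
  (a - b) / N%:R \is a Num.int.

Section Families.
Variables (F : finFieldType) (x y : series F).

(* H is H^mot(q,t,a(q)) as a polynomial in q and t, where q runs through the
   orders of all finite extensions iota : F -> L, the elements x, y being
   fixed.  There are infinitely many such orders, so H is unique. *)
Definition is_Hmot (a : rat -> {poly rat}) (H : {poly {poly rat}}) : Prop :=
  forall (L : finFieldType) (iota : {rmorphism F -> L}),
    at_q #|L|%:R H =
    Hmot (base_change iota x) (base_change iota y) 'X (a #|L|%:R).

(* The modules of q-rank at least r contribute to H^mot(q,t,a=0) the extremal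
   monomials E (a combination of monomials q^i t^i).  The number of modules of
   degree i and q-rank at least r is not assumed to be a polynomial in q, so
   the coefficient of q^i t^i is read off modulo q^(i+1); all the monomials of
   t-degree i with q-degree greater than i vanish modulo q^(i+1). *)
Definition rank_ge_extremal (r : nat) (E : {poly {poly rat}}) : Prop :=
  forall (L : finFieldType) (iota : {rmorphism F -> L}) (i : nat),
    congr_mod (#|L| ^ i.+1)
      (rank_ge_sum (base_change iota x) (base_change iota y) r)`_i
      (at_q #|L|%:R E)`_i.

End Families.

(* Main.v *)
Require Import Defs.
From mathcomp Require Import all_boot all_order all_algebra.
From mathcomp Require Import finmap.
From mathcomp Require Import fieldext galois finfield.
From mathcomp Require Import all_classical.
From mathcomp Require Import zify ring.
Import GRing.Theory Num.Theory.
Local Open Scope classical_set_scope.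
Local Open Scope ring_scope.

Set Implicit Arguments.
Unset Strict Implicit.
Unset Printing Implicit Defensive.

(** Write [O = F[[z]]], [R = F[[x,y]]], [q = #|F|], and let [C] be the conductor
    of the semigroup [Gamma]. All modules considered contain [z^C O], and a
    subspace of [O] containing a power of [z] is handled through its valuations:
    [Delta A] indexes a reduced echelon basis, the dimension of [M / N] is the
    number of valuations lost ([dim_quotE]), and the subspaces between [A] and [B]
    having one valuation [g] more than [A], or one less than [B], number [q] to the
    number of elements of [Delta B `\` Delta A] above [g], or below [g]
    ([ncard_between_add], [ncard_between_del]).

    Part (i). Multiplication by units shows that a cell has [q ^ gaps D] times as
    many points as its part consisting of the modules [M] containing [1]
    ([ncard_cell]). If [g] is the largest gap of [D], the map sending [M] to
    [M + z^g O] has fibres of [q ^ k] points, and [k = 0] occurs only for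
    [M = R + z^(g+1) O] ([dvdn_unital_cell]). So a cell has [q ^ gaps D] points
    modulo [q ^ (gaps D + 1)] if [D] is [Gamma] together with all integers from
    some [n] on, and none otherwise. As these congruences hold over arbitrarily
    large extensions of [F], over which [Gamma] stays the same, they determine the
    lowest coefficients of the polynomials counting the cells ([poly_low_coef],
    [cell_low_coef]). The sets [D] of this kind have 0, 1, ..., [delta] gaps.

    Part (ii). The sum over flags is computed in two ways by one lemma on chains
    with monotone labels ([chain_sum]). Read downwards from the last member, it is
    the sum over [M] of [t ^ deg M] times the product of the [1 + q ^ i a] for
    [0 < i < rank M] ([Hmot_top]). At [a = -t/q] this product is
    [1 - t [rank M >= 2] + q t^2 [rank M >= 3]], up to terms of [t]-degree [k]
    divisible by [q ^ k]; as the number of modules of given degree and rank is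
    divisible by [q] to the degree, this gives the congruence with the sums over
    the ranks ([Hmot_rank_congr]). Read upwards from the first member [N], the sum
    has at [a = -t/q] the product of the [1 - q ^ (i - 1)] for [i < tau N], where
    [tau N] is the dimension of the socle of [O / N] ([Hmot_bottom]); it vanishes
    as soon as [tau N >= 2]. The condition [tau N = 0] means [N = O].

    To count the modules with [tau N = 1], one uses that [R] is Gorenstein: there
    is a linear form [rho] on [O / z^C O] with [perp R = R] ([perp_branch]), hence
    [Gamma] is symmetric, and [tau N = 1] means that [perp N] is generated, modulo
    [z^C O], by one series [b], whose valuation [s] is an element of [Gamma] below
    [C] ([tau1_cyc], [perp_cyc_standard]). With [n = C - s], there are [q] to the
    number of gaps below [n] such modules, all of degree the number of elements of
    [Gamma] below [n] ([tau1_sum]), whence the explicit formula [H_dagger]. Below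
    [n] there are at least as many gaps as elements ([below_le_gaps]), which bounds
    the monomials, and the extremal terms belong to the [n] for which the two
    numbers agree. If [2] is in [Gamma], these are all even [n] up to [C];
    otherwise only [n = 2] and [n = C] ([balanced_not_G2]).

    Finally, a module has rank at least 2 iff its degree is less than [delta]
    ([rank_ge2]), so part (i) gives the extremal terms for rank at least 2; those
    for rank at least 3 follow by comparing the congruence with the formula
    ([rank_ge3_congr]). *)

(** * Power series: coefficients, valuations, inverses *)

Section SeriesBasics.
Variable F : fieldType.
Implicit Types (f g : series F) (A B N : set (series F)).

Lemma coefD_series f g k : (f + g) k = f k + g k. Proof. by []. Qed.
Lemma coefB_series f g k : (f - g) k = f k - g k. Proof. by []. Qed.
Lemma coefZ_series (a : F) f k : (a *: f) k = a * f k. Proof. by []. Qed.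
Lemma coef0_series k : (0 : series F) k = 0. Proof. by []. Qed.
Lemma coef1_series k : (1 : series F) k = (k == 0%N)%:R. Proof. by []. Qed.
Lemma coefM_series f g n : (f * g) n = \sum_(i < n.+1) f i * g (n - i)%N.
Proof. by []. Qed.
Lemma coef_sum_series (I : Type) (r : seq I) (P : pred I) (G : I -> series F) k :
  (\sum_(i <- r | P i) G i) k = \sum_(i <- r | P i) G i k.
Proof.
by elim/big_rec2: _ => [|i y1 y2 _ <-]; rewrite ?coef0_series ?coefD_series.
Qed.

Lemma scaler_mull (a : F) f g : (a *: f) * g = a *: (f * g).
Proof.
apply/funext => n; rewrite coefZ_series !coefM_series big_distrr /=.
by apply: eq_bigr => i _; rewrite coefZ_series mulrA.
Qed.

Lemma scaler_mulr (a : F) f g : f * (a *: g) = a *: (f * g).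
Proof. by rewrite mulrC scaler_mull mulrC. Qed.

Definition tail (n : nat) : set (series F) :=
  [set f | forall k, (k < n)%N -> f k = 0].

Lemma tailM m n f g : tail m f -> tail n g -> tail (m + n) (f * g).
Proof.
move=> fm gn k kmn; rewrite coefM_series big1 // => i _.
have [im|mi] := ltnP i m; first by rewrite fm ?mul0r.
by rewrite gn ?mulr0 // ltn_subLR ?(leq_trans kmn) ?leq_add2r // -ltnS.
Qed.

Lemma coefM_lead m n f g : tail m f -> tail n g -> (f * g) (m + n)%N = f m * g n.
Proof.
move=> fm gn; have mlt : (m < (m + n).+1)%N by rewrite ltnS leq_addr.
rewrite coefM_series (bigD1 (Ordinal mlt)) //= addKn big1 ?addr0 // => i inm.
have /negPf ine : (i != m :> nat) by apply: contraNneq inm => e; apply/eqP/val_inj.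
have [im|mi] := ltnP i m; first by rewrite fm ?mul0r.
rewrite gn ?mulr0 // ltn_subLR; last by rewrite -ltnS.
by rewrite ltn_add2r ltn_neqAle eq_sym ine.
Qed.

Lemma tailW m n f : (m <= n)%N -> tail n f -> tail m f.
Proof. by move=> mn fn k km; apply: fn; exact: leq_trans km mn. Qed.

Lemma tail0 f : tail 0 f. Proof. by []. Qed.

Lemma tail_mulr n f g : tail n g -> tail n (f * g).
Proof. by move=> /(tailM (tail0 f)). Qed.

Lemma tailS n f : tail n f -> f n = 0 -> tail n.+1 f.
Proof. by move=> fn fn0 k; rewrite ltnS leq_eqVlt => /orP[/eqP->|/fn]. Qed.

Lemma val_tail n f : has_valuation f n -> tail n f.
Proof. by case. Qed.

Lemma valM m n f g :
  has_valuation f m -> has_valuation g n -> has_valuation (f * g) (m + n).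
Proof.
move=> [f0 fm] [g0 gn]; split; last exact: tailM.
by rewrite coefM_lead // mulf_neq0.
Qed.

Lemma val_uniq m n f : has_valuation f m -> has_valuation f n -> m = n.
Proof.
move=> [f0 fm] [g0 gn]; apply/eqP; rewrite eqn_leq; apply/andP; split.
  by rewrite leqNgt; apply/negP => /fm e; rewrite e eqxx in g0.
by rewrite leqNgt; apply/negP => /gn e; rewrite e eqxx in f0.
Qed.

Lemma val_ex f : f <> 0 -> exists n, has_valuation f n.
Proof.
move=> f0; have ex : exists n, f n != 0.
  apply: contrapT => /forallNP e; apply: f0; apply/funext => n.
  by apply/eqP; apply: contrapT => /negP; apply: e.
exists (ex_minn ex); case: ex_minnP => m fm min; split=> // k km.
by apply/eqP/negPn/negP => /min; rewrite leqNgt km.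
Qed.

(** Geometric series: the sum of the [m ^+ i] is finite in each degree when
    [m] has no constant term. *)
Lemma series_inv f : f 0%N != 0 -> exists g, f * g = 1.
Proof.
move=> f0; pose m := 1 - (f 0%N)^-1 *: f.
have tm i : tail i (m ^+ i).
  elim: i => [|i IH]; first exact: tail0.
  rewrite exprS -add1n; apply: tailM IH => [[|//]] _.
  by rewrite /m coefB_series coefZ_series mulVf // coef1_series subrr.
pose g : series F := fun n => (\sum_(i < n.+1) m ^+ i) n.
have gE n k : (k <= n)%N -> g k = (\sum_(i < n.+1) m ^+ i) k.
  move=> kn; rewrite /g !coef_sum_series.
  rewrite (big_ord_widen n.+1 (fun i => (m ^+ i) k)) // big_mkcond.
  by apply: eq_bigr => i _; case: ltnP => // ki; rewrite tm.
have mg : (1 - m) * g = 1.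
  apply/funext => n; transitivity (((1 - m) * \sum_(i < n.+1) m ^+ i) n).
    rewrite !coefM_series; apply: eq_bigr => i _; congr (_ * _).
    by apply: gE; exact: leq_subr.
  have -> : (1 - m) * (\sum_(i < n.+1) m ^+ i) = 1 - m ^+ n.+1.
    rewrite -{2}(expr1n _ n.+1) subrXX; congr (_ * _).
    by apply: eq_bigr => i _; rewrite expr1n mul1r.
  by rewrite coefB_series tm // subr0.
exists ((f 0%N)^-1 *: g); rewrite scaler_mulr -scaler_mull.
by rewrite -[X in X * _](subKr 1).
Qed.

(** * Subspaces of power series and their valuation sets *)

Definition subspace A : Prop :=
  A 0 /\ forall (a : F) f g, A f -> A g -> A (a *: f + g).

Section SubspaceClosure.
Variables (A : set (series F)) (sA : subspace A).

Lemma subspace0 : A 0. Proof. by case: sA. Qed.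
Lemma subspaceD f g : A f -> A g -> A (f + g).
Proof. by move=> Af Ag; rewrite -(scale1r f); case: sA => _; apply. Qed.
Lemma subspaceZ (a : F) f : A f -> A (a *: f).
Proof. by move=> Af; rewrite -[_ *: _]addr0; case: sA => A0; apply. Qed.
Lemma subspaceN f : A f -> A (- f).
Proof. by rewrite -scaleN1r; exact: subspaceZ. Qed.
Lemma subspaceB f g : A f -> A g -> A (f - g).
Proof. by move=> Af Ag; apply: subspaceD => //; exact: subspaceN. Qed.
Lemma subspace_sum (I : Type) (r : seq I) (P : pred I) (G : I -> series F) :
  (forall i, P i -> A (G i)) -> A (\sum_(i <- r | P i) G i).
Proof.
by move=> AG; apply: big_ind => //; [exact: subspace0|exact: subspaceD].
Qed.

Lemma Delta_monic n : Delta A n -> exists v, [/\ A v, tail n v & v n = 1].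
Proof.
case=> v Av [vn tv]; exists ((v n)^-1 *: v); split.
- exact: subspaceZ.
- by move=> k kn; rewrite coefZ_series (tv k kn) mulr0.
- by rewrite coefZ_series mulVf.
Qed.

Lemma echelon_uniq b b' : A b -> A b' ->
  (forall k, Delta A k -> b k = b' k) -> b = b'.
Proof.
move=> Ab Ab' e; apply: contrapT => bb'.
have [|n vn] := @val_ex (b - b'); first by move/eqP; rewrite subr_eq0 => /eqP.
have An : Delta A n by exists (b - b') => //; exact: subspaceB.
by case: vn; rewrite coefB_series e // subrr eqxx.
Qed.

(** Together with [echelon_uniq]: the coefficients in the degrees of [Delta A]
    are coordinates on [A]. *)
Lemma echelon_ex K (p : nat -> F) : tail K `<=` A ->
  exists2 b, A b & forall k, Delta A k -> b k = p k.
Proof.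
move=> tA.
suff [b Ab eb] : exists2 b, A b & forall k, (k < K)%N -> Delta A k -> b k = p k.
  exists (b + (fun k => if (k < K)%N then 0 else p k - b k)).
    by apply: subspaceD => //; apply: tA => k ->.
  move=> k Ak; rewrite coefD_series; case: ltnP => kK; last by rewrite addrC subrK.
  by rewrite addr0 eb.
elim: {1}K => [|n [b Ab eb]]; first by exists 0 => //; exact: subspace0.
have [/Delta_monic[v [Av tv v1]]|nA] := pselect (Delta A n); last first.
  exists b => // k; rewrite ltnS leq_eqVlt => /orP[/eqP->//|]; exact: eb.
exists (b + (p n - b n) *: v).
  by apply: subspaceD => //; exact: subspaceZ.
move=> k; rewrite ltnS leq_eqVlt => /orP[/eqP->|kn] Ak.
  by rewrite coefD_series coefZ_series v1 mulr1 addrC subrK.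
by rewrite coefD_series coefZ_series tv // mulr0 addr0 eb.
Qed.

End SubspaceClosure.

Lemma Delta_sub A B : A `<=` B -> Delta A `<=` Delta B.
Proof. by move=> AB n [v /AB Bv vn]; exists v. Qed.

(** Subtracting from an element of [B] its reduction along [A] leaves a series
    with no possible valuation. *)
Lemma Delta_sub_eq K A B : subspace A -> subspace B -> tail K `<=` A ->
  A `<=` B -> Delta B `<=` Delta A -> A = B.
Proof.
move=> sA sB tA AB dBA; apply/seteqP; split=> // b Bb.
have [a Aa ea] := echelon_ex sA b tA.
suff -> : b = a by [].
apply: (echelon_uniq sB) => //; first exact: AB.
by move=> k /dBA /ea.
Qed.

Lemma subspace_tail n : subspace (tail n).
Proof.
split=> // a f g fn gn k kn.
by rewrite coefD_series coefZ_series fn // gn // mulr0 addr0.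
Qed.

Lemma subspaceI A B : subspace A -> subspace B -> subspace (A `&` B).
Proof.
move=> [A0 AD] [B0 BD]; split=> // a f g [Af Bf] [Ag Bg].
by split; [exact: AD|exact: BD].
Qed.

Definition addS A B : set (series F) :=
  [set f | exists a b, [/\ A a, B b & f = a + b]].

Lemma subspace_add A B : subspace A -> subspace B -> subspace (addS A B).
Proof.
move=> sA sB; split; first by exists 0, 0; rewrite addr0; split=> //; exact: subspace0.
move=> c _ _ [a [b [Aa Bb ->]]] [a' [b' [Aa' Bb' ->]]].
exists (c *: a + a'), (c *: b + b'); split; [by case: sA => _; apply|by case: sB => _; apply|].
by rewrite scalerDr addrACA.
Qed.

Lemma addSl A B : subspace B -> A `<=` addS A B.
Proof. by move=> sB a Aa; exists a, 0; rewrite addr0; split=> //; exact: subspace0. Qed.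

Lemma addSr A B : subspace A -> B `<=` addS A B.
Proof. by move=> sA b Bb; exists 0, b; rewrite add0r; split=> //; exact: subspace0. Qed.

Definition line (v : series F) : set (series F) := [set f | exists c, f = c *: v].

Lemma subspace_line v : subspace (line v).
Proof.
split; first by exists 0; rewrite scale0r.
by move=> a _ _ [c ->] [d ->]; exists (a * c + d); rewrite scalerDl scalerA.
Qed.

Lemma line_self v : line v v. Proof. by exists 1; rewrite scale1r. Qed.

Lemma Delta_add_tail A n : subspace A ->
  Delta (addS A (tail n)) = Delta A `|` [set m | (n <= m)%N].
Proof.
move=> sA; apply/seteqP; split=> m.
  move=> [_ [a [b [Aa tb ->]]] [e tm]] /=.
  have [nm|mn] := leqP n m; [by right|left; exists a => //; split].
    by move: e; rewrite coefD_series tb // addr0.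
  move=> k km; have := tm k km; rewrite coefD_series tb ?addr0 //.
  exact: ltn_trans km mn.
case=> [|nm]; first by apply: Delta_sub; apply: addSl; exact: subspace_tail.
exists (fun k => (k == m)%:R); last first.
  by split; [rewrite eqxx oner_neq0|move=> k km; rewrite ltn_eqF].
apply: addSr => // k kn; rewrite ltn_eqF //; exact: leq_trans kn nm.
Qed.

Lemma tail_of_Delta K A n : subspace A -> tail K `<=` A ->
  [set m | (n <= m)%N] `<=` Delta A -> tail n `<=` A.
Proof.
move=> sA tA dA; suff <- : A `&` tail n = tail n by apply: subIsetl.
have [nK|Kn] := leqP n K; last first.
  by apply/seteqP; split=> f => [[]//|tf]; split=> //; apply: tA; exact: tailW (ltnW Kn) tf.
apply: (@Delta_sub_eq K) => //; [exact/subspaceI/subspace_tail|exact: subspace_tail| |].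
  by move=> f tf; split; [exact: tA|exact: tailW tf].
move=> m [f tf [fm tm]]; have nm : (n <= m)%N.
  by rewrite leqNgt; apply/negP => /tf e; rewrite e eqxx in fm.
have [v Av [vm tv]] := dA _ nm; exists v => //; split=> //.
by apply: tailW tv.
Qed.

End SeriesBasics.

(** * Counting finite sets *)

Section Counting.

Definition ncard (T : choiceType) (A : set T) : nat := #|` fset_set A|.

Lemma eq_fsum (V : nmodType) (T : choiceType) (A : set T) (f g : T -> V) :
  (forall x, A x -> f x = g x) -> \sum_(x \in A) f x = \sum_(x \in A) g x.
Proof. by move=> e; apply: eq_fsbigr => x; rewrite inE => /e. Qed.

Lemma fsum_fib (V : nmodType) (T U : choiceType) (A : set T) (B : set U)
    (p : T -> U) (f : T -> V) : finite_set A -> finite_set B ->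
  (forall x, A x -> B (p x)) ->
  \sum_(x \in A) f x = \sum_(b \in B) \sum_(x \in A `&` [set x | p x = b]) f x.
Proof.
move=> fA fB AB.
transitivity (\sum_(x \in A) \sum_(b \in B)
                 (if b \in [set b | p x = b] then f x else 0)).
  apply: eq_fsum => x Ax; rewrite -fsbig_mkcondr.
  suff -> : B `&` [set b | p x = b] = [set p x] by rewrite fsbig_set1.
  by apply/seteqP; split=> [b []|_ ->]//; split=> //; exact: AB.
rewrite exchange_fsbig //; apply: eq_fsum => b _.
rewrite fsbig_mkcondr; apply: eq_fsum => x _.
by rewrite (_ : (b \in _) = (x \in [set x | p x = b])) //; apply/idP/idP; rewrite !inE.
Qed.

Lemma ncard_fsum (T : choiceType) (A : set T) : finite_set A ->
  ncard A = (\sum_(x \in A) 1%N)%R.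
Proof. by move=> fA; rewrite fsbig_finite // /ncard card_fset_sum1. Qed.

Lemma fsum_cst (V : nmodType) (T : choiceType) (A : set T) (f : T -> V) (c : V) :
  finite_set A -> (forall x, A x -> f x = c) -> \sum_(x \in A) f x = c *+ ncard A.
Proof.
move=> fA fc; rewrite (eq_fsum fc) fsbig_finite // big_const_seq count_predT.
by rewrite /ncard -Monoid.iteropE.
Qed.

Lemma ncard_bij (T U : choiceType) (A : set T) (B : set U) (h : T -> U) :
  finite_set A -> (forall x, A x -> B (h x)) ->
  (forall x y, A x -> A y -> h x = h y -> x = y) ->
  (forall y, B y -> exists2 x, A x & h x = y) ->
  finite_set B /\ ncard B = ncard A.
Proof.
move=> fA AB inj surj; have e : B = h @` A.
  by apply/seteqP; split=> y => [/surj[x]|[x /AB ? <-]]//; exists x.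
have fB : finite_set B by rewrite e; exact: finite_image.
split=> //; rewrite !ncard_fsum // e fsbig_image //.
by move=> x y; rewrite !inE; exact: inj.
Qed.

Lemma ncard_fib (T U : choiceType) (A : set T) (B : set U) (p : T -> U) :
  finite_set A -> finite_set B -> (forall x, A x -> B (p x)) ->
  ncard A = (\sum_(b \in B) ncard (A `&` [set x | p x = b]))%R.
Proof.
move=> fA fB AB; rewrite ncard_fsum // (fsum_fib _ fA fB AB).
by apply: eq_fsum => b _; rewrite ncard_fsum //; exact: finite_setIl.
Qed.

Lemma ncard_fib_cst (T U : choiceType) (A : set T) (B : set U) (p : T -> U) k :
  finite_set A -> finite_set B -> (forall x, A x -> B (p x)) ->
  (forall b, B b -> ncard (A `&` [set x | p x = b]) = k) ->
  ncard A = (ncard B * k)%N.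
Proof.
move=> fA fB AB Bk; rewrite (ncard_fib fA fB AB) (fsum_cst fB Bk).
by rewrite mulnC -mulr_natr natn.
Qed.

Lemma ncard_fib_dvd (T U : choiceType) (A : set T) (B : set U) (p : T -> U) k :
  finite_set A -> finite_set B -> (forall x, A x -> B (p x)) ->
  (forall b, B b -> (k %| ncard (A `&` [set x | p x = b]))%N) ->
  (k %| ncard A)%N.
Proof.
move=> fA fB AB Bk; rewrite (ncard_fib fA fB AB) fsbig_finite //.
rewrite big_seq; elim/big_ind: _ => //; first by move=> m n; exact: dvdn_add.
by move=> b; rewrite in_fset_set // inE; exact: Bk.
Qed.

Lemma ncard0 (T : choiceType) : ncard (@set0 T) = 0%N.
Proof. by rewrite /ncard fset_set0. Qed.

Lemma ncard1 (T : choiceType) (x : T) : ncard [set x] = 1%N.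
Proof. by rewrite /ncard fset_set1 cardfs1. Qed.

Lemma ncardU (T : choiceType) (A B : set T) : finite_set A -> finite_set B ->
  A `&` B = set0 -> ncard (A `|` B) = (ncard A + ncard B)%N.
Proof.
move=> fA fB AB; rewrite /ncard fset_setU // cardfsU -fset_setI // AB fset_set0.
by rewrite cardfs0 subn0.
Qed.

Lemma ncard_sub (T : choiceType) (A B : set T) : finite_set B -> A `<=` B ->
  (ncard A <= ncard B)%N.
Proof.
move=> fB AB; apply: fsubset_leq_card; rewrite -fset_set_sub //.
exact: sub_finite_set AB fB.
Qed.

Lemma ncard_sub_eq (T : choiceType) (A B : set T) : finite_set B -> A `<=` B ->
  (ncard B <= ncard A)%N -> A = B.
Proof.
move=> fB AB cBA; have fA := sub_finite_set AB fB.
apply: (@fset_set_inj _ A B) => //; apply/eqP; rewrite eqEfcard cBA andbT.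
by rewrite -fset_set_sub.
Qed.

Lemma ncard_II n : ncard `I_n = n.
Proof. by apply: card_fset_set; rewrite card_eqxx. Qed.

Lemma ncard_gt0 (T : choiceType) (A : set T) x : finite_set A -> A x ->
  (0 < ncard A)%N.
Proof. by move=> fA Ax; rewrite /ncard cardfs_gt0; apply/fset0Pn; exists x; rewrite in_fset_set // inE. Qed.

Lemma finite_bounded (A : set nat) n : (forall k, A k -> (k < n)%N) -> finite_set A.
Proof. by move=> An; apply: (@sub_finite_set _ _ `I_n) => //; exact: finite_II. Qed.

Variable F : finFieldType.

(** Functions supported on a finite set of degrees: the free parameters of a
    reduced echelon form. *)
Definition fns (G : set nat) : set (series F) :=
  [set f | forall k, ~ G k -> f k = 0].

Lemma finset_fintype (T : finType) (U : choiceType) (f : T -> U) (B : set U) :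
  (forall y, B y -> exists x, f x = y) -> finite_set B.
Proof.
move=> s; apply: (@sub_finite_set _ _ (f @` setT)).
  by move=> y /s[x <-]; exists x.
by apply: finite_image; exact: finite_finset.
Qed.

Lemma ncard_fns (G : set nat) : finite_set G ->
  finite_set (fns G) /\ ncard (fns G) = (#|F| ^ ncard G)%N.
Proof.
move=> fG; pose s := enum_fset (fset_set G).
have sG k : (k \in s) = (k \in G) by rewrite -(in_fset_set fG).
pose h (u : {ffun 'I_(size s) -> F}) : series F :=
  fun k => if insub (index k s) is Some i then u i else 0.
have [||||ff fn] := @ncard_bij _ _ [set: {ffun 'I_(size s) -> F}] (fns G) h.
- exact: finite_finset.
- move=> u _ k Gk; rewrite /h insubF // index_mem sG.
  by apply: contra_notF Gk => /set_mem.
- move=> u v _ _ uv; apply/ffunP => i.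
  have := congr1 (fun f : series F => f (nth 0%N s i)) uv.
  by rewrite /h index_uniq ?fset_uniq // !valK.
- move=> f Gf; exists [ffun i : 'I_(size s) => f (nth 0%N s i)] => //.
  apply/funext => k; rewrite /h; case: insubP => [i ks ei|].
    by rewrite ffunE ei nth_index // -index_mem.
  rewrite index_mem sG => kG; rewrite Gf // => Gk.
  by move: kG; rewrite mem_set.
split=> //; rewrite fn /ncard -[RHS]/(#|F| ^ size s)%N.
have -> : fset_set [set: {ffun 'I_(size s) -> F}] =
          [fset x in (predT : pred {ffun 'I_(size s) -> F})]%fset.
  apply/fsetP => u; rewrite in_fset_set; last exact: finite_finset.
  by rewrite !inE mem_set.
by rewrite card_finset card_ffun card_ord.
Qed.

End Counting.

(** * Orthogonality with respect to a residue form *)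

Section Perp.
Variable F : fieldType.
Implicit Types (f g : series F) (A B N : set (series F)).

Definition zn (n : nat) : series F := fun k => (k == n)%:R.

Lemma tail_zn n : tail n (zn n).
Proof. by move=> k kn; rewrite /zn ltn_eqF. Qed.

Lemma zn_id n : zn n n = 1. Proof. by rewrite /zn eqxx. Qed.

Lemma val_zn n : has_valuation (zn n) n.
Proof. by split; [rewrite zn_id oner_neq0|exact: tail_zn]. Qed.

Lemma Delta_of_tail K A k : tail K `<=` A -> (K <= k)%N -> Delta A k.
Proof.
move=> tA Kk; exists (zn k); last exact: val_zn.
by apply: tA; apply: tailW Kk _; exact: tail_zn.
Qed.

Definition linear_form (l : series F -> F) : Prop :=
  forall a f g, l (a *: f + g) = a * l f + l g.

Section LinearForm.
Variables (l : series F -> F) (ll : linear_form l).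
Lemma linear_form0 : l 0 = 0.
Proof.
have := ll 1 0 0; rewrite scale1r addr0 mul1r => /eqP.
by rewrite -{1}[l 0]addr0 (inj_eq (addrI _)) eq_sym => /eqP.
Qed.
Lemma linear_formD f g : l (f + g) = l f + l g.
Proof. by rewrite -[f]scale1r ll mul1r scale1r. Qed.
End LinearForm.

(** Reading a coefficient in degree [k] outside [Delta A], after reduction
    modulo [A] to the echelon form. *)
Lemma separating_form K A k : subspace A -> tail K `<=` A -> ~ Delta A k ->
  exists l, [/\ linear_form l, forall f, A f -> l f = 0 &
                forall f, tail k f -> l f = f k].
Proof.
move=> sA tA kA.
have /choice[e eP] : forall f, exists b, A b /\ forall j, Delta A j -> b j = f j.
  by move=> f; have [b Ab eb] := echelon_ex sA f tA; exists b.
exists (fun f => f k - e f k); split.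
- move=> a f g; rewrite [e _](_ : _ = a *: e f + e g).
    by rewrite !coefD_series !coefZ_series; ring.
  apply: (echelon_uniq sA); first by case: (eP (a *: f + g)).
    by case: sA => _; apply; [case: (eP f)|case: (eP g)].
  move=> j Aj; rewrite (eP _).2 // !coefD_series !coefZ_series.
  by rewrite (eP f).2 // (eP g).2.
- move=> f Af; rewrite [e f](_ : _ = f) ?subrr //.
  by apply: (echelon_uniq sA) => //; [case: (eP f)|exact: (eP f).2].
- move=> f tf; suff -> : e f k = 0 by rewrite subr0.
  apply: contrapT => efk; have [|n en] := @val_ex _ (e f).
    by move=> ef0; apply: efk; rewrite ef0.
  have An : Delta A n by exists (e f) => //; case: (eP f).
  have kn : (k <= n)%N.
    by rewrite leqNgt; apply/negP => nk; case: en; rewrite (eP f).2 // tf ?eqxx.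
  have [kn'|kn'] := ltnP k n; first by apply: efk; case: en => _; apply.
  by apply: kA; rewrite (_ : k = n) //; apply/eqP; rewrite eqn_leq kn.
Qed.

Variables (K : nat) (rho : series F -> F).

(** A residue form at [K] pairs the degrees [i] and [K.-1 - i]: it makes
    [F[[z]] / (z ^+ K)] self-dual. *)
Definition residue_form : Prop :=
  [/\ linear_form rho, forall f, tail K f -> rho f = 0, rho (zn K.-1) = 1 &
      (0 < K)%N].

Definition perp A : set (series F) := [set b | forall a, A a -> rho (a * b) = 0].

Hypothesis rhoP : residue_form.
Let rho_lin : linear_form rho. Proof. by case: rhoP. Qed.
Let rho_tail f : tail K f -> rho f = 0. Proof. by case: rhoP => _ + _ _; apply. Qed.
Let K_gt0 : (0 < K)%N. Proof. by case: rhoP. Qed.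

Lemma residue_last f : tail K.-1 f -> rho f = f K.-1.
Proof.
case: rhoP => _ _ rho1 _ tf.
have -> : f = f K.-1 *: zn K.-1 + (f - f K.-1 *: zn K.-1) by rewrite addrC subrK.
rewrite rho_lin rho1 mulr1 rho_tail ?addr0.
  by rewrite coefD_series coefB_series coefZ_series zn_id mulr1 subrr addr0.
rewrite -(prednK K_gt0); apply: tailS => [k kK|].
  by rewrite coefB_series coefZ_series tf // tail_zn // mulr0 subrr.
by rewrite coefB_series coefZ_series zn_id mulr1 subrr.
Qed.

Lemma residue_lead m n f g : tail m f -> tail n g -> (m + n = K.-1)%N ->
  rho (f * g) = f m * g n.
Proof.
move=> tf tg e; have := tailM tf tg; rewrite e => /residue_last ->.
by rewrite -e coefM_lead.
Qed.

Lemma residue_mul_eq0 m n f g : tail m f -> tail n g -> (K <= m + n)%N ->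
  rho (f * g) = 0.
Proof. by move=> tf tg e; apply: rho_tail; apply: tailW e _; exact: tailM. Qed.

Lemma linear_form_ext (l1 l2 : series F -> F) :
  linear_form l1 -> linear_form l2 ->
  (forall f, tail K f -> l1 f = l2 f) ->
  (forall k, (k < K)%N -> l1 (zn k) = l2 (zn k)) -> l1 = l2.
Proof.
move=> l1l l2l et ez; apply/funext.
suff H n : (n <= K)%N -> forall f, tail (K - n) f -> l1 f = l2 f.
  by move=> f; apply: (H K) => //; rewrite subnn.
elim: n => [|n IH] nK f tf; first by apply: et; rewrite subn0 in tf.
pose k := (K - n.+1)%N; have kE : (K - n = k.+1)%N by rewrite /k; lia.
have -> : f = f k *: zn k + (f - f k *: zn k) by rewrite addrC subrK.
rewrite l1l l2l ez; last by rewrite /k; lia.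
congr (_ + _); apply: IH; first exact: ltnW.
rewrite kE; apply: tailS => [j jk|].
  by rewrite coefB_series coefZ_series tf // tail_zn // mulr0 subrr.
by rewrite coefB_series coefZ_series zn_id mulr1 subrr.
Qed.

(** Every linear form on [F[[z]] / (z ^+ K)] is a multiple of the residue
    form: a triangular system, solved from the top degree down. *)
Lemma residue_representation (l : series F -> F) : linear_form l ->
  (forall f, tail K f -> l f = 0) -> exists b, forall f, l f = rho (b * f).
Proof.
move=> ll lt.
suff H n : (n <= K)%N -> exists b, forall k, (K - n <= k < K)%N ->
    l (zn k) = rho (b * zn k).
  have [|b bP] := H K; first by [].
  exists b => f; have -> // : l = fun f => rho (b * f).
  apply: linear_form_ext => // [a g h|g tg|k kK].
  - by rewrite mulrDr scaler_mulr rho_lin.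
  - by rewrite lt // rho_tail //; exact: tail_mulr.
  - by apply: bP; rewrite subnn.
elim: n => [|n IH] nK; first by exists 0 => k; rewrite subn0; lia.
have [b bP] := IH (ltnW nK); pose k0 := (K - n.+1)%N.
exists (b + (l (zn k0) - rho (b * zn k0)) *: zn n) => k kK.
rewrite mulrDl scaler_mull addrC rho_lin.
have [->|kk0] := eqVneq k k0.
  rewrite (@residue_lead n k0 (zn n) (zn k0)); try exact: tail_zn; last by rewrite /k0; lia.
  by rewrite !zn_id !mulr1 subrK.
rewrite (@residue_mul_eq0 n k (zn n) (zn k)) ?mulr0 ?add0r; try exact: tail_zn.
  by apply: bP; move: kk0; rewrite /k0; lia.
by move: kk0; rewrite /k0; lia.
Qed.

Lemma subspace_perp A : subspace (perp A).
Proof.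
split=> [a _|c f g fA gA a Aa]; first by rewrite mulr0 linear_form0.
by rewrite mulrDr scaler_mulr rho_lin fA // gA // mulr0 addr0.
Qed.

Lemma perp_tail A : tail K `<=` perp A.
Proof. by move=> f tf a _; apply: rho_tail; exact: tail_mulr. Qed.

Lemma perpS A B : A `<=` B -> perp B `<=` perp A.
Proof. by move=> AB f fB a /AB /fB. Qed.

Lemma Delta_perp A h : subspace A -> tail K `<=` A ->
  Delta (perp A) h <-> ((K <= h)%N \/ ~ Delta A (K.-1 - h)%N).
Proof.
move=> sA tA; have [Kh|hK] := leqP K h.
  split=> [|_]; first by left.
  exact: (Delta_of_tail (@perp_tail _) Kh).
have eK : (K.-1 - h + h = K.-1)%N by rewrite subnK // -ltnS prednK.
split=> [[b bA [bh tb]]|[//|nA]].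
  right=> -[a Aa [ah ta]].
  have := bA _ Aa; rewrite (residue_lead ta tb eK) => /eqP.
  by rewrite mulf_eq0 (negPf ah) (negPf bh).
have [l [ll lA lk]] := separating_form sA tA nA.
have [|b bP] := residue_representation ll; first by move=> f /tA /lA.
exists b; first by move=> a Aa; rewrite mulrC -bP lA.
set k := (K.-1 - h)%N in nA lk eK; have lz : rho (b * zn k) = 1.
  by rewrite -bP lk ?zn_id //; exact: tail_zn.
have [|j bj] := @val_ex _ b.
  by move=> b0; move/eqP: lz; rewrite b0 mul0r linear_form0 // eq_sym oner_eq0.
suff -> : h = j by [].
apply/eqP; rewrite eqn_leq; apply/andP; split; rewrite leqNgt; apply/negP => lt.
  have tz : tail k (zn (K.-1 - j)) by apply: tailW _ (@tail_zn _); rewrite /k; lia.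
  have := lk _ tz; rewrite bP (residue_lead (val_tail bj) (@tail_zn _)); last by lia.
  rewrite zn_id mulr1 /zn (_ : (_ == _) = false); last by rewrite /k; lia.
  by move/eqP; case: bj => /negPf ->.
move/eqP: lz; rewrite (residue_mul_eq0 (val_tail bj) (@tail_zn _)); last by lia.
by rewrite eq_sym oner_eq0.
Qed.

Lemma perpK A : subspace A -> tail K `<=` A -> perp (perp A) = A.
Proof.
move=> sA tA; symmetry; apply: (@Delta_sub_eq _ K) => //; first exact: subspace_perp.
  by move=> a Aa b bA; rewrite mulrC bA.
move=> h /(Delta_perp _ (@subspace_perp _) (@perp_tail _)).1 [Kh|].
  exact: (Delta_of_tail tA Kh).
have [hK|Kh] := ltnP h K; last first.
  by move=> _; exact: (Delta_of_tail tA Kh).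
move=> nD; apply: contrapT => nA; apply: nD; apply/(Delta_perp _ sA tA); right.
by rewrite (_ : (_ - (_ - _) = h)%N) //; lia.
Qed.

End Perp.

(** * Subspaces with one valuation more, or one valuation less *)

Section Hyperplanes.
Variable F : finFieldType.
Implicit Types (f : series F) (A B M N : set (series F)).

Definition between A B (D : set nat) : set (set (series F)) :=
  [set M | [/\ subspace M, A `<=` M, M `<=` B & Delta M = D]].

(** The line [M / A] has a unique reduced generator: its free coefficients are
    those in the degrees of [Delta B `\` Delta A] above its valuation. *)
Lemma ncard_between_add K A B g : subspace A -> subspace B -> tail K `<=` A ->
  A `<=` B -> Delta B g -> ~ Delta A g ->
  finite_set (between A B (Delta A `|` [set g])) /\
  ncard (between A B (Delta A `|` [set g])) =
    (#|F| ^ ncard [set k | [/\ Delta B k, ~ Delta A k & (g < k)%N]])%N.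
Proof.
move=> sA sB tA AB Bg nAg; set G := [set k | _].
have tB : tail K `<=` B by move=> f /tA /AB.
have fG : finite_set G.
  apply: (@finite_bounded _ K) => k [_ nAk _]; rewrite ltnNge; apply/negP => Kk.
  apply: nAk; exact: (Delta_of_tail tA Kk).
have [ff <-] := ncard_fns F fG.
pose p (u : series F) k : F := if k == g then 1 else u k.
have /choice[v vP] : forall u : series F, exists v, B v /\
    forall k, Delta B k -> v k = p u k.
  by move=> u; have [v Bv ev] := echelon_ex sB (p u) tB; exists v.
have vG u k : fns G u -> Delta B k -> k <> g -> ~ G k -> v u k = 0.
  by move=> uG Bk /eqP/negPf kg nGk; rewrite (vP u).2 // /p kg uG.
have vg u : v u g = 1 by rewrite (vP u).2 // /p eqxx.
have tv u : fns G u -> tail g (v u).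
  move=> uG; have [|n en] := @val_ex _ (v u).
    by move=> e; have := vg u; rewrite e coef0_series => /eqP; rewrite eq_sym oner_eq0.
  have Bn : Delta B n by exists (v u) => //; case: (vP u).
  apply: tailW _ (val_tail en); rewrite leqNgt; apply/negP => ng.
  by case: en; rewrite vG ?eqxx // => [e|[_ _]]; lia.
pose h u := addS A (line (v u)).
have sh u : subspace (h u) by apply: subspace_add => //; exact: subspace_line.
have AH u : A `<=` h u by apply: addSl; exact: subspace_line.
have vh u : h u (v u) by apply: addSr => //; exact: line_self.
have dh u : fns G u -> Delta (h u) = Delta A `|` [set g].
  move=> uG; apply/seteqP; split=> k; last first.
    case=> [|->]; first exact: Delta_sub (AH u) _.
    by exists (v u) => //; split; [rewrite vg oner_neq0|exact: tv].
  move=> [_ [a [_ [Aa [c ->] ->]]] kv].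
  have [c0|c0] := eqVneq c 0.
    by left; exists a => //; rewrite c0 scale0r addr0 in kv.
  have [[j aj]|a0] := pselect (exists j, has_valuation a j); last first.
    right; have {a0} a0 : a = 0 by apply: contrapT => /val_ex.
    apply: (val_uniq kv); rewrite a0 add0r; split.
      by rewrite coefZ_series vg mulr1.
    by move=> i ig; rewrite coefZ_series tv // mulr0.
  have Aj : Delta A j by exists a.
  have [jg|gj|jg] := ltngtP j g; last by case: nAg; rewrite -jg.
    left; rewrite (val_uniq kv (n := j)) //; case: aj => aj ta; split.
      by rewrite coefD_series coefZ_series tv // mulr0 addr0.
    by move=> i ij; rewrite coefD_series coefZ_series ta // tv ?mulr0 ?addr0 //; lia.
  right; apply: (val_uniq kv); split.
    by rewrite coefD_series coefZ_series vg mulr1 (val_tail aj) // add0r.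
  move=> i ig; rewrite coefD_series coefZ_series tv // mulr0 (val_tail aj) ?addr0 //.
  exact: ltn_trans ig gj.
apply: (@ncard_bij _ _ _ _ h) => //.
- move=> u uG; split=> //; last exact: dh.
  move=> _ [a [_ [Aa [c ->] ->]]]; apply: subspaceD => //; first exact: AB.
  by apply: subspaceZ => //; case: (vP u).
- move=> u w uG wG e.
  have e' : v u = v w.
    apply: (echelon_uniq (sh w)) => //; first by rewrite -e.
    move=> k; rewrite dh // => -[Ak|->]; last by rewrite !vg.
    have Bk : Delta B k by exact: Delta_sub Ak.
    have kg : k <> g by move=> kg; apply: nAg; rewrite -kg.
    by rewrite !vG // => -[].
  apply/funext => k; have [Gk|nGk] := pselect (G k); last by rewrite uG // wG.
  have [Bk _ gk] := Gk; have /eqP/negPf kg : k <> g by lia.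
  by have := congr1 (fun f : series F => f k) e'; rewrite /= !(vP _).2 // /p kg.
- move=> M [sM AM MB dM].
  have tM : tail K `<=` M by move=> f /tA /AM.
  have [w Mw ew] := echelon_ex sM (fun k => (k == g)%:R) tM.
  have Mg : Delta M g by rewrite dM; right.
  have tw : tail g w.
    have [|n en] := @val_ex _ w.
      by move=> e; have := ew g Mg; rewrite e eqxx => /eqP; rewrite eq_sym oner_eq0.
    have Mn : Delta M n by exists w.
    apply: tailW _ (val_tail en); rewrite leqNgt; apply/negP => ng.
    by case: en; rewrite ew // ltn_eqF // eqxx.
  pose u : series F := fun k => if k \in G then w k else 0.
  have uG : fns G u by move=> k Gk; rewrite /u memNset.
  have e : v u = w.
    apply: (echelon_uniq sB); [by case: (vP u)|exact: MB|].
    move=> k Bk; rewrite (vP u).2 // /p /u; case: eqVneq => [->|kg].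
      by rewrite ew // eqxx.
    case: ifPn => // /negP kG; have [Ak|nAk] := pselect (Delta A k).
      by rewrite ew ?(negPf kg) // dM; left.
    rewrite tw // ltn_neqAle kg leqNgt; apply/negP => gk; apply: kG.
    by rewrite inE.
  exists u => //; apply: (@Delta_sub_eq _ K) => //.
  + by move=> f /tA /AH.
  + move=> _ [a [_ [Aa [c ->] ->]]]; apply: subspaceD => //; first exact: AM.
    by apply: subspaceZ => //; rewrite e.
  + by rewrite dh // dM.
Qed.

Lemma residue_coef K : (0 < K)%N -> @residue_form F K (fun f => f K.-1).
Proof.
move=> K0; split=> //; last by rewrite zn_id.
by move=> f; apply; rewrite prednK.
Qed.

(** The dual count, transported through orthogonality. *)
Lemma ncard_between_del K A B g : subspace A -> subspace B -> tail K `<=` A ->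
  A `<=` B -> Delta B g -> ~ Delta A g ->
  finite_set (between A B (Delta B `\ g)) /\
  ncard (between A B (Delta B `\ g)) =
    (#|F| ^ ncard [set k | [/\ Delta B k, ~ Delta A k & (k < g)%N]])%N.
Proof.
move=> sA sB tA AB Bg nAg; have tB : tail K `<=` B by move=> f /tA /AB.
have ltK k : ~ Delta A k -> (k < K)%N.
  move=> nAk; rewrite ltnNge; apply/negP => Kk.
  apply: nAk; exact: (Delta_of_tail tA Kk).
have gK := ltK _ nAg; have K0 : (0 < K)%N by exact: leq_ltn_trans gK.
have rP := @residue_coef K K0; set rho := fun f : series F => f K.-1 in rP.
have sP M := @subspace_perp _ _ _ rP M.
have tP M := @perp_tail _ _ _ rP M.
pose g' := (K.-1 - g)%N.
have [||ff e] := @ncard_between_add K (perp rho B) (perp rho A) g'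
    (sP B) (sP A) (tP B) (perpS AB).
- by apply/(Delta_perp rP _ sA tA); right; rewrite (_ : (_ - g')%N = g) // /g'; lia.
- move/(Delta_perp rP _ sB tB) => [|]; first by rewrite /g'; lia.
  by apply; rewrite (_ : (_ - g')%N = g) // /g'; lia.
have [|||f1 e1] := @ncard_bij _ _ _ (between A B (Delta B `\ g)) (perp rho) ff.
- move=> M [sM BM MA dM]; have tM : tail K `<=` M by move=> f /tP /BM.
  split=> //.
  + by rewrite -(perpK rP sA tA); exact: perpS.
  + by rewrite -(perpK rP sB tB); exact: perpS.
  apply/seteqP; split=> k.
    move/(Delta_perp rP _ sM tM); rewrite dM => -[Kk|].
      split; last by rewrite /=; lia.
      exact: (Delta_of_tail tB Kk).
    move=> /not_orP[nD /= kg]; split; last by move=> kg'; apply: kg; rewrite kg'.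
    have [kK|Kk] := ltnP k K; last first.
      exact: (Delta_of_tail tB Kk).
    apply: contrapT => nB; apply: nD; apply/(Delta_perp rP _ sB tB); right.
    by rewrite (_ : (_ - (_ - _) = k)%N) //; lia.
  move=> [Bk /= kg]; apply/(Delta_perp rP _ sM tM); rewrite dM.
  have [kK|] := ltnP k K; last by left.
  right=> -[/(Delta_perp rP _ sB tB)[|]|] /=; first by lia.
    by apply; rewrite (_ : (_ - (_ - _) = k)%N) //; lia.
  by move=> e2; apply: kg; move: e2; rewrite /g'; lia.
- move=> M N [sM BM _ _] [sN BN _ _] e2.
  have tM : tail K `<=` M by move=> f /tP /BM.
  have tN : tail K `<=` N by move=> f /tP /BN.
  by rewrite -(perpK rP sM tM) e2 (perpK rP).
- move=> M [sM AM MB dM]; have tM : tail K `<=` M by move=> f /tA /AM.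
  exists (perp rho M); last exact: (perpK rP).
  split=> //; [exact: perpS|exact: perpS|].
  apply/seteqP; split=> k.
    move/(Delta_perp rP _ sM tM); rewrite dM => -[Kk|].
      by left; apply/(Delta_perp rP _ sB tB); left.
    move=> nD; have [kg|kg] := eqVneq k g'; first by right.
    left; apply/(Delta_perp rP _ sB tB).
    have [kK|] := ltnP k K; last by left.
    by right=> Bk; apply: nD; split=> //= e2; move/eqP: kg; apply; rewrite /g'; lia.
  move=> + ; case=> [/(Delta_perp rP _ sB tB)|] H; apply/(Delta_perp rP _ sM tM); rewrite dM.
    by case: H => [|nB]; [left|right=> -[]].
  by right=> -[_]; apply; rewrite /= H /g'; lia.
split=> //; rewrite e1 e; congr (_ ^ _)%N.
have [|||| _ ->//] := @ncard_bij _ _ [set k | [/\ Delta B k, ~ Delta A k & (k < g)%N]]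
   [set k | [/\ Delta (perp rho A) k, ~ Delta (perp rho B) k & (g' < k)%N]]
   (fun k => (K.-1 - k)%N).
- by apply: (@finite_bounded _ g) => k [].
- move=> k [Bk nAk kg]; have kK := ltK _ nAk; have ek : (K.-1 - (K.-1 - k) = k)%N by lia.
  split; last by rewrite /g'; lia.
    by apply/(Delta_perp rP _ sA tA); right; rewrite ek.
  by move/(Delta_perp rP _ sB tB) => [|]; rewrite ?ek //; lia.
- by move=> k j [_ /ltK kK _] [_ /ltK jK _]; lia.
- move=> k [/(Delta_perp rP _ sA tA) Ak /(Delta_perp rP _ sB tB)/not_orP[kK nBk] gk].
  have {}kK : (k < K)%N by rewrite ltnNge; apply/negP.
  exists (K.-1 - k)%N; last by lia.
  split; [exact: contrapT|by case: Ak => //; lia|by move: gk; rewrite /g'; lia].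
Qed.

End Hyperplanes.

(** * The ring of a branch *)

Section BranchRing.
Variable F : fieldType.
Implicit Types (f g r : series F) (A : set (series F)).

Lemma tail1_exp (x : series F) i : x 0%N = 0 -> tail i (x ^+ i).
Proof.
move=> x0; elim: i => [|i IH]; first exact: tail0.
rewrite exprS -add1n; apply: tailM IH => k; case: k => // _.
Qed.

Lemma triangle_sum n (G : nat -> nat -> F) :
  (forall i k, (n < i + k)%N -> G i k = 0) ->
  \sum_(i < n.+1) \sum_(k < n.+1) G i k =
  \sum_(a < n.+1) \sum_(i < a.+1) G i (a - i)%N.
Proof.
move=> G0.
transitivity (\sum_(i < n.+1) \sum_(a < n.+1 | (i <= a)%N) G i (a - i)%N).
  apply: eq_bigr => i _; have ilen : (i <= n)%N by rewrite -ltnS.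
  rewrite -(big_mkord xpredT (G i)) -(big_mkord (fun a => (i <= a)%N) (fun a => G i (a - i)%N)).
  rewrite (@big_cat_nat _ _ _ (n.+1 - i)) //=; last exact: leq_subr.
  rewrite [X in _ + X]big_nat_cond [X in _ + X]big1 ?addr0; last first.
    by move=> k; rewrite andbT => /andP[k1 k2]; apply: G0; lia.
  rewrite [RHS](@big_cat_nat _ _ _ i) //=; last by rewrite ltnW.
  rewrite [X in _ = X + _]big_nat_cond [X in _ = X + _]big1 ?add0r; last first.
    by move=> k /andP[/andP[k1 k2] k3]; lia.
  have := big_addn 0 n.+1 i (fun a => (i <= a)%N) (fun a => G i (a - i)%N).
  rewrite add0n => ->; rewrite big_nat_cond [RHS]big_nat_cond.
  apply: eq_big => [k|k _]; first by rewrite andbT leq_addl andbT.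
  by rewrite addnK.
rewrite (exchange_big_dep xpredT) //=; apply: eq_bigr => a _.
rewrite -(big_mkord (fun i => (i <= a)%N) (fun i => G i (a - i)%N)).
rewrite -(big_mkord xpredT (fun i => G i (a - i)%N)).
rewrite big_nat_cond [RHS]big_nat_cond (@big_cat_nat _ _ _ a.+1) //=.
rewrite [X in _ + X]big_nat_cond [X in _ + X]big1 ?addr0.
  rewrite big_nat_cond [RHS]big_nat_cond; apply: eq_bigl => k.
  by have := ltn_ord a; lia.
by move=> k; lia.
Qed.

Section OneRing.
Variables (x y : series F) (x0 : x 0%N = 0) (y0 : y 0%N = 0).
Local Notation R := (branch_ring x y).

Definition ser2 (c : nat -> nat -> F) : series F :=
  fun n => \sum_(i < n.+1) \sum_(j < n.+1) c i j * (x ^+ i * y ^+ j) n.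

Lemma branchP f : R f <-> exists c, f = ser2 c.
Proof.
split=> [[c fc]|[c ->]]; first by exists c; apply/funext.
by exists c.
Qed.

Lemma tail_monomial i j : @tail F (i + j) (x ^+ i * y ^+ j).
Proof. by apply: tailM; exact: tail1_exp. Qed.

Lemma ser2_trunc c N n : (n <= N)%N ->
  ser2 c n = (\sum_(i < N.+1) \sum_(j < N.+1) c i j *: (x ^+ i * y ^+ j)) n.
Proof.
move=> nN; rewrite coef_sum_series /ser2.
rewrite (big_ord_widen N.+1 (fun i => \sum_(j < n.+1) c i j * (x ^+ i * y ^+ j) n)) //.
rewrite big_mkcond; apply: eq_bigr => i _; rewrite coef_sum_series; case: ltnP => ni.
  rewrite (big_ord_widen N.+1 (fun j => c i j * (x ^+ i * y ^+ j) n)) //.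
  rewrite big_mkcond; apply: eq_bigr => j _; rewrite coefZ_series; case: ltnP => // nj.
  by rewrite tail_monomial ?mulr0 //; lia.
by rewrite big1 // => j _; rewrite coefZ_series tail_monomial ?mulr0 //; lia.
Qed.

Lemma branch_subspace : subspace R.
Proof.
split.
  by exists (fun _ _ => 0) => n; rewrite big1 // => i _; rewrite big1 // => j _; rewrite mul0r.
move=> a _ _ /branchP[c ->] /branchP[d ->].
exists (fun i j => a * c i j + d i j) => n.
rewrite coefD_series coefZ_series /ser2 big_distrr -big_split; apply: eq_bigr => i _ /=.
rewrite big_distrr -big_split; apply: eq_bigr => j _ /=.
by rewrite mulrDl mulrA.
Qed.

Lemma branch_mul f g : R f -> R g -> R (f * g).
Proof.
move=> /branchP[c ->] /branchP[d ->].
exists (fun a b => \sum_(i < a.+1) \sum_(j < b.+1) c i j * d (a - i)%N (b - j)%N) => n.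
pose P (e : nat -> nat -> F) := \sum_(i < n.+1) \sum_(j < n.+1) e i j *: (x ^+ i * y ^+ j).
transitivity ((P c * P d) n).
  rewrite !coefM_series; apply: eq_bigr => k _.
  by rewrite (@ser2_trunc _ n) -1?ltnS // (@ser2_trunc _ n) // leq_subr.
pose T i j k l := c i j * d k l * (x ^+ (i + k) * y ^+ (j + l)) n.
have T0 i j k l : (n < (i + k) + (j + l))%N -> T i j k l = 0.
  by move=> nlt; rewrite /T tail_monomial ?mulr0.
transitivity (\sum_(i < n.+1) \sum_(k < n.+1) \sum_(j < n.+1) \sum_(l < n.+1) T i j k l).
  rewrite /P mulr_suml coef_sum_series; apply: eq_bigr => i _.
  rewrite mulr_sumr coef_sum_series; apply: eq_bigr => k _.
  rewrite mulr_suml coef_sum_series; apply: eq_bigr => j _.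
  rewrite mulr_sumr coef_sum_series; apply: eq_bigr => l _.
  rewrite scaler_mull scaler_mulr !coefZ_series mulrA; congr (_ * _).
  by rewrite mulrACA -!exprD.
rewrite (triangle_sum (G := fun i k => \sum_(j < n.+1) \sum_(l < n.+1) T i j k l)); last first.
  by move=> i k nlt; rewrite big1 // => j _; rewrite big1 // => l _; apply: T0; lia.
apply: eq_bigr => a _.
transitivity (\sum_(i < a.+1) \sum_(b < n.+1) \sum_(j < b.+1) T i j (a - i)%N (b - j)%N).
  apply: eq_bigr => i _; rewrite (triangle_sum (G := fun j l => T i j (a - i)%N l)) //.
  by move=> j l nlt; apply: T0; lia.
rewrite exchange_big; apply: eq_bigr => b _ /=.
rewrite big_distrl; apply: eq_bigr => i _ /=.
rewrite big_distrl; apply: eq_bigr => j _ /=.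
by rewrite /T !subnKC // -ltnS.
Qed.

Definition ser1 (p : nat -> F) (w : series F) : series F :=
  fun n => \sum_(j < n.+1) p j * (w ^+ j) n.

Lemma branch_ser1y p : R (ser1 p y).
Proof.
exists (fun i j => if i == 0%N then p j else 0) => n.
rewrite big_ord_recl /= [X in _ + X]big1 ?addr0.
  by apply: eq_bigr => j _; rewrite expr0 mul1r.
by move=> i _; rewrite big1 // => j _; rewrite mul0r.
Qed.

Lemma ser1_1 w : ser1 (fun j => (j == 0%N)%:R) w = 1.
Proof.
apply/funext => n; rewrite /ser1 big_ord_recl /= [X in _ + X]big1 ?addr0.
  by rewrite mul1r expr0.
by move=> j _; rewrite mul0r.
Qed.

Lemma branch1 : R 1. Proof. by rewrite -(ser1_1 y); exact: branch_ser1y. Qed.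

Lemma branch_split f : R f -> exists r p, R r /\ f = x * r + ser1 p y.
Proof.
move=> /branchP[c ->]; pose c' i j := c i.+1 j.
exists (ser2 c'), (c 0%N); split; first by exists c'.
apply/funext => n; rewrite coefD_series {1}/ser2 big_ord_recl /= addrC; congr (_ + _).
  transitivity ((x * \sum_(i < n.+1) \sum_(j < n.+1) c' i j *: (x ^+ i * y ^+ j)) n).
    rewrite mulr_sumr coef_sum_series [RHS]big_ord_recr /= [X in _ = _ + X](_ : _ = 0) ?addr0.
      apply: eq_bigr => i _; rewrite mulr_sumr coef_sum_series; apply: eq_bigr => j _.
      by rewrite scaler_mulr coefZ_series exprS mulrA.
    rewrite mulr_sumr coef_sum_series big1 // => j _.
    rewrite scaler_mulr coefZ_series mulrA -exprS tail_monomial ?mulr0 //; lia.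
  rewrite !coefM_series; apply: eq_bigr => k _; congr (_ * _).
  by rewrite (@ser2_trunc _ n) // leq_subr.
by apply: eq_bigr => j _; rewrite expr0 mul1r.
Qed.

Lemma ser1_split p (w : series F) : w 0%N = 0 ->
  ser1 p w = p 0%N *: (1 : series F) + w * ser1 (fun j => p j.+1) w.
Proof.
move=> w0; apply/funext => n; rewrite coefD_series coefZ_series {1}/ser1 big_ord_recl /=.
congr (_ + _).
transitivity ((w * \sum_(j < n.+1) p j.+1 *: (w ^+ j)) n).
  rewrite mulr_sumr coef_sum_series [RHS]big_ord_recr /= [X in _ = _ + X](_ : _ = 0) ?addr0.
    by apply: eq_bigr => i _; rewrite scaler_mulr coefZ_series exprS.
  by rewrite scaler_mulr -exprS coefZ_series (@tail1_exp w n.+1 w0) ?mulr0.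
rewrite !coefM_series; apply: eq_bigr => k _; congr (_ * _).
rewrite coef_sum_series /ser1.
rewrite [RHS](big_ord_widen n.+1 (fun j => p j.+1 * (w ^+ j) (n - k)%N)) ?ltnS ?leq_subr //.
rewrite [RHS]big_mkcond; apply: eq_bigr => j _; rewrite coefZ_series; case: ltnP => // nj.
by rewrite (@tail1_exp w j w0) ?mulr0.
Qed.

End OneRing.

Lemma branch_swap (x y : series F) f : branch_ring x y f -> branch_ring y x f.
Proof.
move=> [c fc]; exists (fun i j => c j i) => n; rewrite fc exchange_big.
by apply: eq_bigr => i _; apply: eq_bigr => j _; rewrite mulrC [x ^+ _ * _]mulrC mulrC.
Qed.

Lemma branch_swapE (x y : series F) : branch_ring x y = branch_ring y x.
Proof. by apply/seteqP; split=> f; exact: branch_swap. Qed.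

Section Conductor.
Variables (x y : series F) (x0 : x 0%N = 0) (y0 : y 0%N = 0).
Local Notation R := (branch_ring x y).

Lemma branch_ser1x p : R (ser1 p x).
Proof. by rewrite branch_swapE; exact: branch_ser1y. Qed.

Lemma branch_gen (w : series F) : w 0%N = 0 -> (forall p, R (ser1 p w)) -> R w.
Proof.
move=> w0 Rw; have := Rw (fun j => (j == 1%N)%:R).
by rewrite ser1_split // scale0r add0r ser1_1 mulr1.
Qed.

Lemma branch_x : R x. Proof. by apply: branch_gen => //; exact: branch_ser1x. Qed.
Lemma branch_y : R y. Proof. by apply: branch_gen => //; exact: branch_ser1y. Qed.

Lemma branch_max_split f : R f -> f 0%N = 0 ->
  exists r s, [/\ R r, R s & f = x * r + y * s].
Proof.
move=> /(branch_split x0 y0)[r [p [Rr ->]]]; rewrite ser1_split // !coefD_series.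
rewrite !coefM_series !big_ord1 /= x0 y0 !mul0r add0r addr0 coefZ_series mulr1 => p0.
exists r, (ser1 (fun j => p j.+1) y); split=> //; first exact: branch_ser1y.
by rewrite p0 scale0r add0r.
Qed.

Lemma zn_mul n f k : (zn F n * f) k = if (k < n)%N then 0 else f (k - n)%N.
Proof.
case: ltnP => kn; first by apply: (tailM (@tail_zn F n) (@tail0 F f)); rewrite addn0.
rewrite coefM_series; have nk : (n < k.+1)%N by [].
rewrite (bigD1 (Ordinal nk)) //= zn_id mul1r big1 ?addr0 // => i ni.
rewrite /zn (_ : (_ == _) = false) ?mul0r //; apply: contraNF ni => e.
by apply/eqP/val_inj/eqP.
Qed.

Lemma val_div e w m f : has_valuation w e -> tail (e + m) f ->
  exists2 g, tail m g & f = w * g.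
Proof.
move=> [we tw] tf.
have shift n (h : series F) : tail n h -> h = zn F n * (fun k => h (n + k)%N).
  move=> th; apply/funext => k; rewrite zn_mul; case: ltnP => [/th//|nk].
  by rewrite subnKC.
set u : series F := fun k => w (e + k)%N; set f' : series F := fun k => f (e + k)%N.
have [|v uv] := @series_inv _ u; first by rewrite /u addn0.
exists (v * f').
  by apply: tail_mulr => k km; apply: tf; rewrite ltn_add2l.
rewrite (shift _ _ tw) -/u -mulrA [u * _]mulrA uv mul1r.
by apply: shift; apply: tailW tf; exact: leq_addr.
Qed.

(** A series of order at least [C] is reduced along [e] elements of the ring of
    consecutive orders, divided by [x], and reduced again; collecting the powers
    of [x] writes it as a combination of these [e] elements with coefficients in
    [F[[x]]]. *)
Lemma conductor_tail C e : has_valuation x e -> (0 < e)%N ->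
  (forall n, (C <= n)%N -> Delta R n) -> tail C `<=` R.
Proof.
move=> xe e0 dR.
have /choice[b bP] : forall j, exists b, [/\ R b, tail (C + j) b & b (C + j)%N = 1].
  by move=> j; apply: (Delta_monic (branch_subspace x y)); apply: dR; exact: leq_addr.
have red g : tail C g -> forall i, exists a : nat -> F,
    tail (C + i) (g - \sum_(j < i) a j *: b j).
  move=> tg; elim=> [|i [a ta]].
    by exists (fun=> 0); rewrite big_ord0 subr0 addn0.
  set d := _ - _ in ta; exists (fun j => if j == i then d (C + i)%N else a j).
  rewrite big_ord_recr /= eqxx opprD addrA.
  rewrite (eq_bigr (fun j : 'I_i => a j *: b j)) => [|j _]; last by rewrite ltn_eqF.
  have [_ tb b1] := bP i; rewrite addnS; apply: tailS => [k ki|].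
    by rewrite coefB_series coefZ_series tb // mulr0 subr0; apply: ta.
  by rewrite coefB_series coefZ_series b1 mulr1 subrr.
have /choice[st stP] : forall g, exists s : (nat -> F) * series F, tail C g ->
    tail C s.2 /\ g = \sum_(j < e) s.1 j *: b j + x * s.2.
  move=> g; have [tg|] := pselect (tail C g); last by exists (fun=> 0, 0).
  have [a] := red g tg e; rewrite addnC => /(val_div xe)[h th eh].
  by exists (a, h) => _; split=> //=; rewrite -eh addrC subrK.
move=> g tg; pose G k := iter k (fun h => (st h).2) g.
have tG k : tail C (G k) by elim: k => //= k /stP[].
have gE N : g = \sum_(k < N) x ^+ k * (\sum_(j < e) (st (G k)).1 j *: b j) + x ^+ N * G N.
  elim: N => [|N IH]; first by rewrite big_ord0 add0r mul1r.
  rewrite {1}IH big_ord_recr /= -addrA; congr (_ + _).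
  by rewrite exprSr -mulrA -mulrDr -(stP _ (tG N)).2.
suff -> : g = \sum_(j < e) ser1 (fun k => (st (G k)).1 j) x * b j.
  apply: (subspace_sum (branch_subspace x y)) => j _; apply: branch_mul => //.
    exact: branch_ser1x.
  by case: (bP j).
apply/funext => n; rewrite {1}(gE n.+1) coefD_series [X in _ + X](_ : _ = 0); last first.
  have tx : tail n.+1 (G n.+1 * x ^+ n.+1) by apply: tail_mulr; exact: tail1_exp.
  by rewrite mulrC tx.
rewrite addr0 !coef_sum_series.
transitivity (\sum_(j < e) \sum_(k < n.+1) (x ^+ k * ((st (G k)).1 j *: b j)) n).
  rewrite [RHS]exchange_big; apply: eq_bigr => k _ /=.
  by rewrite mulr_sumr coef_sum_series.
apply: eq_bigr => j _.
transitivity (((\sum_(k < n.+1) (st (G k)).1 j *: x ^+ k) * b j) n).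
  rewrite mulr_suml coef_sum_series; apply: eq_bigr => k _.
  by rewrite scaler_mulr scaler_mull.
rewrite !coefM_series; apply: eq_bigr => i _; congr (_ * _).
rewrite coef_sum_series /ser1.
rewrite [RHS](big_ord_widen n.+1 (fun k => (st (G k)).1 j * (x ^+ k) i)) //.
rewrite [RHS]big_mkcond; apply: eq_bigr => k _; rewrite coefZ_series; case: ltnP => // ik.
by rewrite tail1_exp ?mulr0.
Qed.

End Conductor.

End BranchRing.

(** * Dimensions of quotients and finiteness *)

Section Dimension.
Variable F : finFieldType.
Implicit Types (f : series F) (M N : set (series F)).

(** Two bases of a quotient have the same size since both count its elements. *)
Lemma basis_mod_uniq N M d d' v v' : subspace N -> subspace M ->
  @basis_mod F N M d v -> @basis_mod F N M d' v' -> d = d'.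
Proof.
move=> sN sM.
suff le d1 d2 v1 v2 : @basis_mod F N M d1 v1 -> @basis_mod F N M d2 v2 ->
    (d1 <= d2)%N.
  by move=> b b'; apply/eqP; rewrite eqn_leq (le _ _ _ _ b b') (le _ _ _ _ b' b).
move=> [Mv1 b1] [Mv2 b2]; have q1 : (1 < #|F|)%N by exact: card_finNzRing_gt1.
pose w (c : 'rV[F]_d1) : series F := \sum_i c 0 i *: v1 i.
have Mw c : M (w c) by apply: subspace_sum => // i _; apply: subspaceZ.
have /choice[h hP] : forall c, exists e : 'rV[F]_d2, N (w c - \sum_i e 0 i *: v2 i).
  by move=> c; have [e [ne _]] := b2 _ (Mw c); exists e.
suff hi : injective h.
  by have := leq_card h hi; rewrite !card_mx !mul1n leq_exp2l.
move=> c c' e; have [e0 [_ eu]] := b1 _ (Mw c).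
have <- : e0 = c by apply: eu; rewrite -/(w c) subrr; exact: subspace0.
apply: eu; rewrite -/(w c').
have -> : w c - w c' = (w c - \sum_i h c 0 i *: v2 i) - (w c' - \sum_i h c 0 i *: v2 i).
  by rewrite opprB addrA subrK.
by apply: subspaceB => //; rewrite e.
Qed.

(** The reduced elements of [M] of leading degrees in [Delta M `\` Delta N]
    represent a basis of [M / N]. *)
Lemma dim_quotE K N M : subspace N -> subspace M -> tail K `<=` N -> N `<=` M ->
  dim_quot N M = ncard (Delta M `\` Delta N).
Proof.
move=> sN sM tN NM; have tM : tail K `<=` M by move=> f /tN /NM.
set G := Delta M `\` Delta N; have fG : finite_set G.
  apply: (@finite_bounded _ K) => k [_ nNk]; rewrite ltnNge; apply/negP => Kk.
  apply: nNk; exact: (Delta_of_tail tN Kk).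
set d := ncard G; pose s := enum_fset (fset_set G).
have sG k : (k \in s) = (k \in G) by rewrite -(in_fset_set fG).
have us : uniq s by exact: fset_uniq.
have /choice[v vP] : forall i : 'I_d, exists v, M v /\
    forall k, Delta M k -> v k = (k == nth 0%N s i)%:R.
  by move=> i; have [v Mv ev] := echelon_ex sM (fun k => (k == nth 0%N s i)%:R) tM; exists v.
have Gs (i : 'I_d) : G (nth 0%N s i) by apply/set_mem; rewrite -sG mem_nth.
have tv (i : 'I_d) : tail (nth 0%N s i) (v i).
  have [|n en] := @val_ex _ (v i).
    move=> e; have := (vP i).2 _ (Gs i).1; rewrite e eqxx => /eqP.
    by rewrite eq_sym oner_eq0.
  have Mn : Delta M n by exists (v i) => //; case: (vP i).
  apply: tailW _ (val_tail en); rewrite leqNgt; apply/negP => ng.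
  by case: en; rewrite (vP i).2 // ltn_eqF // eqxx.
have vs (i j : 'I_d) : v i (nth 0%N s j) = (i == j)%:R.
  rewrite (vP i).2; last exact: (Gs j).1.
  by rewrite nth_uniq // eq_sym.
suff b : @basis_mod F N M d v.
  have ex : [set d | exists v, @basis_mod F N M d v] !=set0 by exists d, v.
  have [v' b'] := getPex ex; exact: basis_mod_uniq b' b.
split=> [i|f Mf]; first by case: (vP i).
pose S : set (series F) := [set g | exists c : 'rV[F]_d, g = \sum_i c 0 i *: v i].
have sS : subspace S.
  split; first by exists 0; rewrite big1 // => i _; rewrite mxE scale0r.
  move=> a _ _ [c ->] [e ->]; exists (a *: c + e).
  rewrite scaler_sumr -big_split; apply: eq_bigr => i _ /=.
  by rewrite !mxE scalerDl scalerA.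
have vS i : S (v i).
  exists (\row_j (i == j)%:R); rewrite (bigD1 i) //= mxE eqxx scale1r big1 ?addr0 //.
  by move=> j /negPf ji; rewrite mxE eq_sym ji scale0r.
have eM : addS N S = M.
  apply: (@Delta_sub_eq _ K) => //; first exact: subspace_add.
  - by move=> g /tN; exact: addSl.
  - move=> _ [n [_ [Nn [c ->] ->]]]; apply: subspaceD => //; first exact: NM.
    by apply: subspace_sum => // i _; apply: subspaceZ => //; case: (vP i).
  move=> k Mk; have [Nk|nNk] := pselect (Delta N k).
    exact: Delta_sub (addSl sS) _ Nk.
  have ks : k \in s by rewrite sG inE.
  have id : (index k s < d)%N by rewrite index_mem.
  exists (v (Ordinal id)); first exact: addSr.
  have tk := tv (Ordinal id); have vk := vs (Ordinal id) (Ordinal id).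
  by rewrite /= nth_index // eqxx in tk vk; split=> //; rewrite vk oner_neq0.
have [n [_ [Nn [c ->] fE]]] : addS N S f by rewrite eM.
exists c; split=> [|c' Nc']; first by rewrite fE addrK.
apply/rowP => i; apply/eqP; rewrite -subr_eq0; apply/eqP.
pose w := \sum_j (c 0 j - c' 0 j) *: v j.
have Nw : N w.
  have -> : w = (f - \sum_j c' 0 j *: v j) - n.
    rewrite fE /w addrAC [n + _]addrC addrK -sumrB.
    by apply: eq_bigr => j _; rewrite scalerBl.
  exact: subspaceB.
have w0 : w = 0.
  apply: (echelon_uniq sN) => // [|k Nk]; first exact: subspace0.
  rewrite /w coef_sum_series big1 // => j _; rewrite coefZ_series (vP j).2.
    rewrite (_ : (_ == _) = false) ?mulr0 //; apply/eqP => kj.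
    by case: (Gs j) => _; apply; rewrite -kj.
  exact: Delta_sub NM _ Nk.
have := congr1 (fun f : series F => f (nth 0%N s i)) w0.
rewrite /w coef_sum_series (bigD1 i) //= coefZ_series vs eqxx mulr1 big1 ?addr0 //.
by move=> j /negPf ji; rewrite coefZ_series vs ji mulr0.
Qed.

(** Such a subspace is the preimage of a set of truncations. *)
Lemma finite_subspaces K :
  finite_set [set M : set (series F) | subspace M /\ tail K `<=` M].
Proof.
pose tr f : {ffun 'I_K -> F} := [ffun i : 'I_K => f i].
pose dec (S : {set {ffun 'I_K -> F}}) : set (series F) := [set f | tr f \in S].
apply: (@finset_fintype _ _ dec) => M [sM tM].
exists (finset (fun u => `[< exists2 f, M f & tr f = u >])).
apply/seteqP; split=> f; rewrite /dec /= inE; last by move=> Mf; apply/asboolP; exists f.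
move/asboolP=> [g Mg e]; rewrite -(subrK g f); apply: subspaceD => //; apply: tM => k kK.
have := congr1 (fun u : {ffun 'I_K -> F} => u (Ordinal kK)) e.
by rewrite !ffunE /= coefB_series => ->; rewrite subrr.
Qed.

End Dimension.

(** * Modules over the ring of a branch *)

(** All standard modules then contain [tail C], so that they are finite in
    number and their invariants are read off modulo a power of [z]. *)
Definition conductor_at (F : fieldType) (x y : series F) (C : nat) : Prop :=
  [/\ x 0%N = 0, y 0%N = 0, (0 < C)%N & tail C `<=` branch_ring x y].

Section Modules.
Variables (F : finFieldType) (x y : series F) (C : nat).
Hypothesis HC : conductor_at x y C.
Local Notation R := (branch_ring x y).
Local Notation Gam := (Gamma x y).
Local Notation mm := (max_ideal x y).
Local Notation mulm := (max_ideal_mul x y).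
Implicit Types (f g r : series F) (A M N : set (series F)).

Let x0 : x 0%N = 0. Proof. by case: HC. Qed.
Let y0 : y 0%N = 0. Proof. by case: HC. Qed.
Let C0 : (0 < C)%N. Proof. by case: HC. Qed.
Let tC : tail C `<=` R. Proof. by case: HC. Qed.
Local Notation K := (C + C)%N.

Let sR : subspace R. Proof. exact: branch_subspace. Qed.
Let R1 : R 1. Proof. exact: branch1. Qed.

Lemma submodule_subspace M : is_submodule x y M -> subspace M.
Proof.
move=> [M0 MD MR]; split=> // a f g Mf Mg; apply: MD => //.
by rewrite -[f]mul1r -scaler_mull; apply: MR => //; exact: subspaceZ.
Qed.

Lemma submoduleM M r f : is_submodule x y M -> R r -> M f -> M (r * f).
Proof. by move=> [_ _]; apply. Qed.

Lemma submodule_branch : is_submodule x y R.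
Proof.
by split; [exact: subspace0|move=> f g; exact: subspaceD|move=> r f; exact: branch_mul].
Qed.

Lemma submodule_tail n : is_submodule x y (@tail F n).
Proof.
split; first by [].
  by move=> f g tf tg k kn; rewrite coefD_series tf // tg // addr0.
by move=> r f _; exact: tail_mulr.
Qed.

Lemma submodule_add M N : is_submodule x y M -> is_submodule x y N ->
  is_submodule x y (addS M N).
Proof.
move=> sM sN; have [s0 sD] := subspace_add (submodule_subspace sM) (submodule_subspace sN).
split=> // [f g Mf Mg|r _ Rr [a [b [Ma Nb ->]]]].
  by rewrite -[f]scale1r; exact: sD.
by exists (r * a), (r * b); rewrite mulrDr; split=> //; exact: submoduleM.
Qed.

Lemma standard_tail M : standard x y M -> @tail F C `<=` M.
Proof.
move=> [sM [u Mu u1]] f tf.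
have [|g tg ->] := @val_div F 0 u C f _ tf.
  by split=> //; rewrite u1 oner_neq0.
by rewrite mulrC; apply: submoduleM => //; exact: tC.
Qed.

Lemma standard_tailK M : standard x y M -> @tail F K `<=` M.
Proof. by move=> /standard_tail tM f /(tailW (leq_addr _ _)) /tM. Qed.

Lemma standardP M : standard x y M <-> is_submodule x y M /\ Delta M 0.
Proof.
split=> [[sM [u Mu u1]]|[sM /(Delta_monic (submodule_subspace sM))[v [Mv _ v1]]]].
  by split=> //; exists u => //; split=> //; rewrite u1 oner_neq0.
by split=> //; exists v.
Qed.

Lemma DeltaM M a d : is_submodule x y M -> Gam a -> Delta M d -> Delta M (a + d).
Proof.
move=> sM [r Rr rg] [f Mf fd]; exists (r * f); [exact: submoduleM|exact: valM].
Qed.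

Lemma Gamma0 : Gam 0.
Proof. by exists 1 => //; split=> //; rewrite coef1_series oner_neq0. Qed.

Lemma Gamma_tail n : (C <= n)%N -> Gam n.
Proof.
move=> Cn; exact: (Delta_of_tail tC Cn).
Qed.

Lemma mulm_in M a v : mm a -> M v -> mulm M (a * v).
Proof. by move=> ma Mv; exists 1%N, (fun=> a), (fun=> v); rewrite big_ord1. Qed.

Lemma mulm_min M A : A 0 -> (forall f g, A f -> A g -> A (f + g)) ->
  (forall a v, mm a -> M v -> A (a * v)) -> mulm M `<=` A.
Proof.
move=> A0 AD Am _ [n [a [v [ma Mv ->]]]].
by apply: (big_ind A) => // i _; exact: Am.
Qed.

Lemma mulmS M N : M `<=` N -> mulm M `<=` mulm N.
Proof. by move=> MN _ [n [a [v [ma Mv ->]]]]; exists n, a, v; split=> // i; exact: MN. Qed.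

Lemma mulm0 M : mulm M 0.
Proof. by exists 0%N, (fun=> 0), (fun=> 0); rewrite big_ord0; split=> // -[]. Qed.

Lemma mulmD M f g : mulm M f -> mulm M g -> mulm M (f + g).
Proof.
move=> [n [a [v [ma Mv ->]]]] [k [b [w [mb Mw ->]]]].
exists (n + k)%N, (fun i => match fintype.split i with inl j => a j | inr j => b j end),
  (fun i => match fintype.split i with inl j => v j | inr j => w j end).
split=> [i|i|]; [by case: fintype.split|by case: fintype.split|].
rewrite big_split_ord /=; congr (_ + _); apply: eq_bigr => i _.
  by rewrite (unsplitK (inl i)).
by rewrite (unsplitK (inr i)).
Qed.

Lemma mulm_submodule M : is_submodule x y M -> is_submodule x y (mulm M).
Proof.
move=> sM; split; [exact: mulm0|exact: mulmD|].
move=> r _ Rr [n [a [v [ma Mv ->]]]]; rewrite mulr_sumr.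
apply: (big_ind (mulm M)); [exact: mulm0|exact: mulmD|move=> i _].
by rewrite mulrCA; apply: mulm_in => //; exact: submoduleM.
Qed.

Lemma mulm_sub M : is_submodule x y M -> mulm M `<=` M.
Proof.
move=> sM; have [M0 MD _] := sM.
by apply: mulm_min => // a v [Ra _] Mv; exact: submoduleM.
Qed.

Lemma max_ideal_tail a : mm a -> tail 1 a.
Proof. by move=> [_ a0] [|k]. Qed.

Lemma mulm_shift n M : M `<=` @tail F n -> mulm M `<=` @tail F n.+1.
Proof.
move=> Mn; apply: mulm_min => //.
  by move=> f g; exact: (subspaceD (@subspace_tail F n.+1)).
by move=> a v /max_ideal_tail ta /Mn tv; rewrite -add1n; exact: tailM.
Qed.

Lemma mulm_tailK M : standard x y M -> @tail F K `<=` mulm M.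
Proof.
move=> stM f tf.
have zC := @val_zn F C.
have [g tg ->] := val_div zC tf; apply: mulm_in; last exact: standard_tail.
by split; [apply: tC; exact: tail_zn|exact: (@tail_zn F C)].
Qed.

(** Constants act by scaling, and the maximal ideal maps [M] into [A]. *)
Lemma sub_mulm_submodule M A : is_submodule x y M -> subspace A ->
  mulm M `<=` A -> A `<=` M -> is_submodule x y A.
Proof.
move=> sM sA mA AM; split; [exact: subspace0|exact: subspaceD|].
move=> r f Rr Af; have -> : r * f = (r - r 0%N *: (1 : series F)) * f + r 0%N *: f.
  by rewrite mulrBl scaler_mull mul1r subrK.
apply: subspaceD => //; last exact: subspaceZ.
apply: mA; apply: mulm_in; last exact: AM.
split; first by apply: subspaceB => //; exact: subspaceZ.
by rewrite coefB_series coefZ_series mulr1 subrr.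
Qed.

(** Iterating the inclusion pushes the error term into [tail n] for all [n],
    and [Y] absorbs it for [n = K]. *)
Lemma nakayama M Y : is_submodule x y M -> is_submodule x y Y ->
  @tail F K `<=` Y -> Y `<=` M -> M `<=` addS Y (mulm M) -> M = Y.
Proof.
move=> sM sY tY YM MYm; apply/seteqP; split=> //.
have sYv := submodule_subspace sY.
suff H n : M `<=` addS Y (@tail F n).
  by move=> f /(H K)[a [b [Ya /tY Yb ->]]]; exact: subspaceD.
elim: n => [|n IH]; first by move=> f _; apply: addSr.
have sYt := subspace_add sYv (@subspace_tail F n.+1).
have mY : mulm M `<=` addS Y (@tail F n.+1).
  apply: mulm_min; [exact: subspace0|exact: subspaceD|move=> a v ma /IH[b [t [Yb tt ->]]]].
  rewrite mulrDr; exists (a * b), (a * t); split=> //.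
    by apply: submoduleM => //; case: ma.
  by rewrite -add1n; apply: tailM => //; exact: max_ideal_tail.
move=> f /MYm[a [b [Ya /mY Yb ->]]]; apply: subspaceD => //.
by apply: addSl => //; exact: subspace_tail.
Qed.

Lemma deg_gaps M : standard x y M -> deg M = gaps (Delta M).
Proof.
move=> stM; have [sM _] := stM.
rewrite /deg (@dim_quotE F K M setT) //; [|exact: submodule_subspace|exact: standard_tailK].
rewrite /gaps /ncard; congr (#|` fset_set _|); apply/seteqP; split=> k //=.
  by case.
move=> nM; split=> //; exists (zn F k) => //.
exact: val_zn.
Qed.

Definition labels M : set nat := Delta M `\` Delta (mulm M).

Lemma qrankE M : standard x y M -> qrank x y M = ncard (labels M).
Proof.
move=> stM; have [sM _] := stM.
apply: (@dim_quotE F K); [|exact: submodule_subspace|exact: mulm_tailK|exact: mulm_sub].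
exact: submodule_subspace (mulm_submodule sM).
Qed.

Lemma finite_standard : finite_set (standard x y).
Proof.
apply: sub_finite_set (finite_subspaces F K) => M stM; have [sM _] := stM.
by split; [exact: submodule_subspace|exact: standard_tailK].
Qed.

Lemma standard_gaps_finite M : standard x y M -> finite_set (~` Delta M).
Proof.
move=> stM; apply: (@finite_bounded _ C) => k nMk; rewrite ltnNge; apply/negP => Ck.
exact/nMk/(Delta_of_tail (standard_tail stM) Ck).
Qed.

Lemma standard_Delta M : standard x y M -> standard_gamma Gam (Delta M).
Proof. by move=> /standardP[sM M0]; split=> // m n; exact: DeltaM. Qed.

(** ** Multiplication by units *)

Definition scale (u : series F) M : set (series F) := [set f | exists2 g, M g & f = u * g].

Lemma scaleK (u v : series F) M : u * v = 1 -> scale u (scale v M) = M.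
Proof.
move=> uv; apply/seteqP; split=> [_ [_ [g Mg ->] ->]|f Mf].
  by rewrite mulrA uv mul1r.
by exists (v * f); [exists f|rewrite mulrA uv mul1r].
Qed.

Lemma scale_submodule u M : is_submodule x y M -> is_submodule x y (scale u M).
Proof.
move=> sM; have [M0 MD MR] := sM; split; first by exists 0; rewrite ?mulr0.
  by move=> _ _ [f Mf ->] [g Mg ->]; exists (f + g); [exact: MD|rewrite mulrDr].
by move=> r _ Rr [f Mf ->]; exists (r * f); [exact: MR|rewrite mulrCA].
Qed.

Lemma val_unit (u v : series F) : u * v = 1 -> has_valuation u 0 /\ has_valuation v 0.
Proof.
move=> uv; have := congr1 (fun f : series F => f 0%N) uv.
rewrite coefM_series big_ord1 subn0 coef1_series /= => e.
by split; split=> //; apply/eqP => z; move/eqP: e; rewrite z ?mulr0 ?mul0r eq_sym oner_eq0.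
Qed.

Lemma Delta_scale (u v : series F) M : u * v = 1 -> Delta (scale u M) = Delta M.
Proof.
move=> uv; have [u0 v0] := val_unit uv.
apply/seteqP; split=> n [f].
  move=> [g Mg ->] gn; exists g => //; have := valM v0 gn.
  by rewrite mulrA [v * u]mulrC uv mul1r add0n.
by move=> Mf fn; exists (u * f); [exists f|exact: (valM u0 fn)].
Qed.

Lemma scale_standard (u v : series F) M : u * v = 1 -> standard x y M -> standard x y (scale u M).
Proof.
move=> uv /standardP[sM M0]; apply/standardP; split; first exact: scale_submodule.
by rewrite (Delta_scale _ uv).
Qed.

Lemma mulm_scale u M : mulm (scale u M) = scale u (mulm M).
Proof.
apply/seteqP; split.
  apply: mulm_min; first by exists 0; [exact: mulm0|rewrite mulr0].
    by move=> _ _ [f Mf ->] [g Mg ->]; exists (f + g); [exact: mulmD|rewrite mulrDr].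
  move=> a _ ma [g Mg ->]; exists (a * g); [exact: mulm_in|by rewrite mulrCA].
move=> _ [g mg ->]; suff : [set g | mulm (scale u M) (u * g)] g by [].
move: g mg; apply: mulm_min => /=.
- by rewrite mulr0; exact: mulm0.
- by move=> f g; rewrite mulrDr; exact: mulmD.
- by move=> a v ma Mv; rewrite mulrCA; apply: mulm_in => //; exists v.
Qed.

Lemma qrank_scale (u v : series F) M : u * v = 1 -> standard x y M ->
  qrank x y (scale u M) = qrank x y M.
Proof.
move=> uv stM; rewrite !qrankE //; last exact: scale_standard uv stM.
by rewrite /labels mulm_scale !(Delta_scale _ uv).
Qed.

(** A standard module [M] contains a unique series [u = 1 + ...] whose other
    coefficients vanish in the degrees of [Delta M]; then [M] is [u] times a
    module containing [1], and the coefficients of [u] in the gaps are free. *)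
Lemma ncard_cell (D : set nat) (Q : set (series F) -> Prop) :
  (forall (u v : series F) M, u * v = 1 -> standard x y M -> Q M -> Q (scale u M)) ->
  D 0%N ->
  ncard [set M | [/\ standard x y M, Delta M = D & Q M]] =
  (#|F| ^ gaps D * ncard [set M | [/\ standard x y M, Delta M = D, Q M & M 1%R]])%N.
Proof.
move=> QU D0; set X := [set M | _]; set X1 := [set M | _].
have fX : finite_set X.
  by apply: sub_finite_set finite_standard => M [].
have fX1 : finite_set X1 by apply: sub_finite_set fX => M [].
have [[M0 XM0]|X0] := pselect (exists M, X M); last first.
  have e (Y : set (set (series F))) : Y `<=` X -> Y = set0.
    by move=> YX; apply/seteqP; split=> // M /YX XM; apply: X0; exists M.
  by rewrite (e X) // (e X1) ?ncard0 ?muln0 // => M [].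
have fG : finite_set (~` D) by case: XM0 => /standard_gaps_finite + <-.
have [ff nf] := ncard_fns F fG.
have /choice[e eP] : forall M, exists u : series F, X M ->
    M u /\ forall k, D k -> u k = (k == 0%N)%:R.
  move=> M; have [XM|] := pselect (X M); last by exists 0.
  have [stM dM _] := XM; have [sM _] := stM.
  have [u Mu eu] := echelon_ex (submodule_subspace sM) (fun k => (k == 0%N)%:R)
    (standard_tailK stM).
  by exists u => _; split=> //; rewrite -dM.
rewrite -nf mulnC mulnC; apply: (@ncard_fib_cst _ _ X _ (fun M => e M - 1)) => //.
  move=> M XM k /contrapT Dk; rewrite coefB_series coef1_series.
  by rewrite (eP _ XM).2 // subrr.
move=> b bG; have b0 k : D k -> b k = 0 by move=> Dk; apply: bG => /(_ Dk).
have [|v uv] := @series_inv _ (1 + b).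
  by rewrite coefD_series coef1_series b0 // addr0 oner_neq0.
have vu : v * (1 + b) = 1 by rewrite mulrC.
have [|||//] := @ncard_bij _ _ X1 (X `&` [set M | e M - 1 = b]) (scale (1 + b)) fX1.
- move=> M [stM dM QM M1].
  have XM : X (scale (1 + b) M).
    by split; [exact: scale_standard uv stM|rewrite (Delta_scale _ uv)|exact: QU uv _ _].
  split=> //=; suff -> : e (scale (1 + b) M) = 1 + b by rewrite addrC addKr.
  have [[sM _] dM' _] := XM.
  apply: (echelon_uniq (submodule_subspace sM)).
  + by case: (eP _ XM).
  + by exists 1 => //; rewrite mulr1.
  + move=> k; rewrite dM' => Dk.
    by rewrite (eP _ XM).2 // coefD_series coef1_series b0 // addr0.
- move=> M N _ _ eMN; rewrite -(scaleK M vu) eMN; exact: scaleK.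
- move=> M [XM eM]; exists (scale v M); last exact: scaleK.
  have [stM dM QM] := XM; split; [exact: scale_standard vu stM| | |].
  + by rewrite (Delta_scale _ vu).
  + exact: QU vu _ _.
  + exists (e M); first by case: (eP _ XM).
    by rewrite -[e M](subrK 1) eM addrC vu.
Qed.

End Modules.

(** * Counting the modules containing 1 modulo the order of the field *)

Section CellModulo.
Variables (F : finFieldType) (x y : series F) (C : nat).
Hypothesis HC : conductor_at x y C.
Local Notation R := (branch_ring x y).
Local Notation Gam := (Gamma x y).
Local Notation mulm := (max_ideal_mul x y).
Implicit Types (f : series F) (A M N : set (series F)).

Definition truncated_semigroup (G : set nat) (n : nat) : set nat :=
  G `|` [set m | (n <= m)%N].

Definition unital_cell (D : set nat) : set (set (series F)) :=
  [set M | [/\ standard x y M, Delta M = D & M 1]].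

Lemma unital_branch M : is_submodule x y M -> M 1 -> R `<=` M.
Proof. by move=> sM M1 r Rr; have := submoduleM sM Rr M1; rewrite mulr1. Qed.

Lemma unital_cell_truncated n :
  unital_cell (truncated_semigroup Gam n) = [set addS R (@tail F n)].
Proof.
have sR := submodule_branch HC; have sRv := submodule_subspace sR.
have [_ _ _ tC] := HC.
have R1 : R 1 by exact: branch1.
have sRn := submodule_add sR (submodule_tail x y n).
have dRn : Delta (addS R (@tail F n)) = truncated_semigroup Gam n.
  exact: Delta_add_tail.
have Rn1 : addS R (@tail F n) 1 by apply: addSl => //; exact: subspace_tail.
apply/seteqP; split=> [M [stM dM M1]|_ ->]; last first.
  split=> //; apply/standardP => //; split=> //.
  by rewrite dRn; left; exact: Gamma0.
have [sM _] := stM; have sMv := submodule_subspace sM.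
symmetry; apply: (@Delta_sub_eq _ C); [exact: submodule_subspace sRn|exact: sMv| | |].
- by move=> f /tC; apply: addSl; exact: subspace_tail.
- move=> _ [r [t [Rr tt ->]]]; apply: subspaceD => //; first exact: (unital_branch sM).
  apply: (tail_of_Delta sMv (standard_tail HC stM)) tt => k nk.
  by rewrite dM; right.
- by rewrite dRn dM.
Qed.

Lemma finite_unital_cell D : finite_set (unital_cell D).
Proof. by apply: sub_finite_set (finite_standard HC) => M []. Qed.

Lemma max_gap D : Gam `<=` D -> D <> setT ->
  exists g, ~ D g /\ forall k, (g < k)%N -> D k.
Proof.
move=> GD DT; have [k nDk] : exists k, ~ D k.
  by apply: contrapT => /forallNP H; apply: DT; apply/seteqP; split=> // k _; apply: contrapT.
have ltC j : ~ D j -> (j < C)%N.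
  by move=> nDj; rewrite ltnNge; apply/negP => Cj; apply: nDj; apply/GD/(Gamma_tail HC).
have ex : exists j, `[< ~ D j >] by exists k; apply/asboolP.
have ub j : `[< ~ D j >] -> (j <= C)%N by move/asboolP/ltC/ltnW.
exists (ex_maxn ex ub); case: ex_maxnP => g /asboolP nDg gmax; split=> // j gj.
by apply: contrapT => /asboolP /gmax; rewrite leqNgt gj.
Qed.

(** If [g] is the largest gap of [D], then [M + (z ^+ g)] forgets only the
    choice of a hyperplane, and these hyperplanes form an affine space; it is
    a point only for [M + (z ^+ g) = R + (z ^+ g)]. *)
Lemma dvdn_unital_cell D : standard_gamma Gam D ->
  (forall n, D <> truncated_semigroup Gam n) ->
  (#|F| %| ncard (unital_cell D))%N.
Proof.
move=> [D0 DG] Dsp; have sR := submodule_branch HC.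
have sRv := submodule_subspace sR.
have GD : Gam `<=` D by move=> g Gg; rewrite -[g]addn0; exact: DG.
have [|g [nDg Dg]] := max_gap GD.
  by move=> DT; apply: (Dsp 0%N); rewrite DT; apply/seteqP; split=> // k _; right.
have fX := finite_unital_cell D; set X := unital_cell D in fX *.
pose p M := addS M (@tail F g).
apply: (@ncard_fib_dvd _ _ X (p @` X) p) => //; first exact: finite_image.
move=> _ [M0 [stM0 dM0 M01] <-]; set b := p M0.
have [sM0 _] := stM0; have sb : is_submodule x y b := submodule_add sM0 (submodule_tail x y g).
have sbv : subspace b := submodule_subspace sb.
have db : Delta b = D `|` [set m | (g <= m)%N].
  by rewrite -dM0; apply: Delta_add_tail; exact: submodule_subspace sM0.
have M0b : M0 `<=` b by apply: addSl; exact: subspace_tail.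
have stb : standard x y b by apply/standardP => //; split=> //; rewrite db; left.
have tb : @tail F g `<=` b by apply: addSr; exact: submodule_subspace sM0.
have dbg : Delta b `\ g = D.
  rewrite db; apply/seteqP; split=> k => [[[//|/= gk] /eqP kg]|Dk].
    by apply: Dg; rewrite ltn_neqAle eq_sym kg.
  by split; [left|move=> /= kg; apply: nDg; rewrite -kg].
set A := addS R (mulm b).
have smb := submodule_subspace (mulm_submodule sb).
have sA : subspace A by exact: subspace_add.
have mA : mulm b `<=` A by exact: addSr.
have RA : R `<=` A by exact: addSl.
have tA : tail (C + C) `<=` A by move=> f /(mulm_tailK HC stb) /mA.
have Ab : A `<=` b.
  move=> _ [r [m [Rr mm ->]]]; apply: subspaceD => //.
    by apply: (unital_branch sb (M0b _ M01)).
  exact: (mulm_sub sb).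
have inM M : X M -> p M = b -> A `<=` M.
  move=> [stM dM M1] pM; have [sM _] := stM.
  have sMv := submodule_subspace sM.
  move=> _ [r [m [Rr mm ->]]]; apply: subspaceD => //; first by apply: (unital_branch sM M1).
  apply: mulm_min mm; [exact: subspace0|by move=> *; exact: subspaceD|].
  rewrite -pM => a _ ma [v [t [Mv tt ->]]]; rewrite mulrDr; apply: subspaceD => //.
    exact: (submoduleM sM ma.1 Mv).
  apply: (tail_of_Delta sMv (standard_tail HC stM) (n := g.+1)).
    by move=> k gk; rewrite dM; exact: Dg.
  by rewrite -add1n; apply: tailM => //; exact: max_ideal_tail ma.
have nAg : ~ Delta A g.
  move=> Ag; apply: nDg; rewrite -dM0.
  by apply: Delta_sub Ag; apply: inM.
have bg : Delta b g by rewrite db; right => /=.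
(* All hyperplanes of [b] through [A] are modules, since [A] contains the
   product of [b] by the maximal ideal. *)
have -> : X `&` [set M | p M = b] = between A b (Delta b `\ g).
  apply/seteqP; split=> M.
    move=> [XM pM]; have [[sM _] dM M1] := XM; split; [exact: submodule_subspace sM|exact: inM| |].
      by rewrite -pM; apply: addSl; exact: subspace_tail.
    by rewrite dbg.
  move=> [sM AM Mb dM].
  have sM' : is_submodule x y M by apply: (sub_mulm_submodule sb) => // f /mA /AM.
  split.
    split; [|by rewrite dM|by apply: AM; apply: RA; exact: branch1].
    by apply/standardP => //; rewrite dM dbg.
  apply: (@Delta_sub_eq _ (C + C)) => //.
  - by apply: subspace_add => //; exact: subspace_tail.
  - by move=> f /tA /AM; apply: addSl; exact: subspace_tail.
  - move=> _ [m [t [Mm tt ->]]]; apply: subspaceD => //; first exact: Mb.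
    exact: tb.
  - by rewrite (Delta_add_tail _ sM) dM dbg db.
have [_ ->] := ncard_between_del sA sbv tA Ab bg nAg.
set G := [set k | _].
have fG : finite_set G by apply: (@finite_bounded _ g) => k [].
have [[k Gk]|G0] := pselect (exists k, G k).
  by apply: dvdn_exp => //; exact: (ncard_gt0 fG Gk).
(* Without free coefficients, [b = R + (z ^ g)] by Nakayama's lemma. *)
exfalso; have e : b = addS R (@tail F g).
  apply: (nakayama (C := C) sb (submodule_add sR (submodule_tail x y g))).
  - move=> f tf; apply: addSl; first exact: subspace_tail.
    by case: HC => _ _ _; apply; apply: tailW (leq_addr _ _) tf.
  - move=> _ [r [t [Rr tt ->]]]; apply: subspaceD => //; last exact: tb.
    by apply: Ab; exact: RA.
  have sAt := subspace_add sA (@subspace_tail F g).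
  have eA : b = addS A (@tail F g).
    symmetry; apply: (@Delta_sub_eq _ (C + C)) => //.
    + by move=> f /tA; apply: addSl; exact: subspace_tail.
    + move=> _ [a [t [Aa tt ->]]]; apply: subspaceD => //; [exact: Ab|exact: tb].
    rewrite (Delta_add_tail _ sA) => k bk; have [gk|kg] := leqP g k; first by right.
    by left; apply: contrapT => nAk; apply: G0; exists k.
  rewrite {1}eA => _ [_ [t [[r [m [Rr mm ->]]] tt ->]]].
  exists (r + t), m; rewrite addrAC; split=> //; first by exists r, t.
apply: (Dsp g.+1); rewrite -dbg e (Delta_add_tail _ sRv); apply/seteqP; split=> k.
  move=> [[Gk|/= gk] /eqP kg]; first by left.
  by right=> /=; rewrite ltn_neqAle eq_sym kg.
case=> [Gk|/= gk]; split; [by left| |by right=> /=; exact: ltnW|by move=> /= kg; lia].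
by move=> /= kg; apply: nDg; apply: GD; rewrite -kg.
Qed.

(** The units [1 + ...] with free coefficients in the gaps of [D] act freely. *)
Lemma cell_mod D (Q : set (series F) -> Prop) :
  (forall (u v : series F) M, u * v = 1 -> standard x y M -> Q M -> Q (scale u M)) ->
  D 0%N ->
  (#|F| ^ gaps D %| ncard [set M | [/\ standard x y M, Delta M = D & Q M]])%N.
Proof. by move=> QU D0; rewrite (ncard_cell HC) // dvdn_mulr. Qed.

Lemma J0_ncard D : D 0%N ->
  ncard (J0 x y D) = (#|F| ^ gaps D * ncard (unital_cell D))%N.
Proof.
move=> D0; have := @ncard_cell _ _ _ _ HC D (fun=> True) (fun _ _ _ _ _ _ => I) D0.
rewrite (_ : [set M | _] = J0 x y D) => [->|]; last first.
  by apply/seteqP; split=> M [].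
by congr (_ * ncard _)%N; apply/seteqP; split=> M [].
Qed.

End CellModulo.

(** * Weighted counts of chains with monotone labels *)

Lemma fsum_mull (A : comNzRingType) (T : choiceType) (D : set T) (a : A) (f : T -> A) :
  finite_set D -> a * \sum_(x \in D) f x = \sum_(x \in D) a * f x.
Proof. by move=> fD; rewrite !fsbig_finite // mulr_sumr. Qed.

(** Counting the predecessors of an element of [G] is a bijection from [G] onto
    the numbers below [ncard G]. *)
Lemma rank_sum (V : nmodType) (r : rel nat) (G : set nat) (f : nat -> V) :
  irreflexive r -> transitive r -> (forall a b, a != b -> r a b || r b a) ->
  finite_set G ->
  \sum_(g \in G) f (ncard [set l | G l /\ r l g]) = \sum_(c < ncard G) f c.
Proof.
move=> irr tr tot fG; pose rk g := ncard [set l | G l /\ r l g].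
have fGg g : finite_set [set l | G l /\ r l g] by apply: sub_finite_set fG => l [].
have lt g : G g -> (rk g < ncard G)%N.
  move=> Gg; rewrite ltn_neqAle ncard_sub ?andbT //; last by move=> l [].
  apply/eqP => e; have := ncard_sub_eq fG (_ : [set l | G l /\ r l g] `<=` G).
  rewrite -/(rk g) e => /(_ (fun l h => h.1) (leqnn _)) e'.
  by move: Gg; rewrite -e' /= => -[_]; rewrite irr.
have mono g g' : G g -> r g g' -> (rk g < rk g')%N.
  move=> Gg gg'; have sub : [set l | G l /\ r l g] `<=` [set l | G l /\ r l g'].
    by move=> l [Gl lg]; split=> //; exact: tr gg'.
  rewrite ltn_neqAle ncard_sub ?andbT //; apply/eqP => e.
  have e' : [set l | G l /\ r l g] = [set l | G l /\ r l g'].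
    by apply: ncard_sub_eq => //; rewrite -/(rk g) -/(rk g') e.
  have : [set l | G l /\ r l g'] g by [].
  by rewrite -e' /= irr => -[].
have inj g g' : G g -> G g' -> rk g = rk g' -> g = g'.
  move=> Gg Gg' e; apply/eqP; apply: contraT => /tot /orP[|] /mono.
    by move/(_ Gg); rewrite e ltnn.
  by move/(_ Gg'); rewrite e ltnn.
have im : rk @` G = `I_(ncard G).
  have [|||f1 n1] := @ncard_bij _ _ G (rk @` G) rk fG.
  - by move=> g Gg; exists g.
  - exact: inj.
  - by move=> _ [g Gg <-]; exists g.
  apply: ncard_sub_eq; [exact: finite_II|by move=> _ [g /lt ? <-]|].
  by rewrite n1 ncard_II.
rewrite fsbig_ord -im fsbig_image //.
by move=> g g'; rewrite !inE; exact: inj.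
Qed.

Section Chains.
Variables (X : choiceType) (ok : rel nat) (nxt : nat -> nat).
Variable T : X -> X -> nat -> Prop.

(** A state is a pair of a bound on the labels still allowed, and an element. *)
Definition next (s : nat * X) : set (nat * X) :=
  [set s' | exists g, [/\ ok s.1 g, s'.1 = nxt g & T s.2 s'.2 g]].

Fixpoint chain (s : nat * X) (l : seq X) : Prop :=
  if l is M :: l' then exists h, next s (h, M) /\ chain (h, M) l' else True.

Lemma chain_labels h M l : chain (h, M) l <->
  exists g : nat -> nat,
    [/\ forall i, (i < size l)%N -> T (nth M (M :: l) i) (nth M l i) (g i),
        forall i, (i.+1 < size l)%N -> ok (nxt (g i)) (g i.+1) &
        (0 < size l)%N -> ok h (g 0%N)].
Proof.
elim: l h M => [|N l IH] h M /=; first by split=> // _; exists id.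
split=> [[_ [[g0 [/= ok0 -> T0]] /IH[g [Tg okg okh]]]]|[g [Tg okg okh]]].
  exists (fun i => if i is i'.+1 then g i' else g0); split=> // -[|i] //= il; last exact: okg.
  have := Tg i il; rewrite (set_nth_default M) /=; last exact: leqW.
  by rewrite (set_nth_default M).
exists (nxt (g 0%N)); split; first by exists (g 0%N); split; [exact: okh|by []|exact: (Tg 0%N)].
apply/IH; exists (fun i => g i.+1); split=> [i il|i il|il]; [|exact: okg|exact: (okg 0%N)].
have := Tg i.+1 il; rewrite /= (set_nth_default N) /=; last exact: leqW.
by rewrite (set_nth_default N).
Qed.

Variables (A : comNzRingType) (w q a : A) (good : set (nat * X)) (n : nat * X -> nat).
Hypothesis Tdet : forall s M g g', good s -> T s.2 M g -> T s.2 M g' -> g = g'.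
Hypothesis good_next : forall s s', good s -> next s s' -> good s' /\ (n s' < n s)%N.
Hypothesis fin_next : forall s, good s -> finite_set (next s).
Hypothesis sum_next : forall s (f : nat -> A), good s ->
  \sum_(s' \in next s) f (n s') = \sum_(c < n s) w * q ^+ c * f c.

Lemma telescope_prod k :
  1 + \sum_(c < k) w * q ^+ c * (a * \prod_(i < c) (1 + w * q ^+ i * a)) =
  \prod_(i < k) (1 + w * q ^+ i * a).
Proof.
elim: k => [|k IH]; first by rewrite !big_ord0 addr0.
by rewrite big_ord_recr addrA IH big_ord_recr /=; ring.
Qed.

Definition chain_weight s : Prop := finite_set (chain s) /\
  \sum_(l \in chain s) a ^+ size l = \prod_(i < n s) (1 + w * q ^+ i * a).

Lemma chain_weight_step s : good s ->
  (forall s', next s s' -> chain_weight s') -> chain_weight s.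
Proof.
move=> gs IH; have fn := fin_next gs.
pose B := \bigcup_(s' in next s) [set s'.2 :: l | l in chain s'].
have fB : finite_set B.
  by apply: bigcup_finite => // s' /IH[fc _]; exact: finite_image.
have eB : chain s = [set [::]] `|` B.
  apply/seteqP; split=> [[|M l]|l]; first by left.
    by move=> [h [nh ch]]; right; exists (h, M) => //; exists l.
  by move=> [->//|[[h M] nh [l' cl' <-]]]; exists h.
have f1 : finite_set [set ([::] : seq X)] by exact: finite_set1.
split; first by rewrite eB finite_setU.
rewrite eB fsbigU //=; last by move=> l [-> [[h M] _ [l' _]]].
rewrite fsbig_set1 expr0 -telescope_prod; congr (_ + _).
have /choice[p pP] : forall l, exists s', B l ->
    next s s' /\ exists2 l', chain s' l' & l = s'.2 :: l'.
  move=> l; have [[s' ns' [l' cl' <-]]|] := pselect (B l); last by exists s.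
  by exists s' => _; split=> //; exists l'.
rewrite (fsum_fib _ fB fn (p := p)); last by move=> l /pP[].
rewrite -(sum_next (fun c => a * \prod_(i < c) (1 + w * q ^+ i * a)) gs).
apply: eq_fsum => s' ns'; have [fc <-] := IH s' ns'.
rewrite (fsum_mull _ _ fc).
have -> : B `&` [set l | p l = s'] = [set s'.2 :: l | l in chain s'].
  apply/seteqP; split=> [l [Bl pl]|_ [l cl <-]].
    by have [_ [l' cl' ->]] := pP _ Bl; rewrite pl in cl' *; exists l'.
  have Bl : B (s'.2 :: l) by exists s' => //; exists l.
  have [np [l' cl' [e _]]] := pP _ Bl; split=> //=.
  case: np => g [_ e1 Tp]; case: (ns') => g' [_ e1' Ts'].
  rewrite -e in Tp; rewrite [p _]surjective_pairing [s' in RHS]surjective_pairing.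
  by rewrite e1 e1' -e (Tdet gs Tp Ts').
rewrite fsbig_image => [|l l' _ _ []//].
by apply: eq_fsum => l _; rewrite exprS.
Qed.

(** A state of rank [n s] has [w * q ^+ c] successors of each rank [c < n s];
    splitting off the first element of a chain, the product telescopes. *)
Lemma chain_sum s : good s -> chain_weight s.
Proof.
move: {2}(n s).+1 (ltnSn (n s)) => m; elim: m s => // m IH s ns gs.
apply: chain_weight_step => // s' /(good_next gs)[gs' lt]; apply: IH => //.
exact: leq_trans lt ns.
Qed.

End Chains.

(** * Flags of modules *)

Section Flags.
Variables (F : finFieldType) (x y : series F) (C : nat).
Hypothesis HC : conductor_at x y C.
Local Notation R := (branch_ring x y).
Local Notation mm := (max_ideal x y).
Local Notation mulm := (max_ideal_mul x y).
Local Notation K := (C + C)%N.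
Local Notation q := #|F|.
Implicit Types (f : series F) (A M N : set (series F)).

Definition step N M (g : nat) : Prop :=
  [/\ is_submodule x y M, N `<=` M, Delta M = Delta N `|` [set g] & ~ Delta N g].

(** [soc N / N] is the socle of [F[[z]] / N], and [tau N] below its dimension. *)
Definition soc N : set (series F) := [set v | forall a, mm a -> N (a * v)].

Lemma soc_submodule N : is_submodule x y N -> is_submodule x y (soc N).
Proof.
move=> sN; have [N0 ND NR] := sN; split.
- by move=> a _; rewrite mulr0.
- by move=> f g sf sg a ma; rewrite mulrDr; apply: ND; [exact: sf|exact: sg].
- by move=> r f Rr sf a ma; rewrite mulrCA; exact: (NR _ _ Rr (sf _ ma)).
Qed.

Lemma soc_sub N : is_submodule x y N -> N `<=` soc N.
Proof. by move=> sN f Nf a [Ra _]; exact: (submoduleM sN Ra Nf). Qed.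

Section OneStep.
Variables (N M : set (series F)) (g : nat).
Hypotheses (stN : standard x y N) (sNM : step N M g).

Let sN : is_submodule x y N. Proof. by case: stN. Qed.
Let sM : is_submodule x y M. Proof. by case: sNM. Qed.
Let NM : N `<=` M. Proof. by case: sNM. Qed.
Let dM : Delta M = Delta N `|` [set g]. Proof. by case: sNM. Qed.
Let nNg : ~ Delta N g. Proof. by case: sNM. Qed.
Let sNv := submodule_subspace sN.
Let sMv := submodule_subspace sM.

Lemma step_standard : standard x y M.
Proof.
apply/standardP; split=> //; rewrite dM; left.
by have [_ N0] := (standardP x y N).1 stN.
Qed.

Lemma step_generator : exists v, [/\ M v, tail g v, v g = 1 &
  forall f, M f -> exists n c, N n /\ f = n + c *: v].
Proof.
have [v [Mv tv v1]] : exists v, [/\ M v, tail g v & v g = 1].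
  by apply: Delta_monic => //; rewrite dM; right.
exists v; split=> // f Mf.
have lv : subspace (line v) by exact: subspace_line.
have e : addS N (line v) = M.
  apply: (@Delta_sub_eq _ K) => //; first exact: subspace_add.
  - by move=> h /(standard_tailK HC stN); exact: (addSl lv).
  - move=> _ [n [_ [Nn [c ->] ->]]]; apply: (subspaceD sMv); first exact: NM.
    exact: (subspaceZ sMv).
  rewrite dM => k [Nk|->]; first exact: (Delta_sub (addSl lv)).
  exists v; last by split; [rewrite v1 oner_neq0|].
  by apply: (addSr sNv); exact: line_self.
by move: Mf; rewrite -e => -[n [_ [Nn [c ->] ->]]]; exists n, c.
Qed.

Lemma step_high f : M f -> tail g.+1 f -> N f.
Proof.
move=> Mf tf; have [v [Mv tv v1 gen]] := step_generator.
have [n [c [Nn e]]] := gen _ Mf; have [c0|c0] := eqVneq c 0.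
  by rewrite e c0 scale0r addr0.
case: nNg; exists n => //; have -> : n = f - c *: v by rewrite e addrK.
split; last by move=> k kg; rewrite coefB_series coefZ_series tv // mulr0 tf ?subrr // ltnW.
by rewrite coefB_series coefZ_series v1 mulr1 tf // sub0r oppr_eq0.
Qed.

Lemma step_soc : M `<=` soc N.
Proof.
move=> f Mf a ma; have [v [Mv tv v1 gen]] := step_generator.
have [n [c [Nn ->]]] := gen _ Mf; rewrite mulrDr scaler_mulr.
apply: (subspaceD sNv); first exact: (submoduleM sN ma.1 Nn).
apply: (subspaceZ sNv); apply: step_high; first exact: (submoduleM sM ma.1 Mv).
by rewrite -add1n; apply: tailM => //; exact: (max_ideal_tail ma).
Qed.

Lemma step_mulm : mulm M `<=` N.
Proof.
apply: mulm_min; [exact: (subspace0 sNv)|exact: (subspaceD sNv)|].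
by move=> a v ma /step_soc; apply.
Qed.

Lemma step_gt0 : (0 < g)%N.
Proof.
rewrite lt0n; apply/eqP => g0; apply: nNg; rewrite g0.
by have [_ N0] := (standardP x y N).1 stN.
Qed.

Lemma step_lt : (g < C)%N.
Proof.
rewrite ltnNge; apply/negP => Cg; apply: nNg.
exact: (Delta_of_tail (standard_tail HC stN) Cg).
Qed.

Lemma step_gaps : gaps (Delta N) = (gaps (Delta M)).+1.
Proof.
rewrite /gaps -[LHS]/(ncard _) -[X in X.+1]/(ncard _) -addn1 -(ncard1 g).
have fM := standard_gaps_finite HC step_standard.
rewrite -(ncardU fM (finite_set1 g)).
  congr (ncard _); rewrite dM; apply/seteqP; split=> k.
    by move=> nk; have [->|kg] := eqVneq k g; [right|left => -[//|/eqP]; rewrite (negPf kg)].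
  by move=> [nk Nk|->//]; apply: nk; left.
apply/seteqP; split=> // k [nk /= kg]; case: nk; rewrite kg dM; by right.
Qed.

(** A step upwards with label [g] keeps the available labels above [g]. *)
Lemma step_soc_above k : (g < k)%N -> Delta (soc M) k <-> Delta (soc N) k.
Proof.
move=> gk; split=> -[v sv [vk tv]]; exists v => // a ma.
  apply: step_high; first exact: sv.
  rewrite -add1n; apply: tailM; first exact: (max_ideal_tail ma).
  exact: tailW (ltnW gk) tv.
by apply: NM; exact: sv.
Qed.

(** A step downwards with label [g] keeps the available labels below [g]. *)
Lemma step_mulm_below k : (k < g)%N -> Delta (mulm N) k <-> Delta (mulm M) k.
Proof.
move=> kg; split; first by apply: Delta_sub; exact: mulmS.
have [v [Mv tv v1 gen]] := step_generator.
have H : mulm M `<=` addS (mulm N) (@tail F g).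
  have sA := subspace_add (submodule_subspace (mulm_submodule sN)) (@subspace_tail F g).
  apply: mulm_min; [exact: (subspace0 sA)|exact: (subspaceD sA)|].
  move=> a f ma /gen[n [c [Nn ->]]]; rewrite mulrDr scaler_mulr.
  exists (a * n), (c *: (a * v)); split=> //; first exact: (mulm_in ma Nn).
  by apply: (subspaceZ (@subspace_tail F g)); exact: tail_mulr.
move=> [f /H[n [t [mn tt ->]]] [fk tf]]; exists n => //; split.
  by move: fk; rewrite coefD_series tt // addr0.
move=> j jk; have := tf j jk; rewrite coefD_series tt ?addr0 //.
exact: ltn_trans jk kg.
Qed.

End OneStep.

(** Every subspace of [soc N] that contains [N] is a module. *)
Lemma step_of_soc N M g : standard x y N -> ~ Delta N g ->
  between N (soc N) (Delta N `|` [set g]) M -> step N M g.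
Proof.
move=> stN nNg [sM NM Ms dM]; split=> //; have [sN _] := stN.
split; [exact: (subspace0 sM)|exact: (subspaceD sM)|].
move=> r f Rr Mf; have -> : r * f = (r - r 0%N *: (1 : series F)) * f + r 0%N *: f.
  by rewrite mulrBl scaler_mull mul1r subrK.
apply: (subspaceD sM); last exact: (subspaceZ sM).
apply: NM; apply: (Ms _ Mf); split.
  apply: subspaceB => //; first exact: branch_subspace.
  by apply: subspaceZ; [exact: branch_subspace|exact: branch1].
by rewrite coefB_series coefZ_series mulr1 subrr.
Qed.

Lemma step_soc_set N g : standard x y N -> ~ Delta N g ->
  [set M | step N M g] = between N (soc N) (Delta N `|` [set g]).
Proof.
move=> stN nNg; apply/seteqP; split=> M; last exact: step_of_soc.
move=> sNM; have [sM NM dM _] := sNM.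
split=> //; [exact: (submodule_subspace sM)|exact: (step_soc stN sNM)].
Qed.

Lemma step_label_uniq N M g g' : step N M g -> step N M g' -> g = g'.
Proof.
move=> [_ _ d1 n1] [_ _ d2 n2].
have : (Delta N `|` [set g']) g by rewrite -d2 d1; right.
by case.
Qed.

Lemma step_down_set M g : standard x y M -> (0 < g)%N -> Delta M g ->
  ~ Delta (mulm M) g ->
  [set N | standard x y N /\ step N M g] = between (mulm M) M (Delta M `\ g).
Proof.
move=> stM g0 Mg nmg; have [sM _] := stM; apply/seteqP; split=> N.
  move=> [stN sNM]; have [_ NM dM nNg] := sNM; have [sN _] := stN.
  split=> //; [exact: (submodule_subspace sN)|exact: (step_mulm stN sNM)|].
  rewrite dM; apply/seteqP; split=> k.
    by move=> Nk; split; [left|move=> /= kg; apply: nNg; rewrite -kg].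
  by move=> [[//|->] []].
move=> [sN mN NM dN]; have sN' := sub_mulm_submodule sM sN mN NM.
have [_ M0] := (standardP x y M).1 stM; split.
  by apply/standardP; split=> //; rewrite dN; split=> //= e; rewrite -e in g0.
split=> //; last by rewrite dN => -[_]; apply.
rewrite dN; apply/seteqP; split=> k; last by move=> [[]|->].
by move=> Mk; have [->|/eqP kg] := eqVneq k g; [right|left].
Qed.

(** ** Chains upwards *)

Definition upper_labels N : set nat := Delta (soc N) `\` Delta N.

Definition tau N : nat := ncard (upper_labels N).

Definition up_ok : rel nat := leq.
Definition up_next := next up_ok S step.
Definition up_good : set (nat * set (series F)) := [set s | standard x y s.2].
Definition up_rank (s : nat * set (series F)) : nat :=
  ncard [set l | upper_labels s.2 l /\ (s.1 <= l)%N].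

Lemma upper_labels_lt N l : standard x y N -> upper_labels N l -> (l < C)%N.
Proof.
move=> stN [_ nNl]; rewrite ltnNge; apply/negP => Cl; apply: nNl.
exact: (Delta_of_tail (standard_tail HC stN) Cl).
Qed.

Lemma step_upper_label N M g : standard x y N -> step N M g -> upper_labels N g.
Proof.
move=> stN sNM; split; last by case: sNM.
apply: (Delta_sub (step_soc stN sNM)); case: sNM => _ _ -> _; by right.
Qed.

Lemma up_rank_step N M g : standard x y N -> step N M g ->
  up_rank (g.+1, M) = ncard [set l | upper_labels N l /\ (g < l)%N].
Proof.
move=> stN sNM; congr (ncard _); apply/seteqP; split=> l /= [[sl nl] gl].
  split=> //; split; first exact/(step_soc_above stN sNM gl).
  by move=> Nl; apply: nl; case: sNM => _ _ -> _; left.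
split=> //; split; first exact/(step_soc_above stN sNM gl).
by case: sNM => _ _ -> _ [//|/= e]; rewrite e ltnn in gl.
Qed.

Lemma finite_labels (G : set nat) : (forall l, G l -> (l < C)%N) -> finite_set G.
Proof. exact: finite_bounded. Qed.

(** With the label [g] there are [q] to the number of labels above [g]
    successors, so that the labels, from the largest down, give the exponents
    [0, 1, 2], and so on. *)
Lemma up_sum (A : comNzRingType) s (f : nat -> A) : up_good s ->
  \sum_(s' \in up_next s) f (up_rank s') =
  \sum_(c < up_rank s) 1 * q%:R ^+ c * f c.
Proof.
move: s => [h N] /= stN; have [sN _] := stN.
pose G := [set l | upper_labels N l /\ (h <= l)%N].
have fG : finite_set G by apply: finite_labels => l [/(upper_labels_lt stN)].
have fn : finite_set (up_next (h, N)).
  apply: (@sub_finite_set _ _ (`I_(C.+1) `*` standard x y)); last first.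
    by apply: finite_setX; [exact: finite_II|exact: (finite_standard HC)].
  move=> [h' M] [g [/= _ -> sNM]]; split=> /=; last exact: (step_standard stN sNM).
  exact: (step_lt stN sNM).
have f1 : finite_set ([set g.+1 | g in G]) by exact: finite_image.
rewrite (fsum_fib _ fn f1 (p := fst)); last first.
  move=> [h' M] [g [/= hg -> sNM]]; exists g => //.
  by split=> //; exact: (step_upper_label stN sNM).
rewrite fsbig_image => [|a b _ _ []//].
transitivity (\sum_(g \in G) 1 * q%:R ^+ (ncard [set l | G l /\ (g < l)%N]) *
                 f (ncard [set l | G l /\ (g < l)%N])).
  apply: eq_fsum => g [[sg nNg] hg].
  have eG : [set l | G l /\ (g < l)%N] = [set l | upper_labels N l /\ (g < l)%N].
    apply/seteqP; split=> l; first by move=> [[]].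
    by move=> [ll gl]; split=> //; split=> //; exact: ltnW (leq_ltn_trans hg gl).
  have ft : finite_set (up_next (h, N) `&` [set s | s.1 = g.+1]) by exact: finite_setIl.
  rewrite (fsum_cst (c := f (ncard [set l | G l /\ (g < l)%N])) ft); last first.
    by move=> [h' M] [[g' [/= hg' -> sNM]] [e]]; rewrite e in sNM; rewrite e eG (up_rank_step stN sNM).
  rewrite mul1r -[LHS]mulr_natl -natrX; congr (_%:R * _).
  have [fb nb] := ncard_between_add (submodule_subspace sN)
    (submodule_subspace (soc_submodule sN)) (standard_tailK HC stN)
    (soc_sub sN) sg nNg.
  have [||| _ ->] := @ncard_bij _ _ (between N (soc N) (Delta N `|` [set g]))
    (up_next (h, N) `&` [set s | s.1 = g.+1]) (fun M => (g.+1, M)) fb.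
  - by move=> M /(step_of_soc stN nNg) sNM; split=> //; exists g.
  - by move=> M M' _ _ [].
  - move=> [h' M] [[g' [/= hg' -> sNM]] [e]]; rewrite e in sNM *; exists M => //.
    by rewrite -(step_soc_set stN nNg).
  rewrite nb eG; congr (_ ^ ncard _)%N; apply/seteqP; split=> l.
    by move=> [? ? ?]; split.
  by move=> [[]].
apply: (@rank_sum _ (fun l g => (g < l)%N) G (fun c => 1 * q%:R ^+ c * f c)) => //.
- by move=> g /=; rewrite ltnn.
- by move=> b a c /= ba cb; exact: ltn_trans cb ba.
- by move=> a b; rewrite neq_ltn orbC.
Qed.

Lemma up_chain_sum (A : comNzRingType) (a : A) N : standard x y N ->
  finite_set (chain up_ok S step (0%N, N)) /\
  \sum_(l \in chain up_ok S step (0%N, N)) a ^+ size l =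
  \prod_(i < tau N) (1 + q%:R ^+ i * a).
Proof.
move=> stN; have [|||||fc ->] := @chain_sum _ up_ok S step A 1 q%:R a up_good up_rank
  _ _ _ _ (0%N, N); first 5 last.
- split=> //; rewrite /up_rank /tau /=.
  have -> : [set l | upper_labels N l /\ (0 <= l)%N] = upper_labels N.
    by apply/seteqP; split=> l // [].
  by apply: eq_bigr => i _; rewrite mul1r.
- by move=> [h M] P g g' _; exact: step_label_uniq.
- move=> [h M] [h' P] /= stM [g [/= hg -> sMP]].
  split; first exact: (step_standard stM sMP).
  rewrite (up_rank_step stM sMP) /up_rank /=.
  have fG : finite_set [set l | upper_labels M l /\ (h <= l)%N].
    by apply: finite_labels => l [/(upper_labels_lt stM)].
  have sub : [set l | upper_labels M l /\ (g < l)%N] `<=`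
             [set l | upper_labels M l /\ (h <= l)%N].
    by move=> l [ll gl]; split=> //; exact: ltnW (leq_ltn_trans hg gl).
  rewrite ltn_neqAle ncard_sub // andbT; apply/eqP => e.
  have e' := ncard_sub_eq fG sub (eq_leq (esym e)).
  have : [set l | upper_labels M l /\ (h <= l)%N] g.
    by split=> //; exact: (step_upper_label stM sMP).
  by rewrite -e' /= ltnn => -[].
- move=> [h M] /= stM.
  apply: (@sub_finite_set _ _ (`I_(C.+1) `*` standard x y)); last first.
    by apply: finite_setX; [exact: finite_II|exact: (finite_standard HC)].
  move=> [h' P] [g [/= _ -> sNM]]; split=> /=; last exact: (step_standard stM sNM).
  exact: (step_lt stM sNM).
- by move=> s f gs; exact: up_sum.
- exact: stN.
Qed.

(** ** Chains downwards *)

Definition down_ok (h g : nat) : bool := (g < h)%N.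
Definition down_step M N (g : nat) : Prop := standard x y N /\ step N M g.
Definition down_next := next down_ok id down_step.
Definition down_rank (s : nat * set (series F)) : nat :=
  ncard [set l | [/\ labels x y s.2 l, (0 < l)%N & (l < s.1)%N]].

Lemma labels_lt M l : standard x y M -> labels x y M l -> (l < K)%N.
Proof.
move=> stM [_ nl]; rewrite ltnNge; apply/negP => Kl; apply: nl.
exact: (Delta_of_tail (mulm_tailK HC stM) Kl).
Qed.

Lemma labels0 M : standard x y M -> labels x y M 0%N.
Proof.
move=> stM; have [_ M0] := (standardP x y M).1 stM; split=> // -[f mf [f0 _]].
have t1 := @mulm_shift _ x y 0 M (fun f _ => @tail0 _ f).
by have tf := t1 _ mf 0%N (leqnn 1); rewrite tf eqxx in f0.
Qed.

Lemma down_label M N g : standard x y M -> down_step M N g -> labels x y M g /\ (0 < g)%N.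
Proof.
move=> stM [stN sNM]; split; last exact: (step_gt0 stN sNM).
split; first by case: sNM => _ _ -> _; right.
by move=> /(Delta_sub (step_mulm stN sNM)); case: sNM.
Qed.

Lemma down_rank_step M N g : standard x y N -> step N M g ->
  down_rank (g, N) = ncard [set l | [/\ labels x y M l, (0 < l)%N & (l < g)%N]].
Proof.
move=> stN sNM; congr (ncard _); apply/seteqP; split=> l /= [[sl nl] l0 lg]; split=> //.
  split; first by case: sNM => _ _ -> _; left.
  by move=> /(step_mulm_below stN sNM lg).
split; last by move=> /(step_mulm_below stN sNM lg).
by case: sNM sl => _ _ -> _ [//|/= e]; rewrite e ltnn in lg.
Qed.

(** The label [0] counts among the labels below [g], but is never removed since
    all modules are standard: this is the additional factor [q]. *)
Lemma down_sum (A : comNzRingType) s (f : nat -> A) : up_good s ->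
  \sum_(s' \in down_next s) f (down_rank s') =
  \sum_(c < down_rank s) q%:R * q%:R ^+ c * f c.
Proof.
move: s => [h M] /= stM; have [sM _] := stM.
pose G := [set l | [/\ labels x y M l, (0 < l)%N & (l < h)%N]].
have fG : finite_set G by apply: (@finite_bounded _ h) => l [].
have fn : finite_set (down_next (h, M)).
  apply: (@sub_finite_set _ _ (`I_C `*` standard x y)); last first.
    by apply: finite_setX; [exact: finite_II|exact: (finite_standard HC)].
  move=> [h' N] [g [/= _ -> [stN sNM]]]; split=> //=.
  exact: (step_lt stN sNM).
rewrite (fsum_fib _ fn fG (p := fst)); last first.
  move=> [h' N] [g [/= hg -> dMN]]; have [lg g0] := down_label stM dMN.
  by split.
transitivity (\sum_(g \in G) q%:R * q%:R ^+ (ncard [set l | G l /\ (l < g)%N]) *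
                 f (ncard [set l | G l /\ (l < g)%N])).
  apply: eq_fsum => g [[Mg nmg] g0 gh].
  have eG : [set l | G l /\ (l < g)%N] = [set l | [/\ labels x y M l, (0 < l)%N & (l < g)%N]].
    apply/seteqP; split=> l; first by move=> [[]].
    by move=> [ll l0 lg]; split=> //; split=> //; exact: ltn_trans lg gh.
  have ft : finite_set (down_next (h, M) `&` [set s | s.1 = g]) by exact: finite_setIl.
  rewrite (fsum_cst (c := f (ncard [set l | G l /\ (l < g)%N])) ft); last first.
    by move=> [h' N] [[g' [/= hg' -> [stN sNM]]] e]; rewrite /= in e; rewrite e in sNM *;
      rewrite eG (down_rank_step stN sNM).
  rewrite -exprS -[LHS]mulr_natl -natrX; congr (_%:R * _).
  have [fb nb] := ncard_between_del (submodule_subspace (mulm_submodule sM))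
    (submodule_subspace sM) (mulm_tailK HC stM) (mulm_sub sM) Mg nmg.
  have eS := step_down_set stM g0 Mg nmg.
  have [||| _ ->] := @ncard_bij _ _ (between (mulm M) M (Delta M `\ g))
    (down_next (h, M) `&` [set s | s.1 = g]) (fun N => (g, N)) fb.
  - by rewrite -eS => N dMN; split=> //; exists g.
  - by move=> N N' _ _ [].
  - move=> [h' N] [[g' [/= hg' -> dMN]] e]; rewrite /= in e; rewrite e in dMN *; exists N => //.
    by rewrite -eS.
  rewrite nb eG; congr (_ ^ _)%N.
  have -> : [set k | [/\ Delta M k, ~ Delta (mulm M) k & (k < g)%N]] =
    [set 0%N] `|` [set l | [/\ labels x y M l, (0 < l)%N & (l < g)%N]].
    apply/seteqP; split=> l; last by move=> [->|[[? ?] _ ?]]; [have [? ?] := labels0 stM; split|split].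
    by move=> [Ml nml lg]; have [->|l0] := posnP l; [left|right; split].
  rewrite ncardU; [by rewrite ncard1|exact: finite_set1| |].
    by apply: (@finite_bounded _ g) => l [].
  by apply/seteqP; split=> // l [-> []].
apply: (@rank_sum _ ltn G (fun c => q%:R * q%:R ^+ c * f c)).
- by move=> g; rewrite /= ltnn.
- exact: ltn_trans.
- by move=> a b; rewrite neq_ltn.
- exact: fG.
Qed.

Lemma down_chain_sum (A : comNzRingType) (a : A) M : standard x y M ->
  finite_set (chain down_ok id down_step (K, M)) /\
  \sum_(l \in chain down_ok id down_step (K, M)) a ^+ size l =
  \prod_(i < (qrank x y M).-1) (1 + q%:R ^+ i.+1 * a).
Proof.
move=> stM; have [|||||fc ->] := @chain_sum _ down_ok id down_step A q%:R q%:R a up_good down_rank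
  _ _ _ _ (K, M); first 5 last.
- split=> //; rewrite (qrankE HC stM) /down_rank /=.
  set G := [set l | _].
  have -> : labels x y M = [set 0%N] `|` G.
    apply/seteqP; split=> l; last by move=> [->|[]//]; exact: labels0.
    move=> ll; have [->|l0] := posnP l; [by left|right; split=> //].
    exact: (labels_lt stM).
  rewrite ncardU; [|exact: finite_set1| |].
  + by rewrite ncard1 add1n /=; apply: eq_bigr => i _; rewrite exprS.
  + by apply: (@finite_bounded G K) => l [].
  + by apply/seteqP; split=> // l [-> []].
- by move=> [h N] P g g' _ [_ s1] [_ s2]; exact: (step_label_uniq s1 s2).
- move=> [h N] [h' P] /= stN [g [/= hg -> dNP]]; have [stP sPN] := dNP; split=> //.
  rewrite (down_rank_step stP sPN) /down_rank /=.
  have fG : finite_set [set l | [/\ labels x y N l, (0 < l)%N & (l < h)%N]].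
    by apply: (@finite_bounded _ h) => l [].
  have sub : [set l | [/\ labels x y N l, (0 < l)%N & (l < g)%N]] `<=`
             [set l | [/\ labels x y N l, (0 < l)%N & (l < h)%N]].
    by move=> l [ll l0 lg]; split=> //; exact: ltn_trans lg hg.
  rewrite ltn_neqAle ncard_sub // andbT; apply/eqP => e.
  have e' := ncard_sub_eq fG sub (eq_leq (esym e)).
  have [lg g0] := down_label stN dNP.
  have : [set l | [/\ labels x y N l, (0 < l)%N & (l < h)%N]] g by split.
  by rewrite -e' /= ltnn => -[].
- move=> [h N] /= stN.
  apply: (@sub_finite_set _ _ (`I_C `*` standard x y)); last first.
    by apply: finite_setX; [exact: finite_II|exact: (finite_standard HC)].
  move=> [h' P] [g [/= _ -> [stP sPN]]]; split=> //=.
  exact: (step_lt stP sPN).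
- by move=> s f gs; exact: down_sum.
- exact: stM.
Qed.

End Flags.

(** * The superpolynomial as a sum over modules *)

Section FlagSums.
Variables (F : finFieldType) (x y : series F) (C : nat).
Hypothesis HC : conductor_at x y C.
Local Notation K := (C + C)%N.
Local Notation q := #|F|.
Local Notation module := (set (series F)).
Implicit Types (M N : module) (m l s : seq module).

Local Notation mnth := (nth (set0 : module)).
Local Notation step := (@step F x y).
Local Notation up_chain N := (chain up_ok S step (0%N, N)).
Local Notation down_chain M := (chain down_ok id (@down_step F x y) (K, M)).

Definition flag_list m : Prop := standard x y (mnth m 0) /\
  exists g : nat -> nat,
    (forall i, (i.+1 < size m)%N -> step (mnth m i) (mnth m i.+1) (g i)) /\
    (forall i, (i.+2 < size m)%N -> (g i < g i.+1)%N).

Lemma flag_list_standard m i : flag_list m -> (i < size m)%N -> standard x y (mnth m i).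
Proof.
move=> [st0 [g [stg _]]]; elim: i => // i IH im.
exact: (step_standard (IH (ltnW im)) (stg i im)).
Qed.

Lemma standard_flagE (fl : module * seq module) :
  standard_flag x y fl <-> flag_list (fl.1 :: fl.2).
Proof.
case: fl => N s /=.
have nthE i : (i <= size s)%N -> flag_nth (N, s) i = mnth (N :: s) i.
  by move=> il; rewrite /flag_nth; apply: set_nth_default.
split=> [[st0 [g [gP gi]]]|fl].
  split=> //; exists (fun i => g i.+1); split=> i il; last exact: gi.
  have [|sM sub _ d nd] := gP i.+1; first by [].
  by rewrite -!nthE //; exact: ltnW.
have [st0 [g [gP gi]]] := fl.
split=> //; exists (fun i => g i.-1); split=> [[//|i] /= il|i j i1 ij jl].
  have sg := gP i il; have st : standard x y (mnth (N :: s) i).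
    by apply: (flag_list_standard fl); exact: ltnW.
  have ei : flag_nth (N, s) i = mnth (N :: s) i by apply: nthE; exact: ltnW.
  have ei' : flag_nth (N, s) i.+1 = mnth (N :: s) i.+1 by exact: nthE.
  have [sM sub dM nd] := sg; rewrite ei ei'; split=> //.
  have [sN _] := st.
  rewrite (dim_quotE (submodule_subspace sN) (submodule_subspace sM) (standard_tailK HC st)) //.
  suff -> : Delta (mnth (N :: s) i.+1) `\` Delta (mnth (N :: s) i) = [set g i] by rewrite ncard1.
  rewrite dM; apply/seteqP; split=> k; first by move=> [[]].
  by move=> ->; split=> //; right.
have mono a b : (a < b)%N -> (b < size s)%N -> (g a < g b)%N.
  elim: b => // b IH; rewrite ltnS leq_eqVlt => /orP[/eqP->|ab] bs; first exact: gi.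
  exact: ltn_trans (IH ab (ltnW bs)) (gi _ bs).
have jl' : (j <= size s)%N := jl.
by case: i i1 ij => // i _; case: j jl' {jl} => // j jl' ij; exact: mono.
Qed.

Lemma flag_list_up N s :
  flag_list (N :: s) <-> standard x y N /\ up_chain N s.
Proof.
split=> [[st0 [g [gP gi]]]|[st0 /chain_labels[g [gP gi _]]]].
  split=> //; apply/chain_labels; exists g; split=> // i il.
  rewrite (set_nth_default set0) /=; last exact: leqW.
  by rewrite [nth _ s i](set_nth_default set0) //; exact: gP.
split=> //; exists g; split=> // i il.
have := gP i il; rewrite (set_nth_default set0) /=; last exact: leqW.
by rewrite [nth _ s i](set_nth_default set0).
Qed.

Lemma flag_list_down M l : standard x y M ->
  flag_list (rev (M :: l)) <-> down_chain M l.
Proof.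
move=> stM; have sz : size (rev (M :: l)) = (size l).+1 by rewrite size_rev.
have nE i : (i <= size l)%N -> mnth (M :: l) i = mnth (rev (M :: l)) (size l - i).
  move=> il; rewrite nth_rev /= ?subSS; last by rewrite ltnS leq_subr.
  by rewrite subKn.
have a1 n i : (i < n)%N -> (n - i = (n - i.+1).+1)%N by lia.
have a2 n i : (i < n)%N -> (n - i.+1 < n.+1)%N by lia.
have a3 n i : (i < n)%N -> ((n - i.+1).+1 < n.+1)%N by lia.
have a4 n i : (i < n)%N -> (n - (n - i.+1) = i.+1)%N by lia.
have a5 n i : (i < n)%N -> (n - (n - i.+1).+1 = i)%N by lia.
have a6 n i : (i < n)%N -> (n - i.+1 < n)%N by lia.
split=> [fl|/chain_labels[g [gP gi _]]].
  have [_ [g [gP gi]]] := fl; apply/chain_labels.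
  have gS i : (i < size l)%N ->
      standard x y (mnth (M :: l) i.+1) /\
      step (mnth (M :: l) i.+1) (mnth (M :: l) i) (g (size l - i.+1)%N).
    move=> il; rewrite !nE //; last exact: ltnW.
    split; first by apply: (flag_list_standard fl); rewrite sz; exact: a2.
    by rewrite (a1 _ _ il); apply: gP; rewrite sz; exact: a3.
  exists (fun i => g (size l - i.+1)%N); split=> [i il|i il|il].
  - rewrite (set_nth_default set0) /=; last exact: leqW.
    by rewrite [nth _ l i](set_nth_default set0) //; exact: gS.
  - by rewrite /down_ok /= (a1 _ _ il); apply: gi; rewrite sz -(a1 _ _ il); exact: a3 (ltnW il).
  - have [st sg] := gS 0%N il; have := step_lt HC st sg.
    by rewrite /down_ok => lt; apply: (leq_trans lt); exact: leq_addr.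
have gS i : (i < size l)%N ->
    down_step x y (mnth (M :: l) i) (mnth (M :: l) i.+1) (g i).
  move=> il; have := gP i il; rewrite (set_nth_default set0) /=; last exact: leqW.
  by rewrite [nth _ l i](set_nth_default set0).
split.
  rewrite -[0%N](subnn (size l)) -nE //.
  case: (posnP (size l)) => [->//|l0].
  have := gS _ (a6 _ _ l0); rewrite subn1 => -[].
  by rewrite prednK.
exists (fun i => g (size l - i.+1)%N); rewrite sz; split=> i; rewrite ltnS => il.
  have [_] := gS _ (a6 _ _ il).
  rewrite nE; last exact: (a6 _ _ il).
  by rewrite nE; [rewrite (a4 _ _ il) (a5 _ _ il)|exact: ltnW (a6 _ _ il)].
have := gi (size l - i.+2)%N; rewrite /down_ok /= -(a1 _ _ il); apply.
exact: a6 (ltnW il).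
Qed.

Lemma finite_standard_flag : finite_set (standard_flag x y).
Proof.
apply: (@sub_finite_set _ _ (\bigcup_(N in standard x y) [set (N, s) | s in up_chain N])).
  move=> [N s] /standard_flagE /flag_list_up[stN ch]; exists N => //; by exists s.
apply: bigcup_finite => [|N stN]; first exact: (finite_standard HC).
by apply: finite_image; have [] := up_chain_sum HC (1 : int) stN.
Qed.

Lemma flag_top (fl : module * seq module) :
  flag_nth fl (flag_length fl) = last fl.1 fl.2.
Proof. by rewrite /flag_nth /flag_length -[size _]/(size (fl.1 :: fl.2)).-1 nth_last. Qed.

(** The flags are grouped by their last member and read downwards. *)
Lemma Hmot_top (A : comNzRingType) (t a : A) : Hmot x y t a =
  \sum_(M \in standard x y)
     t ^+ deg M * \prod_(i < (qrank x y M).-1) (1 + q%:R ^+ i.+1 * a).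
Proof.
rewrite /Hmot; have fS := finite_standard HC.
rewrite (fsum_fib _ finite_standard_flag fS (p := fun fl => last fl.1 fl.2)); last first.
  move=> [N s] /standard_flagE fl /=; have := flag_list_standard fl (ltnSn (size s)).
  by rewrite -[size s]/(size (N :: s)).-1 nth_last.
apply: eq_fsum => M stM; have [fc <-] := down_chain_sum HC a stM.
rewrite (fsum_mull _ _ fc).
pose h l : module * seq module := (head M (rev (M :: l)), behead (rev (M :: l))).
have hE l : (h l).1 :: (h l).2 = rev (M :: l).
  by rewrite /h /=; case: (rev _) (size_rev (M :: l)).
have -> : standard_flag x y `&` [set fl | last fl.1 fl.2 = M] =
          [set h l | l in down_chain M].
  apply/seteqP; split=> [fl [/standard_flagE flP /= eM]|_ [l cl <-]].
    have e : rev (fl.1 :: fl.2) = M :: behead (rev (fl.1 :: fl.2)).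
      by rewrite lastI rev_rcons eM.
    exists (behead (rev (fl.1 :: fl.2))).
      by apply/(flag_list_down _ stM); rewrite -e revK.
    by rewrite /h -e revK; case: (fl).
  split; first by apply/standard_flagE; rewrite hE; exact/(flag_list_down _ stM).
  rewrite /= -[last _ _]/(last M ((h l).1 :: (h l).2)) hE rev_cons last_rcons.
  by [].
rewrite fsbig_image => [|l l' _ _ e]; last first.
  have : rev (M :: l) = rev (M :: l') by rewrite -!hE e.
  by move/(can_inj revK) => -[].
apply: eq_fsum => l cl; rewrite flag_top.
have -> : last (h l).1 (h l).2 = M.
  by rewrite -[last _ _]/(last M ((h l).1 :: (h l).2)) hE rev_cons last_rcons.
congr (_ * _ ^+ _); rewrite /flag_length.
by have := congr1 size (hE l); rewrite size_rev => -[].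
Qed.

Lemma up_chain_gaps N s : standard x y N -> up_chain N s ->
  (deg N = deg (last N s) + size s)%N.
Proof.
move=> stN /(conj stN)/flag_list_up fl.
suff H i : (i <= size s)%N -> (gaps (Delta N) = gaps (Delta (mnth (N :: s) i)) + i)%N.
  have stl := flag_list_standard fl (ltnSn (size s)).
  have := H _ (leqnn _); rewrite -[X in mnth _ X]/(size (N :: s)).-1 nth_last /=.
  rewrite -[X in mnth _ X]/(size (N :: s)).-1 nth_last /= in stl.
  by rewrite (deg_gaps HC stN) (deg_gaps HC stl).
elim: i => [|i IH] il; first by rewrite addn0.
have [_ [g [gP _]]] := fl; have st := flag_list_standard fl (leqW il).
by rewrite (IH (ltnW il)) (step_gaps HC st (gP i il)) addSnnS.
Qed.

(** The flags are grouped by their first member. Every step lowers the degree by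
    one, which the factor [t] of the weight [t * b] compensates. *)
Lemma Hmot_bottom (A : comNzRingType) (t b : A) : Hmot x y t (t * b) =
  \sum_(N \in standard x y) t ^+ deg N * \prod_(i < tau x y N) (1 + q%:R ^+ i * b).
Proof.
rewrite /Hmot; have fS := finite_standard HC.
rewrite (fsum_fib _ finite_standard_flag fS (p := fst)); last first.
  by move=> [N s] /standard_flagE/flag_list_up[].
apply: eq_fsum => N stN; have [fc <-] := up_chain_sum HC b stN.
rewrite (fsum_mull _ _ fc).
have -> : standard_flag x y `&` [set fl | fl.1 = N] = [set (N, s) | s in up_chain N].
  apply/seteqP; split=> [[N' s] [/standard_flagE/flag_list_up[_ ch] /= e]|_ [s cs <-]].
    by rewrite e in ch *; exists s.
  by split=> //; apply/standard_flagE/flag_list_up.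
rewrite fsbig_image => [|s s' _ _ []//].
apply: eq_fsum => s cs; rewrite flag_top /flag_length /= exprMn mulrA -exprD.
by rewrite (up_chain_gaps stN cs).
Qed.

End FlagSums.

(** * Gorenstein duality for a plane branch *)

Section Socle.
Variables (F : finFieldType) (x y : series F) (C : nat).
Hypothesis HC : conductor_at x y C.
Local Notation R := (branch_ring x y).
Local Notation mm := (max_ideal x y).
Implicit Types (f : series F).

Lemma series_mulf_eq0 f g : f * g = 0 -> f <> 0 -> g = 0.
Proof.
move=> fg /val_ex[m fm]; apply: contrapT => /val_ex[n gn].
by have [] := valM fm gn; rewrite fg coef0_series eqxx.
Qed.

Lemma series_mulI f g h : f <> 0 -> f * g = f * h -> g = h.
Proof.
move=> f0 e; apply/eqP; rewrite -subr_eq0; apply/eqP.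
by apply: (@series_mulf_eq0 f) => //; rewrite mulrBr e subrr.
Qed.

Lemma branch_exp f i : R f -> R (f ^+ i).
Proof.
have [x0 y0 _ _] := HC; move=> Rf; elim: i => [|i IH]; first exact: branch1.
by rewrite exprS; exact: branch_mul.
Qed.

Lemma branch_inv (u w : series F) : R u -> u * w = 1 -> R w.
Proof.
have [x0 y0 _ tC] := HC; have sR := branch_subspace x y.
move=> Ru uw; have [[u0 _] _] := val_unit uw; pose c := (u 0%N)^-1.
pose m := 1 - c *: u.
have Rm : R m by apply: (subspaceB sR); [exact: branch1|exact: (subspaceZ sR)].
have m0 : m 0%N = 0 by rewrite /m coefB_series coefZ_series mulVf // subrr.
have e : (c *: u) * (\sum_(i < C) m ^+ i) = 1 - m ^+ C.
  have -> : c *: u = 1 - m by rewrite /m subKr.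
  rewrite -{2}(expr1n _ C) subrXX; congr (_ * _).
  by apply: eq_bigr => i _; rewrite expr1n mul1r.
have -> : w = c *: (\sum_(i < C) m ^+ i) + w * m ^+ C.
  rewrite -[X in X = _]mulr1 -(subrK (m ^+ C) 1) -e mulrDr scaler_mull.
  by rewrite scaler_mulr mulrA [w * u]mulrC uw mul1r.
apply: (subspaceD sR).
  by apply: (subspaceZ sR); apply: (subspace_sum sR) => i _; exact: branch_exp.
by apply: tC; apply: tail_mulr; exact: tail1_exp.
Qed.

Lemma ser1_order (p : nat -> F) (w : series F) k : w 0%N = 0 ->
  (forall i, (i < k)%N -> p i = 0) -> ser1 p w = w ^+ k * ser1 (fun i => p (k + i)%N) w.
Proof.
move=> w0; elim: k => [|k IH] pk; first by rewrite expr0 mul1r.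
rewrite IH => [|i ik]; last by apply: pk; exact: ltnW.
rewrite [ser1 _ w in LHS]ser1_split // addn0 pk // scale0r add0r mulrA -exprSr.
by congr (_ * ser1 _ _); apply/funext => i; rewrite addnS.
Qed.

Lemma ser1_0 (p : nat -> F) (w : series F) : w 0%N = 0 -> (ser1 p w) 0%N = p 0%N.
Proof. by move=> w0; rewrite /ser1 big_ord1 expr0 mulr1. Qed.

(** Since [R = x R + F[[y]]], multiplication by [x] sends a class of the socle
    of [F[[z]] / R] to a power of [y], up to units. *)
Lemma socle_monomial v : x <> 0 -> soc x y R v -> ~ R v ->
  exists k c r, [/\ R r, c != 0 & x * (c *: v + r) = y ^+ k].
Proof.
have [x0 y0 _ tC] := HC; have sR := branch_subspace x y.
move=> xn0 sv nRv.
have mx : mm x by split=> //; exact: branch_x.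
have [r [p [Rr e]]] := branch_split x0 y0 (sv _ mx).
have [ex|p0] := pselect (exists k, p k != 0); last first.
  case: nRv; rewrite (_ : v = r) //; apply: (series_mulI xn0); rewrite e.
  rewrite (_ : ser1 p y = 0) ?addr0 //; apply/funext => n.
  rewrite /ser1 big1 // => i _; suff -> : p i = 0 by rewrite mul0r.
  by apply/eqP; apply: contrapT => /negP pi; apply: p0; exists i.
have [k pk kmin] := ex_minnP ex.
have pk0 i : (i < k)%N -> p i = 0.
  by move=> ik; apply/eqP; apply: contraTT ik => /kmin; rewrite -leqNgt.
set u := ser1 (fun i => p (k + i)%N) y.
have u0 : u 0%N != 0 by rewrite /u ser1_0 // addn0.
have [w uw] := series_inv u0.
have Rw : R w by apply: branch_inv uw; exact: branch_ser1y.
have [_ [w0 _]] := val_unit uw.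
pose w' := w - w 0%N *: (1 : series F).
have mw : mm w'.
  split; last by rewrite /w' coefB_series coefZ_series mulr1 subrr.
  by apply: (subspaceB sR) => //; apply: (subspaceZ sR); exact: branch1.
exists k, (w 0%N), (w' * v - w * r); split=> //.
  by apply: (subspaceB sR); [exact: sv|exact: branch_mul].
have -> : w 0%N *: v + (w' * v - w * r) = w * (v - r).
  by rewrite /w' mulrBl scaler_mull mul1r mulrBr addrA addrC; ring.
by rewrite mulrCA mulrBr e addrC addKr (ser1_order y0 pk0) -/u mulrCA [w * u]mulrC uw mulr1.
Qed.

(** If the two powers of [y] differed, then the class with the larger one would be
    a multiple of the other by the maximal ideal, hence zero. *)
Lemma socle_pair v1 v2 : x <> 0 -> soc x y R v1 -> ~ R v1 -> soc x y R v2 -> ~ R v2 ->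
  exists c r, R r /\ v1 = r + c *: v2.
Proof.
have [x0 y0 _ tC] := HC; have sR := branch_subspace x y.
have my : mm y by split=> //; exact: branch_y.
move=> xn0 s1 n1 s2 n2.
have [k1 [c1 [r1 [Rr1 c10 e1]]]] := socle_monomial xn0 s1 n1.
have [k2 [c2 [r2 [Rr2 c20 e2]]]] := socle_monomial xn0 s2 n2.
have lt a b v v' c c' r r' : (a < b)%N -> soc x y R v -> R r -> R r' -> c' != 0 ->
    x * (c *: v + r) = y ^+ a -> x * (c' *: v' + r') = y ^+ b -> R v'.
  move=> ab sv Rr Rr' c'0 e e'.
  have H : R (y ^+ (b - a) * (c *: v + r)).
    have -> : (b - a)%N = (b - a.+1).+1 by lia.
    rewrite exprSr -mulrA; apply: (branch_mul x0 y0); first by apply: branch_exp; case: my.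
    rewrite mulrDr scaler_mulr; apply: (subspaceD sR).
      by apply: (subspaceZ sR); exact: sv.
    by apply: (branch_mul x0 y0) => //; case: my.
  have E : c' *: v' + r' = y ^+ (b - a) * (c *: v + r).
    by apply: (series_mulI xn0); rewrite e' mulrCA e -exprD subnK // ltnW.
  have -> : v' = c'^-1 *: ((c' *: v' + r') - r') by rewrite addrK scalerA mulVf ?scale1r.
  by rewrite E; apply: (subspaceZ sR); exact: (subspaceB sR).
have k12 : k1 = k2.
  by have [h|h|//] := ltngtP k1 k2; [case: n2; exact: (lt _ _ _ _ _ _ _ _ h s1 Rr1 Rr2 c20 e1 e2)
    |case: n1; exact: (lt _ _ _ _ _ _ _ _ h s2 Rr2 Rr1 c10 e2 e1)].
have E : c1 *: v1 + r1 = c2 *: v2 + r2 by apply: (series_mulI xn0); rewrite e1 e2 k12.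
exists (c1^-1 * c2), (c1^-1 *: (r2 - r1)); split.
  by apply: (subspaceZ sR); exact: (subspaceB sR).
have -> : v1 = c1^-1 *: ((c1 *: v1 + r1) - r1) by rewrite addrK scalerA mulVf ?scale1r.
by rewrite E -addrA addrC scalerDr scalerA.
Qed.

End Socle.

Section Duality.
Variables (F : finFieldType) (x y : series F) (C : nat).
Hypothesis HC : conductor_at x y C.
Local Notation R := (branch_ring x y).
Local Notation Gam := (Gamma x y).
Local Notation mulm := (max_ideal_mul x y).
Hypothesis C_gap : ~ Gam C.-1.
Implicit Types (f : series F) (A N : set (series F)).

Let x0 : x 0%N = 0. Proof. by case: HC. Qed.
Let y0 : y 0%N = 0. Proof. by case: HC. Qed.
Let C0 : (0 < C)%N. Proof. by case: HC. Qed.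
Let tC : tail C `<=` R. Proof. by case: HC. Qed.
Let sR : subspace R. Proof. exact: branch_subspace. Qed.

Lemma conductor_at_swap (u v : series F) : conductor_at u v C -> conductor_at v u C.
Proof. by move=> [u0 v0 C1 t]; exact: (And4 v0 u0 C1 (fun f tf => branch_swap (t f tf))). Qed.

Lemma socle_zn : soc x y R (zn F C.-1) /\ ~ R (zn F C.-1).
Proof.
split=> [a ma|Rz]; last first.
  by apply: C_gap; exists (zn F C.-1) => //; exact: val_zn.
apply: tC; rewrite -(prednK C0) -add1n; apply: tailM; last exact: tail_zn.
exact: (max_ideal_tail ma).
Qed.

(** The ring of a plane branch is Gorenstein: the socle of [F[[z]] / R] is a line. *)
Lemma socle_line v : soc x y R v -> exists c r, R r /\ v = r + c *: zn F C.-1.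
Proof.
move=> sv; have [Rv|nRv] := pselect (R v).
  by exists 0, v; rewrite scale0r addr0.
have [sz nz] := socle_zn.
have [xe|xn] := pselect (x = 0); last exact: (socle_pair HC xn sv nRv sz nz).
have yn : y <> 0.
  move=> ye; have [||r [s [_ _ e]]] := @branch_max_split _ x y x0 y0 (zn F C).
  - by apply: tC; exact: tail_zn.
  - by rewrite /zn ltn_eqF.
  move/(congr1 (fun f : series F => f C)): e; rewrite zn_id xe ye !mul0r addr0.
  by move/eqP; rewrite oner_eq0.
have swap w : soc x y R w -> soc y x (branch_ring y x) w.
  by move=> sw a [Ra a0]; exact: branch_swap (sw a (conj (branch_swap Ra) a0)).
have nswap w : ~ R w -> ~ branch_ring y x w by move=> nw /branch_swap.
have [c [r [Rr e]]] := socle_pair (conductor_at_swap HC) yn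
  (swap _ sv) (nswap _ nRv) (swap _ sz) (nswap _ nz).
by exists c, r; split; [exact: (branch_swap Rr)|exact: e].
Qed.

Lemma residue_branch : exists rho : series F -> F,
  residue_form C rho /\ forall r, R r -> rho r = 0.
Proof.
have [l [ll lR lk]] := separating_form sR tC C_gap.
exists l; split=> //; split=> //; first by move=> f /tC /lR.
by rewrite lk ?zn_id //; exact: tail_zn.
Qed.

Variable rho : series F -> F.
Hypotheses (rhoP : residue_form C rho) (rhoR : forall r, R r -> rho r = 0).

(** A class outside [R] has a multiple in the socle, where the residue does
    not vanish. *)
Lemma residue_detects v : (forall r, R r -> rho (r * v) = 0) -> R v.
Proof.
move=> rv; apply: contrapT => nRv.
have [rl rt r1 _] := rhoP.
pose P n := `[< exists r, [/\ R r, tail n r & ~ R (r * v)] >].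
have ex : exists n, P n.
  by exists 0%N; apply/asboolP; exists 1; rewrite mul1r; split=> //; exact: branch1.
have ub n : P n -> (n <= C)%N.
  move=> /asboolP[r [_ tr nR]]; rewrite leqNgt; apply/negP => Cn; apply: nR; apply: tC.
  by rewrite mulrC; apply: tail_mulr; apply: tailW (ltnW Cn) tr.
have [n /asboolP[r [Rr tr nR]] nmax] := ex_maxnP ex ub.
have sr : soc x y R (r * v).
  move=> a ma; apply: contrapT => nRa.
  have /nmax : P n.+1.
    apply/asboolP; exists (a * r); split; last by rewrite -mulrA.
      by apply: (branch_mul x0 y0) => //; case: ma.
    by rewrite -add1n; apply: tailM => //; exact: (max_ideal_tail ma).
  by rewrite ltnn.
have [c [s [Rs e]]] := socle_line sr.
have := rv _ Rr; rewrite e addrC rl r1 (rhoR Rs) addr0 mulr1 => c0.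
by apply: nR; rewrite e c0 scale0r addr0.
Qed.

Lemma perp_branch : perp rho R = R.
Proof.
apply/seteqP; split=> b; first by move=> bR; apply: residue_detects.
by move=> Rb r Rr; apply: rhoR; exact: branch_mul.
Qed.

Lemma Gamma_symmetric h : (h < C)%N -> Gam h <-> ~ Gam (C.-1 - h)%N.
Proof.
move=> hC; rewrite {1}/Gamma -perp_branch (Delta_perp rhoP h sR tC).
by split=> [[|//]|]; [lia|right].
Qed.

Lemma perp_submodule N : is_submodule x y N -> is_submodule x y (perp rho N).
Proof.
move=> sN; have [p0 pD] := subspace_perp rhoP N; split=> //.
  by move=> f g pf pg; rewrite -[f]scale1r; exact: pD.
by move=> r b Rr pb a Na; rewrite mulrCA mulrA; apply: pb; exact: (submoduleM sN Rr Na).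
Qed.

(** For [a] in the maximal ideal, [a * v] lies in [N = perp (perp N)] iff [v] is
    orthogonal to all [a * b] with [b] in [perp N]. *)
Lemma soc_perp N : is_submodule x y N -> tail C `<=` N ->
  soc x y N = perp rho (addS (mulm (perp rho N)) (tail C)).
Proof.
move=> sN tN; have sNv := submodule_subspace sN; have [rl rt _ _] := rhoP.
have sp := perp_submodule sN.
apply/seteqP; split=> v.
  move=> sv _ [m [t [mm_m tt ->]]]; rewrite mulrDl (linear_formD rl).
  rewrite (rt (t * v)) ?addr0; last by rewrite mulrC; exact: tail_mulr.
  suff : [set m | rho (m * v) = 0] m by [].
  move: m mm_m; apply: mulm_min => /=; first by rewrite mul0r linear_form0.
    by move=> f g f0 g0; rewrite mulrDl (linear_formD rl) f0 g0 addr0.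
  move=> a b ma pb; rewrite [a * b]mulrC -mulrA mulrC; apply: pb; exact: sv.
move=> pv a ma; rewrite -(perpK rhoP sNv tN) => b pb.
rewrite mulrA [b * a]mulrC; apply: pv; apply: addSl; first exact: subspace_tail.
exact: (mulm_in ma pb).
Qed.

End Duality.

(** * The modules [N] for which [F[[z]] / N] has a simple socle *)

Definition elements_below (G : set nat) (n : nat) : nat :=
  ncard [set k | G k /\ (k < n)%N].

Section TauOne.
Variables (F : finFieldType) (x y : series F) (C : nat).
Hypothesis HC : conductor_at x y C.
Local Notation R := (branch_ring x y).
Local Notation Gam := (Gamma x y).
Local Notation mulm := (max_ideal_mul x y).
Local Notation q := #|F|.
Hypothesis C_gap : ~ Gam C.-1.
Implicit Types (f : series F) (A B M N : set (series F)).

Let x0 : x 0%N = 0. Proof. by case: HC. Qed.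
Let y0 : y 0%N = 0. Proof. by case: HC. Qed.
Let C0 : (0 < C)%N. Proof. by case: HC. Qed.
Let sRm : is_submodule x y R. Proof. exact: (submodule_branch HC). Qed.
Let sR : subspace R. Proof. exact: branch_subspace. Qed.

Variable rho : series F -> F.
Hypotheses (rhoP : residue_form C rho) (rhoR : forall r, R r -> rho r = 0).

Lemma ncard_perp_diff A B : subspace A -> subspace B -> tail C `<=` A -> A `<=` B ->
  ncard (Delta (perp rho A) `\` Delta (perp rho B)) = ncard (Delta B `\` Delta A).
Proof.
move=> sA sB tA AB; have tB : tail C `<=` B by move=> f /tA /AB.
have ltC k : ~ Delta A k -> (k < C)%N.
  move=> nAk; rewrite ltnNge; apply/negP => Ck; apply: nAk.
  exact: (Delta_of_tail tA Ck).
have a1 k : (k < C)%N -> (C.-1 - (C.-1 - k) = k)%N by lia.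
have a2 k : (k < C)%N -> (C.-1 - k < C)%N by lia.
have [|||| _ ->//] := @ncard_bij _ _ (Delta B `\` Delta A)
   (Delta (perp rho A) `\` Delta (perp rho B)) (fun k => (C.-1 - k)%N).
- by apply: (@finite_bounded _ C) => k [_ /ltC].
- move=> k [Bk nAk]; have kC := ltC _ nAk.
  split; first by apply/(Delta_perp rhoP _ sA tA); right; rewrite a1.
  by move/(Delta_perp rhoP _ sB tB) => -[|]; [rewrite leqNgt a2|rewrite a1].
- by move=> k j [_ /ltC kC] [_ /ltC jC] e; rewrite -(a1 _ kC) e a1.
- move=> k [/(Delta_perp rhoP _ sA tA) Ak nBk].
  have {nBk} [Ck nB] : ~ (C <= k)%N /\ ~ ~ Delta B (C.-1 - k)%N.
    by split=> h; apply: nBk; apply/(Delta_perp rhoP _ sB tB); [left|right].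
  have kC : (k < C)%N by rewrite ltnNge; apply/negP.
  exists (C.-1 - k)%N; last exact: a1.
  by split; [exact: contrapT|case: Ak].
Qed.

(** Duality turns the socle of [F[[z]] / N] into the generators of the dual
    module that are visible below the conductor. *)
Lemma tauE N : standard x y N -> tau x y N =
  ncard (Delta (perp rho N) `\` Delta (addS (mulm (perp rho N)) (tail C))).
Proof.
move=> stN; have [sN _] := stN; have sNv := submodule_subspace sN.
have tN := standard_tail HC stN; have sp := perp_submodule rhoP sN.
have smp := submodule_subspace (mulm_submodule sp).
rewrite /tau /upper_labels (soc_perp rhoP sN tN).
rewrite -{2}(perpK rhoP sNv tN) ncard_perp_diff //.
- exact: (subspace_add smp (@subspace_tail F C)).
- exact: (submodule_subspace sp).
- exact: (addSr smp).
- move=> _ [m [t [mm_m tt ->]]]; apply: (subspaceD (submodule_subspace sp)).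
    exact: (mulm_sub sp).
  exact: (perp_tail rhoP).
Qed.

Definition cyc (b : series F) : set (series F) := addS (scale b R) (tail C).

Lemma cyc_submodule b : is_submodule x y (cyc b).
Proof. exact: (submodule_add (scale_submodule b sRm) (submodule_tail x y C)). Qed.

Lemma cyc_tail b : tail C `<=` cyc b.
Proof. exact: (addSr (submodule_subspace (scale_submodule b sRm))). Qed.

Lemma cyc_self b : cyc b b.
Proof.
apply: (addSl (@subspace_tail F C)); exists 1; last by rewrite mulr1.
exact: branch1.
Qed.

Lemma cyc_min b M : is_submodule x y M -> tail C `<=` M -> M b -> cyc b `<=` M.
Proof.
move=> sM tM Mb _ [_ [t [[r Rr ->] tt ->]]]; apply: (subspaceD (submodule_subspace sM)).
  by rewrite mulrC; exact: (submoduleM sM Rr Mb).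
exact: tM.
Qed.

Lemma Delta_cyc b s k : has_valuation b s ->
  Delta (cyc b) k <-> (C <= k)%N \/ exists2 c, Gam c & k = (s + c)%N.
Proof.
move=> bs; rewrite /cyc (Delta_add_tail _ (submodule_subspace (scale_submodule b sRm))).
split=> [[[_ [r Rr ->] bk]|/= Ck]|[Ck|[c [r Rr rc] ->]]].
- have [e|/val_ex[c rc]] := pselect (r = 0).
    by case: bk; rewrite e mulr0 coef0_series eqxx.
  by right; exists c; [exists r|exact: (val_uniq bk (valM bs rc))].
- by left.
- by right.
- by left; exists (b * r); [exists r|exact: valM].
Qed.

Lemma cyc_tail_val b s : has_valuation b s -> (s < C)%N -> cyc b `<=` @tail F s.
Proof.
move=> bs sC; apply: cyc_min; [exact: (submodule_tail x y)|move=> f; exact: (tailW (ltnW sC))|].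
exact: (val_tail bs).
Qed.

(** One generator suffices for the dual module, by Nakayama's lemma. *)
Lemma tau1_cyc N : standard x y N -> tau x y N = 1%N ->
  exists b s, [/\ has_valuation b s, (s < C)%N & perp rho N = cyc b].
Proof.
move=> stN; rewrite (tauE stN); have [sN _] := stN.
have sp := perp_submodule rhoP sN; have spv := submodule_subspace sp.
have tp := @perp_tail _ _ _ rhoP N; set P := perp rho N in sp spv tp *.
have smp := submodule_subspace (mulm_submodule sp).
set Q := addS _ _; have sQ : subspace Q by exact: (subspace_add smp (@subspace_tail F C)).
have tQ : tail C `<=` Q by exact: (addSr smp).
have QP : Q `<=` P.
  move=> _ [m [t [mm_m tt ->]]]; apply: (subspaceD spv); first exact: (mulm_sub sp).
  exact: tp.
set L := _ `\` _ => cL.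
have ltC k : ~ Delta Q k -> (k < C)%N.
  move=> nQk; rewrite ltnNge; apply/negP => Ck; apply: nQk.
  exact: (Delta_of_tail tQ Ck).
have fL : finite_set L by apply: (@finite_bounded _ C) => k [_ /ltC].
have [s Ls] : exists s, L s.
  apply: contrapT => nL; have e : L = set0 by apply/seteqP; split=> // k Lk; apply: nL; exists k.
  by move: cL; rewrite e ncard0.
have eL : [set s] = L.
  by apply: ncard_sub_eq => //; [move=> _ ->|rewrite cL ncard1].
have [[b Pb bs] nQs] := Ls; exists b, s; split=> //; first exact: ltC.
have sc := cyc_submodule b; have scv := submodule_subspace sc.
apply: (nakayama (C := C) sp sc).
- move=> f tf; apply: cyc_tail; exact: tailW (leq_addr _ _) tf.
- exact: (cyc_min sp tp Pb).
have sl := subspace_line b.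
have eP : addS (line b) Q = P.
  apply: (@Delta_sub_eq _ C) => //.
  - exact: (subspace_add sl sQ).
  - by move=> f /tQ; exact: (addSr sl).
  - move=> _ [_ [m [[c ->] Qm ->]]]; apply: (subspaceD spv); last exact: QP.
    exact: (subspaceZ spv).
  move=> k Pk; have [Qk|nQk] := pselect (Delta Q k).
    exact: (Delta_sub (addSr sl)).
  have : L k by [].
  rewrite -eL /= => ->; exists b => //; apply: (addSl sQ); exact: line_self.
rewrite -{1}eP => _ [_ [_ [[c ->] [m [t [mm_m tt ->]]] ->]]].
exists (c *: b + t), m; split=> //; last by rewrite addrAC addrA.
apply: (subspaceD scv); first by apply: (subspaceZ scv); exact: cyc_self.
exact: cyc_tail.
Qed.

Lemma cyc_mulm b s : has_valuation b s -> (s < C)%N ->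
  Delta (cyc b) `\` Delta (addS (mulm (cyc b)) (tail C)) = [set s].
Proof.
move=> bs sC; have sc := cyc_submodule b; have scv := submodule_subspace sc.
have smp := submodule_subspace (mulm_submodule sc).
have sQ := subspace_add smp (@subspace_tail F C).
set Q := addS _ _ in sQ *.
have Qs : Q `<=` @tail F s.+1.
  move=> _ [m [t [mm_m tt ->]]]; apply: (subspaceD (@subspace_tail F s.+1)).
    exact: (mulm_shift (cyc_tail_val bs sC) mm_m).
  exact: tailW sC tt.
have eP : addS (line b) Q = cyc b.
  have sl := subspace_line b; have sP := subspace_add sl sQ.
  apply/seteqP; split.
    move=> _ [_ [m [[c ->] Qm ->]]]; apply: (subspaceD scv).
      by apply: (subspaceZ scv); exact: cyc_self.
    case: Qm => [n [t [mn tt ->]]]; apply: (subspaceD scv); first exact: (mulm_sub sc).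
    exact: cyc_tail.
  move=> _ [_ [t [[r Rr ->] tt ->]]].
  have -> : b * r + t = r 0%N *: b + ((r - r 0%N *: (1 : series F)) * b + t).
    by rewrite mulrBl scaler_mull mul1r addrA [r * b]mulrC addrC [_ + (b * r - _)]addrC subrK addrC.
  apply: (subspaceD sP).
    by apply: (addSl sQ); exists (r 0%N).
  apply: (addSr sl); exists ((r - r 0%N *: (1 : series F)) * b), t; split=> //.
  apply: mulm_in; last exact: cyc_self.
  split; last by rewrite coefB_series coefZ_series mulr1 subrr.
  by apply: (subspaceB sR) => //; apply: (subspaceZ sR); exact: branch1.
apply/seteqP; split=> k.
  rewrite -{1}eP => -[[_ [_ [m [[c ->] Qm ->]]] kv] nQ].
  have [c0|c0] := eqVneq c 0.
    by case: nQ; exists m => //; rewrite c0 scale0r add0r in kv.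
  apply: (val_uniq kv); split.
    by rewrite coefD_series coefZ_series (Qs _ Qm) // addr0 mulf_neq0 //; case: bs.
  move=> j js; rewrite coefD_series coefZ_series (Qs _ Qm) ?(val_tail bs) ?mulr0 ?addr0 //.
  exact: ltnW.
move=> ->; split; first by exists b => //; exact: cyc_self.
by move=> [m /Qs tm [ms _]]; move: ms; rewrite tm // eqxx.
Qed.

(** The number [0] is a valuation of [perp rho (cyc b)] iff [C.-1] is not one of
    [cyc b], that is, iff [C.-1 - s] is a gap; the semigroup is symmetric. *)
Lemma perp_cyc_standard b s : has_valuation b s -> (s < C)%N ->
  standard x y (perp rho (cyc b)) <-> Gam s.
Proof.
move=> bs sC; have sc := cyc_submodule b; have scv := submodule_subspace sc.
have sp := perp_submodule rhoP sc.
rewrite standardP (Delta_perp rhoP _ scv (@cyc_tail b)) subn0 leqn0 (gtn_eqF C0).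
rewrite (Delta_cyc _ bs); have C1 : (C <= C.-1)%N = false by lia.
rewrite C1; have sym := Gamma_symmetric HC C_gap rhoP rhoR sC.
split=> [[_ [//|H]]|Gs].
  apply/sym => G; apply: H; right; exists (C.-1 - s)%N => //; lia.
split=> //; right=> -[//|[c Gc e]]; move/sym: Gs; apply.
by rewrite (_ : (C.-1 - s)%N = c) //; lia.
Qed.

Lemma perp_cyc_deg b s : has_valuation b s -> (s < C)%N -> Gam s ->
  deg (perp rho (cyc b)) = elements_below Gam (C - s).
Proof.
move=> bs sC Gs; have sc := cyc_submodule b; have scv := submodule_subspace sc.
rewrite (deg_gaps HC ((perp_cyc_standard bs sC).2 Gs)) /gaps /elements_below -/(ncard _).
have [|||| _ ->//] := @ncard_bij _ _ [set k | Gam k /\ (k < C - s)%N]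
  (~` Delta (perp rho (cyc b))) (fun k => (C.-1 - (s + k))%N).
- by apply: (@finite_bounded _ (C - s)) => k [].
- move=> k [Gk kC] /(Delta_perp rhoP _ scv (@cyc_tail b)) -[|]; first by lia.
  apply; apply/(Delta_cyc _ bs); right; exists k => //; lia.
- by move=> k j [_ kC] [_ jC]; lia.
- move=> h nh.
  have {nh} [hC H] : ~ (C <= h)%N /\ ~ ~ Delta (cyc b) (C.-1 - h)%N.
    by split=> H; apply: nh; apply/(Delta_perp rhoP _ scv (@cyc_tail b)); [left|right].
  move/contrapT: H => /(Delta_cyc _ bs) [|[c Gc e]]; first by lia.
  exists c; [split=> //|]; lia.
Qed.

Lemma cyc_tau1 b s : has_valuation b s -> (s < C)%N -> Gam s ->
  tau x y (perp rho (cyc b)) = 1%N.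
Proof.
move=> bs sC Gs; have sc := cyc_submodule b; have scv := submodule_subspace sc.
rewrite (tauE ((perp_cyc_standard bs sC).2 Gs)) (perpK rhoP scv (@cyc_tail b)).
by rewrite (cyc_mulm bs sC) ncard1.
Qed.

(** A cyclic module [cyc b], with [b] of valuation [s], has a unique reduced
    generator [z ^ s + ...]; its free coefficients lie in the degrees [s + k] with
    [k] a gap below [C - s]. *)
Lemma tau1_sum (V : nmodType) (f : nat -> V) :
  \sum_(N \in [set N | standard x y N /\ tau x y N = 1%N]) f (deg N) =
  \sum_(s \in [set s | Gam s /\ (s < C)%N])
     f (elements_below Gam (C - s)) *+ (q ^ elements_below (~` Gam) (C - s)).
Proof.
set D := [set N | _]; set S := [set s | _].
have fD : finite_set D by apply: sub_finite_set (finite_standard HC) => N [].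
have fS : finite_set S by apply: (@finite_bounded _ C) => s [].
have /choice[p pP] : forall N, exists s, D N ->
    exists b, [/\ has_valuation b s, (s < C)%N & perp rho N = cyc b].
  move=> N; have [[stN t1]|] := pselect (D N); last by exists 0%N.
  by have [b [s bP]] := tau1_cyc stN t1; exists s => _; exists b.
have tN N : D N -> tail C `<=` N by move=> [stN _]; exact: (standard_tail HC stN).
have sN N : D N -> subspace N by move=> [[sN _] _]; exact: (submodule_subspace sN).
have pS N : D N -> S (p N).
  move=> DN; have [b [bs sC e]] := pP _ DN; split=> //.
  have [stN _] := DN; apply/(perp_cyc_standard bs sC).
  by rewrite -e (perpK rhoP (sN _ DN) (tN _ DN)).
rewrite (fsum_fib _ fD fS pS); apply: eq_fsum => s [Gs sC].
have ft : finite_set (D `&` [set N | p N = s]) by exact: finite_setIl.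
rewrite (fsum_cst (c := f (elements_below Gam (C - s))) ft); last first.
  move=> N [DN pN]; have [b [bs _ e]] := pP _ DN; rewrite /= in pN; rewrite pN in bs.
  by rewrite -(perp_cyc_deg bs sC Gs) -e (perpK rhoP (sN _ DN) (tN _ DN)).
congr (_ *+ _).
(* [z ^ s + u] is reduced if [u] vanishes in the degrees of [Delta (cyc b)]. *)
pose G := [set h | (s < h < C)%N /\ ~ Gam (h - s)%N].
have fG : finite_set G by apply: (@finite_bounded _ C) => h [/andP[]].
have [ff nf] := ncard_fns F fG.
pose b (u : series F) : series F := zn F s + u.
have bs u : fns G u -> has_valuation (b u) s.
  move=> uG; split.
    by rewrite /b coefD_series zn_id uG ?addr0 ?oner_neq0 //= => -[]; rewrite ltnn.
  by move=> k ks; rewrite /b coefD_series (@tail_zn F s) // uG ?addr0 //= => -[/andP[]]; lia.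
have bD u k : fns G u -> Delta (cyc (b u)) k -> (b u) k = (k == s)%:R.
  move=> uG /(Delta_cyc _ (bs _ uG)) H; rewrite /b coefD_series /zn uG ?addr0 // => -[sk].
  by case: H => [|[c Gc e]]; [lia|apply; rewrite e addKn].
have pb u : fns G u -> perp rho (perp rho (cyc (b u))) = cyc (b u).
  move=> uG; apply: (perpK rhoP); last exact: cyc_tail.
  exact: (submodule_subspace (cyc_submodule _)).
have Db u : fns G u -> D (perp rho (cyc (b u))).
  move=> uG; split; first exact/(perp_cyc_standard (bs _ uG) sC).
  exact: (cyc_tau1 (bs _ uG) sC Gs).
have [||| _ ->] := @ncard_bij _ _ (fns G) (D `&` [set N | p N = s])
    (fun u => perp rho (cyc (b u))) ff.
- move=> u uG; split; first exact: Db.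
  have [b' [bs' s'C e]] := pP _ (Db _ uG); rewrite (pb _ uG) in e.
  have : cyc (b u) b' by rewrite e; exact: cyc_self.
  have : cyc b' (b u) by rewrite -e; exact: cyc_self.
  move=> /(cyc_tail_val bs' s'C) t1 /(cyc_tail_val (bs _ uG) sC) t2.
  apply/eqP; rewrite /= eqn_leq; apply/andP; split; rewrite leqNgt; apply/negP => lt.
    by have [] := bs _ uG; rewrite t1 // eqxx.
  by have [] := bs'; rewrite t2 // eqxx.
- move=> u v uG vG e; have e' : cyc (b u) = cyc (b v) by rewrite -(pb _ uG) e (pb _ vG).
  have scv := submodule_subspace (cyc_submodule (b u)).
  have : b u = b v.
    apply: (echelon_uniq scv); [exact: cyc_self|rewrite e'; exact: cyc_self|].
    by move=> k Dk; rewrite (bD _ _ uG) // (bD _ _ vG) // -e'.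
  by move/addrI.
- move=> N [DN pN]; have [b0 [bs0 _ e]] := pP _ DN; rewrite /= in pN; rewrite pN in bs0.
  have sc := cyc_submodule b0; have scv := submodule_subspace sc.
  have [w cw ew] := echelon_ex scv (fun k => (k == s)%:R) (@cyc_tail b0).
  pose u := w - zn F s.
  have uG : fns G u.
    move=> k nGk; rewrite /u coefB_series.
    have tw : tail s w by exact: (cyc_tail_val bs0 sC).
    have [ks|sk|->] := ltngtP k s.
    + by rewrite tw // (@tail_zn F s) // subrr.
    + suff -> : w k = 0 by rewrite /zn gtn_eqF // subrr.
      rewrite ew ?gtn_eqF //; apply/(Delta_cyc _ bs0).
      have [Ck|kC] := leqP C k; [by left|right].
      exists (k - s)%N; last by lia.
      by apply: contrapT => nG; apply: nGk; split=> //; rewrite sk.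
    + rewrite ew ?eqxx ?zn_id ?subrr //; apply/(Delta_cyc _ bs0); right.
      by exists 0%N; [exact: Gamma0|rewrite addn0].
  exists u => //; have eb : b u = w by rewrite /b /u addrC subrK.
  rewrite -(perpK rhoP (sN _ DN) (tN _ DN)) e; congr (perp rho _).
  apply: (@Delta_sub_eq _ C) => //.
  + exact: (submodule_subspace (cyc_submodule _)).
  + exact: cyc_tail.
  + by apply: cyc_min => //; [exact: cyc_tail|rewrite eb].
  + by move=> k /(Delta_cyc _ bs0) H; apply/(Delta_cyc _ (bs _ uG)).
rewrite nf; congr (_ ^ _)%N.
have [|||| _ ->//] := @ncard_bij _ _ [set k | (~` Gam) k /\ (k < C - s)%N] G
  (fun k => (s + k)%N).
- by apply: (@finite_bounded _ (C - s)) => k [].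
- move=> k [nGk kC]; split; last by rewrite addKn.
  have : k <> 0%N by move=> k0; apply: nGk; rewrite k0; exact: Gamma0.
  by lia.
- by move=> k j _ _; lia.
- move=> h [sh nG]; exists (h - s)%N; last by lia.
  by split=> //; lia.
Qed.

(** Otherwise [z ^ g] lies in the socle for the largest gap [g] of [Delta N]. *)
Lemma tau0 N : standard x y N -> tau x y N = 0%N -> N = setT.
Proof.
move=> stN t0; apply: contrapT => NT; have [sN _] := stN.
have sNv := submodule_subspace sN; have tN := standard_tail HC stN.
have [||g [nNg Ng]] := max_gap HC (D := Delta N).
- by move=> k Gk; rewrite -[k]addn0; apply: (DeltaM sN) => //; case: (standard_Delta stN).
- move=> DT; apply: NT; apply/seteqP; split=> // f _.
  by apply: (tail_of_Delta sNv tN (n := 0%N)) => // k _; rewrite DT.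
have fl : finite_set (upper_labels x y N).
  by apply: (@finite_bounded _ C) => l; exact: (upper_labels_lt HC stN).
suff /(ncard_gt0 fl) : upper_labels x y N g by rewrite -/(tau x y N) t0.
split=> //; exists (zn F g); last exact: val_zn.
move=> a ma; apply: (tail_of_Delta sNv tN (n := g.+1)) => //.
by rewrite -add1n; apply: tailM; [exact: (max_ideal_tail ma)|exact: tail_zn].
Qed.

Lemma tau_setT : tau x y setT = 0%N /\ standard x y setT.
Proof.
split; last by split=> //; exists 1.
rewrite /tau /upper_labels (_ : _ `\` _ = set0) ?ncard0 //.
apply/seteqP; split=> k // [_]; apply; exists (zn F k) => //.
exact: val_zn.
Qed.

End TauOne.

(** * Finite extensions of the base field *)

Section Extensions.

(** The polynomial ['X^#|F| - 'X + 1] takes the value [1] on the whole of [F], and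
    so has its roots in a larger field. *)
Lemma bigger_extension (F : finFieldType) :
  exists (L : finFieldType) (iota : {rmorphism F -> L}), (#|F| < #|L|)%N.
Proof.
pose p : {poly F} := 'X^#|F| - 'X + 1.
have q1 : (1 < #|F|)%N by exact: card_finNzRing_gt1.
have pE a : p.[a] = 1 by rewrite /p !hornerE expf_card subrr add0r.
have sp : size p = #|F|.+1.
  rewrite /p -addrA size_polyDl size_polyXn // ltnS.
  by rewrite (leq_trans (size_polyD _ _)) // size_polyN size_polyX size_poly1 geq_max q1 ltnW.
have p0 : p != 0 by rewrite -size_poly_eq0 sp.
have [L [zs eqp _]] := FinSplittingFieldFor p0.
pose L' : finFieldType := FinFieldExtType L.
pose iota : {rmorphism F -> L'} := in_alg L.
exists L', iota; rewrite ltnNge; apply/negP => le.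
have sz : size (map_poly (in_alg L) p) = #|F|.+1 by rewrite size_map_poly sp.
case: zs eqp => [|z zs] eqp.
  move/eqp_size: eqp; rewrite sz big_nil size_poly1 => -[e].
  by rewrite e in q1.
have rz : root (map_poly (in_alg L) p) z.
  by rewrite (eqp_root eqp) root_prod_XsubC mem_head.
have inj : injective iota by exact: fmorph_inj.
have [g _ gK] : bijective iota by exact: inj_card_bij.
have := rz; rewrite -[z](gK z) /root (horner_map iota p) pE rmorph1.
by rewrite oner_eq0.
Qed.

Lemma unbounded_extensions (F : finFieldType) (N : nat) :
  exists (L : finFieldType) (iota : {rmorphism F -> L}), (N < #|L|)%N.
Proof.
elim: N => [|N [L [iota NL]]].
  by exists F, idfun; apply/card_gt0P; exists 0.
have [L' [iota' LL']] := bigger_extension L.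
by exists L', (iota' \o iota); exact: leq_ltn_trans NL LL'.
Qed.

Section LinearForm.
Variables (F L : finFieldType) (iota : {rmorphism F -> L}).

(** A linear form over [F] on [L] that does not vanish at [u]: the coefficient
    of [u] modulo a maximal subspace avoiding it. *)
Lemma extension_form (u : L) : u != 0 -> exists l : L -> F,
  (forall a v w, l (iota a * v + w) = a * l v + l w) /\ l u = 1.
Proof.
move=> u0.
pose P (H : {set L}) := `[< [/\ 0 \in H,
  forall a v w, v \in H -> w \in H -> iota a * v + w \in H & u \notin H] >].
have P0 : P (finset (pred1 0)).
  apply/asboolP; split; rewrite ?inE // => a v w.
  by rewrite !inE => /eqP-> /eqP->; rewrite mulr0 addr0.
have [H /maxsetP[/asboolP[H0 HD nHu] Hmax] _] := maxset_exists P0.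
have HM a v : v \in H -> iota a * v \in H.
  by move=> Hv; rewrite -[_ * _]addr0; exact: HD.
have HB v w : v \in H -> w \in H -> v - w \in H.
  by move=> Hv Hw; rewrite addrC -mulN1r -(rmorph1 iota) -rmorphN; exact: HD.
have ex v : exists c, v - iota c * u \in H.
  have [Hv|nHv] := boolP (v \in H); first by exists 0; rewrite rmorph0 mul0r subr0.
  pose H' := finset (fun w => [exists c, w - iota c * v \in H]).
  have HH' : H \subset H'.
    by apply/fintype.subsetP => w Hw; rewrite inE; apply/existsP; exists 0; rewrite rmorph0 mul0r subr0.
  have nP : ~ P H'.
    move=> PH'; have e := Hmax _ PH' HH'.
    by move: nHv; rewrite -e inE => /existsP; case; exists 1; rewrite rmorph1 mul1r subrr.
  have Hu : u \in H'.
    apply: contrapT => /negP nu; apply: nP; apply/asboolP; split=> //.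
      exact: (fintype.subsetP HH').
    move=> a w w'; rewrite !inE => /existsP[c Hc] /existsP[c' Hc'].
    apply/existsP; exists (a * c + c').
    have -> : iota a * w + w' - iota (a * c + c') * v =
              iota a * (w - iota c * v) + (w' - iota c' * v).
      by rewrite rmorphD rmorphM; ring.
    exact: HD.
  move: Hu; rewrite inE => /existsP[c Hc].
  have c0 : c != 0 by apply: contraNneq nHu => c0; rewrite c0 rmorph0 mul0r subr0 in Hc.
  exists c^-1; have -> : v - iota c^-1 * u = iota (- c^-1) * (u - iota c * v).
    have e : iota c^-1 * iota c = 1 by rewrite -rmorphM mulVf // rmorph1.
    by rewrite rmorphN mulNr mulrBr mulrA e mul1r opprB.
  exact: HM.
have {ex} [l lP] := choice ex.
have uniq v c : v - iota c * u \in H -> l v = c.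
  move=> Hc; apply/eqP; rewrite -subr_eq0; apply: contraNT nHu => d0.
  have -> : u = iota (l v - c)^-1 * ((v - iota c * u) - (v - iota (l v) * u)).
    have -> : (v - iota c * u) - (v - iota (l v) * u) = iota (l v - c) * u.
      by rewrite rmorphB; ring.
    by rewrite mulrA -rmorphM mulVf // rmorph1 mul1r.
  by apply: HM; exact: HB.
exists l; split=> [a v w|]; apply: uniq; last by rewrite rmorph1 mul1r subrr.
have -> : iota a * v + w - iota (a * l v + l w) * u =
          iota a * (v - iota (l v) * u) + (w - iota (l w) * u).
  by rewrite rmorphD rmorphM; ring.
exact: HD.
Qed.

Variables (x y : series F) (x0 : x 0%N = 0) (y0 : y 0%N = 0).
Local Notation bc := (base_change iota).

Lemma base_changeM f g : bc (f * g) = bc f * bc g.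
Proof.
apply/funext => n; rewrite /base_change !coefM_series rmorph_sum.
by apply: eq_bigr => i _; rewrite rmorphM.
Qed.

Lemma base_change1 : bc 1 = 1.
Proof. by apply/funext => n; rewrite /base_change !coef1_series rmorph_nat. Qed.

Lemma base_changeX f i : bc (f ^+ i) = bc f ^+ i.
Proof.
elim: i => [|i IH]; first by rewrite !expr0 base_change1.
by rewrite !exprS base_changeM IH.
Qed.

(** Applying a linear form coefficientwise maps [L[[x,y]]] to [F[[x,y]]]; the form
    is chosen so as to keep the leading coefficient of a given series. *)
Lemma Gamma_base_change : Gamma (bc x) (bc y) = Gamma x y.
Proof.
have mE i j n : (bc x ^+ i * bc y ^+ j) n = iota ((x ^+ i * y ^+ j) n).
  by rewrite -!base_changeX -base_changeM.
apply/seteqP; split=> k [f [c fc] [fk tf]].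
  have [l [ll l1]] := extension_form fk.
  have l0 : l 0 = 0.
    have := ll 1 0 0; rewrite mulr0 addr0 mul1r => /eqP.
    by rewrite -{1}[l 0]addr0 (inj_eq (addrI _)) eq_sym => /eqP.
  have lD v w : l (v + w) = l v + l w.
    by have := ll 1 v w; rewrite rmorph1 !mul1r.
  have lZ a v : l (iota a * v) = a * l v by have := ll a v 0; rewrite l0 !addr0.
  have lS (I : Type) (r : seq I) (G : I -> L) :
      l (\sum_(i <- r) G i) = \sum_(i <- r) l (G i).
    by elim/big_rec2: _ => // i a b _ <-.
  exists (fun n => l (f n)).
    exists (fun i j => l (c i j)) => n; rewrite fc lS; apply: eq_bigr => i _.
    by rewrite lS; apply: eq_bigr => j _; rewrite mE mulrC lZ mulrC.
  by split; [rewrite l1 oner_neq0|move=> i ik; rewrite tf // l0].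
exists (bc f).
  exists (fun i j => iota (c i j)) => n; rewrite /base_change fc rmorph_sum.
  apply: eq_bigr => i _; rewrite rmorph_sum; apply: eq_bigr => j _.
  by rewrite rmorphM mE.
by split; [rewrite /base_change fmorph_eq0|move=> i ik; rewrite /base_change tf // rmorph0].
Qed.

Lemma base_change_conductor C : (0 < C)%N -> (forall n, (C <= n)%N -> Gamma x y n) ->
  conductor_at (bc x) (bc y) C.
Proof.
move=> C0 GC; have X0 : bc x 0%N = 0 by rewrite /base_change x0 rmorph0.
have Y0 : bc y 0%N = 0 by rewrite /base_change y0 rmorph0.
split=> //.
have GL n : (C <= n)%N -> Delta (branch_ring (bc x) (bc y)) n.
  by move=> /GC; rewrite -Gamma_base_change.
have pos (w : series L) e : w 0%N = 0 -> has_valuation w e -> (0 < e)%N.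
  by move=> w0 [we _]; rewrite lt0n; apply: contraNneq we => ->; rewrite w0.
have [/val_ex[e xe]|/contrapT xe] := pselect (bc x <> 0).
  exact: (conductor_tail X0 Y0 xe (pos _ _ X0 xe) GL).
have [/val_ex[e ye]|/contrapT ye] := pselect (bc y <> 0).
  rewrite branch_swapE in GL *.
  exact: (conductor_tail Y0 X0 ye (pos _ _ Y0 ye) GL).
have [f Rf [fC tf]] := GL C (leqnn C).
have [r [s [_ _ e]]] := branch_max_split X0 Y0 Rf (tf 0%N C0).
by rewrite e xe ye !mul0r addr0 coef0_series eqxx in fC.
Qed.

End LinearForm.

Lemma consecutive_cofinite (G : set nat) b : G 0%N ->
  (forall m n, G m -> G n -> G (m + n)%N) -> G b -> G b.+1 ->
  forall n, (b * b <= n)%N -> G n.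
Proof.
move=> G0 GD Gb Gb1 n bn.
have GM k m : G m -> G (k * m)%N.
  by move=> Gm; elim: k => [|k IH]; [rewrite mul0n|rewrite mulSn; exact: GD].
have [b0|b0] := posnP b.
  by rewrite -[n]muln1; apply: GM; rewrite b0 in Gb1.
have e := divn_eq n b; have r := ltn_pmod n b0.
have k : (b <= n %/ b)%N by rewrite leq_divRL.
have -> : n = ((n %/ b - n %% b) * b + (n %% b) * b.+1)%N.
  by rewrite mulnS addnCA -mulnDl subnK ?(leq_trans (ltnW r)) // addnC.
by apply: GD; exact: GM.
Qed.

(** The numerator and the denominator of [z], written as a fraction over
    [F[[x,y]]], have consecutive valuations. *)
Lemma unibranch_conductor (F : finFieldType) (x y : series F) :
  unibranch_plane x y -> (1 <= delta x y)%N ->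
  exists C, [/\ (1 < C)%N, ~ Gamma x y C.-1 & forall n, (C <= n)%N -> Gamma x y n].
Proof.
move=> [x0 y0 fr] d1.
have G0 : Gamma x y 0%N by exact: Gamma0.
have GD m n : Gamma x y m -> Gamma x y n -> Gamma x y (m + n)%N.
  move=> [f Rf fm] [g Rg gn]; exists (f * g); [exact: branch_mul|exact: valM].
have [a [b [Ra Rb b0 e]]] := fr (zn F 1) 1 (oner_neq0 _).
have [|k bk] := @val_ex _ b; first exact/eqP.
have zk := @val_zn F 1.
have Gk : Gamma x y k by exists b.
have Gk1 : Gamma x y k.+1.
  by exists a => //; have := valM zk bk; rewrite e mulr1.
have GC := consecutive_cofinite G0 GD Gk Gk1.
have [j nGj] : exists j, ~ Gamma x y j.
  apply: contrapT => /forallNP H; move: d1; rewrite /delta /gaps.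
  rewrite (_ : ~` _ = set0) ?fset_set0 ?cardfs0 //.
  by apply/seteqP; split=> // i nGi; apply: nGi; apply: contrapT; apply: H.
pose P n := `[< ~ Gamma x y n >].
have ex : exists n, P n by exists j; apply/asboolP.
have ub n : P n -> (n <= k * k)%N.
  by move=> /asboolP nG; rewrite leqNgt; apply/negP => /ltnW /GC.
have [g /asboolP nGg gmax] := ex_maxnP ex ub.
exists g.+1; split=> //.
  by rewrite ltnS lt0n; apply/eqP => g0; apply: nGg; rewrite g0.
move=> n gn; apply: contrapT => nGn.
by have /gmax : P n by [apply/asboolP]; rewrite leqNgt gn.
Qed.

End Extensions.

(** * Symmetric numerical semigroups *)

Section Semigroup.
Variables (G : set nat) (C : nat).
Hypotheses (G0 : G 0%N) (GD : forall m n, G m -> G n -> G (m + n)%N).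
Hypotheses (C1 : (1 < C)%N) (C_gap : ~ G C.-1) (GC : forall n, (C <= n)%N -> G n).

Local Notation below := (elements_below G).
Local Notation gaps_below := (elements_below (~` G)).

Lemma elements_below_split n : (below n + gaps_below n)%N = n.
Proof.
have fb (H : set nat) : finite_set [set k | H k /\ (k < n)%N].
  by apply: (@finite_bounded _ n) => k [].
rewrite -[RHS](ncard_II n) -ncardU //; last by apply/seteqP; split=> // k [[Gk _] []].
congr (ncard _); apply/seteqP; split=> k /=; first by case=> [[]|[]].
by move=> kn; have [Gk|nGk] := pselect (G k); [left|right].
Qed.

(** Otherwise [C.-1 = s + k + ((C - s).-1 - k)] would be in [G]. *)
Lemma reflection_gap s k : G s -> (s < C)%N -> G k -> (k < C - s)%N ->
  ~ G ((C - s).-1 - k)%N.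
Proof.
move=> Gs sC Gk kn H; apply: C_gap.
have -> : C.-1 = (s + k + ((C - s).-1 - k))%N by lia.
by apply: GD => //; exact: GD.
Qed.

(** The reflection maps the elements below [C - s] injectively to gaps. *)
Lemma below_le_gaps s : G s -> (s < C)%N -> (below (C - s) <= gaps_below (C - s))%N.
Proof.
move=> Gs sC; set n := (C - s)%N.
have fb : finite_set [set k | G k /\ (k < n)%N] by apply: (@finite_bounded _ n) => k [].
have [|||f1 e] := @ncard_bij _ _ _ ((fun k => n.-1 - k)%N @` [set k | G k /\ (k < n)%N])
   (fun k => n.-1 - k)%N fb.
- by move=> k kP; exists k.
- by move=> k j [_ kn] [_ jn]; lia.
- by move=> _ [k kP <-]; exists k.
rewrite /elements_below -e; apply: ncard_sub.
  by apply: (@finite_bounded _ n) => k [].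
move=> _ [k [Gk kn] <-]; split; first exact: reflection_gap.
by rewrite /n in kn *; lia.
Qed.

(** Equality forces the reflection of every gap to be an element. *)
Lemma below_eq_gaps s : G s -> (s < C)%N -> below (C - s) = gaps_below (C - s) ->
  forall h, (h < C - s)%N -> ~ G h -> G ((C - s).-1 - h)%N.
Proof.
move=> Gs sC; set n := (C - s)%N => e h hn nGh.
have fb : finite_set [set k | G k /\ (k < n)%N] by apply: (@finite_bounded _ n) => k [].
have fg : finite_set [set k | (~` G) k /\ (k < n)%N] by apply: (@finite_bounded _ n) => k [].
have [|||f1 e1] := @ncard_bij _ _ _ ((fun k => n.-1 - k)%N @` [set k | G k /\ (k < n)%N])
   (fun k => n.-1 - k)%N fb.
- by move=> k kP; exists k.
- by move=> k j [_ kn] [_ jn]; lia.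
- by move=> _ [k kP <-]; exists k.
have sub : (fun k => n.-1 - k)%N @` [set k | G k /\ (k < n)%N] `<=`
           [set k | (~` G) k /\ (k < n)%N].
  move=> _ [k [Gk kn] <-]; split; first exact: reflection_gap.
  by rewrite /n in kn *; lia.
have E := ncard_sub_eq fg sub; rewrite e1 -/(below n) e in E.
have : [set k | (~` G) k /\ (k < n)%N] h by [].
rewrite -(E (leqnn _)) => -[k [Gk kn] <-].
by rewrite (_ : (_ - (_ - _) = k)%N) //; lia.
Qed.

Lemma not_G1 : ~ G 1%N.
Proof.
move=> G1; apply: C_gap; elim: C.-1 => // k IH.
by rewrite -addn1; exact: GD.
Qed.

Lemma gaps_below_gt0 s : G s -> (s < C)%N -> (0 < gaps_below (C - s))%N.
Proof.
move=> Gs sC; have sC1 : s <> C.-1 by move=> e; apply: C_gap; rewrite -e.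
have fg : finite_set [set k | (~` G) k /\ (k < C - s)%N].
  by apply: (@finite_bounded _ (C - s)) => k [].
apply: (@ncard_gt0 _ _ 1%N fg); split; [exact: not_G1|lia].
Qed.

Hypothesis sym : forall h, (h < C)%N -> G h <-> ~ G (C.-1 - h)%N.

Lemma gaps_below_conductor : gaps_below C = gaps G.
Proof.
rewrite /gaps -[RHS]/(ncard _); congr (ncard _); apply/seteqP; split=> k; first by case.
move=> nGk; split=> //; rewrite ltnNge; apply/negP => /GC; exact: nGk.
Qed.

Lemma below_conductor : below C = gaps_below C.
Proof.
rewrite /elements_below.
have [|||| _ ->//] := @ncard_bij _ _ [set k | (~` G) k /\ (k < C)%N] [set k | G k /\ (k < C)%N]
  (fun k => C.-1 - k)%N.
- by apply: (@finite_bounded _ C) => k [].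
- move=> k [nGk kC]; split; last by lia.
  apply/sym; first by lia.
  by rewrite (_ : (_ - (_ - _) = k)%N) //; lia.
- by move=> k j [_ kn] [_ jn]; lia.
- move=> k [Gk kC]; exists (C.-1 - k)%N; last by lia.
  by split; [exact: (sym kC).1|lia].
Qed.

Lemma conductor_double : C = (gaps G).*2.
Proof.
by rewrite -(elements_below_split C) below_conductor gaps_below_conductor addnn.
Qed.

(** The degrees [j] that carry an extremal term of the specialization. *)
Definition balanced j : Prop :=
  (j.*2 <= C)%N /\ G (C - j.*2)%N /\ below j.*2 = j.

Lemma balanced1 : balanced 1.
Proof.
have C2 : (2 <= C)%N by [].
split=> //; split.
  apply/sym; first by lia.
  by rewrite (_ : (_ - _ = 1)%N); [exact: not_G1|lia].
rewrite /elements_below (_ : [set k | _] = [set 0%N]) ?ncard1 //.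
apply/seteqP; split=> k; last by move=> ->.
move=> [Gk k2]; case: k Gk k2 => [//|[|//]] G1; exfalso; exact: not_G1.
Qed.

Lemma balanced_delta : balanced (gaps G).
Proof.
rewrite /balanced -conductor_double leqnn subnn; split=> //; split=> //.
by rewrite below_conductor gaps_below_conductor.
Qed.

Lemma balanced_G2 j : G 2%N -> (j <= gaps G)%N -> balanced j.
Proof.
move=> G2 jd; have Ge k : G k.*2.
  by elim: k => // k IH; rewrite doubleS -[_.+2]/(2 + _)%N; exact: GD.
have Cd := conductor_double; have jC : (j.*2 <= C)%N by rewrite Cd leq_double.
split=> //; split; first by rewrite Cd -doubleB.
have evenG k : (k < C)%N -> G k <-> ~~ odd k.
  move=> kC; split=> [Gk|ek]; last by rewrite -(even_halfK ek).
  apply/negP => ok; move/(sym kC): Gk; apply.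
  have e : ~~ odd (C.-1 - k) by rewrite Cd; move: kC; rewrite Cd; lia.
  by rewrite -(even_halfK e).
have [|||| _ e] := @ncard_bij _ _ `I_j [set k | G k /\ (k < j.*2)%N] double.
- exact: finite_II.
- by move=> k kj; split=> //; rewrite ltn_double.
- by move=> k l _ _ /double_inj.
- move=> k [Gk kj]; have ek : ~~ odd k by apply/evenG => //; exact: leq_trans kj jC.
  by exists k./2; [rewrite /= -ltn_double even_halfK|rewrite even_halfK].
by rewrite /elements_below e ncard_II.
Qed.

(** Suppose that [1 < j < gaps G], and put [s = C - 2 j]. By [below_eq_gaps] and
    symmetry, [s + h] in [G] implies [h] in [G] for all [h < 2 j]. The least
    positive element [e] of [G] is at least 3, and less than [2 j] as there are
    [j > 1] elements below [2 j]. So [s] is the only element of [G] in the interval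
    from [s] to [s + e - 1]. As the multiples of [e] meet this interval, [e] divides
    [s]. Now let [b] be the least element of [G] not divisible by [e]. If [b <= s], then the numbers [b + k e] also meet the
    interval, and [e] divides [b]. If [s < b < C], then [b - s] is a smaller
    element not divisible by [e]. If [C <= b], then [e] divides the consecutive
    numbers [C - 3] and [C - 2], which are in [G] by symmetry. *)
Lemma balanced_not_G2 j : ~ G 2%N -> (0 < j)%N -> balanced j -> j = 1%N \/ j = gaps G.
Proof.
move=> nG2 j0 [jC [Gs bj]]; apply: contrapT => /not_orP[j1 jd].
have Cd := conductor_double; set s := (C - j.*2)%N in Gs.
have s0 : (0 < s)%N by rewrite /s Cd in jC *; lia.
have sC : (s < C)%N by rewrite /s; lia.
have ns : (C - s = j.*2)%N by rewrite /s; lia.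
have n4 : (4 <= j.*2)%N by lia.
have eqs : below (C - s) = gaps_below (C - s).
  by have := elements_below_split (C - s); rewrite ns bj; lia.
have shift h : (h < j.*2)%N -> G (s + h)%N -> G h.
  move=> hn Gsh; apply: contrapT => nGh.
  have := below_eq_gaps Gs sC eqs; rewrite ns => /(_ h hn nGh) Gr.
  have shC : (s + h < C)%N by lia.
  have := (sym shC).1 Gsh; rewrite (_ : (_ - _ = j.*2.-1 - h)%N) //; lia.
have [e [Ge e0 emin]] : exists e, [/\ G e, (0 < e)%N & forall k, G k -> (0 < k)%N -> (e <= k)%N].
  have ex : exists k, `[< G k /\ (0 < k)%N >].
    by exists C; apply/asboolP; split; [exact: GC|lia].
  have [e /asboolP[Ge e0] emin] := ex_minnP ex.
  by exists e; split=> // k Gk k0; apply: emin; apply/asboolP.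
have e3 : (3 <= e)%N.
  move: e0 Ge; case: (e) => [//|[_ G1|[_ G2|//]]]; [case: (not_G1 G1)|by case: nG2].
have en : (e < j.*2)%N.
  rewrite ltnNge; apply/negP => ne.
  suff : (below j.*2 <= 1)%N by rewrite bj; lia.
  rewrite -(ncard1 0%N); apply: ncard_sub; first exact: finite_set1.
  move=> k [Gk kn] /=; apply/eqP; rewrite -leqn0 leqNgt; apply/negP => /(emin _ Gk).
  by lia.
have GM k : G (k * e)%N.
  by elim: k => [|k IH]; [rewrite mul0n|rewrite mulSn; exact: GD].
have [b [Gb nb bmin]] : exists b, [/\ G b, ~~ (e %| b)%N &
    forall k, G k -> ~~ (e %| k)%N -> (b <= k)%N].
  have ex : exists k, `[< G k /\ ~~ (e %| k)%N >].
    exists (C * e).+1; apply/asboolP; split; first by apply: GC; nia.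
    by rewrite -addn1 dvdn_addr ?dvdn_mull // dvdn1; lia.
  have [b /asboolP[Gb nb] bmin] := ex_minnP ex.
  by exists b; split=> // k Gk nk; apply: bmin; apply/asboolP.
have [sb|bs] := ltnP s b.
  have es : (e %| s)%N by apply: contraTT sb => ns'; rewrite -leqNgt; exact: bmin.
  have [bC|Cb] := ltnP b C.
    have Gbs : G (b - s)%N.
      by apply: shift; [rewrite /s in sb *; lia|rewrite subnKC // ltnW].
    have : (b <= b - s)%N by apply: bmin => //; rewrite dvdn_subl // ltnW.
    by lia.
  have dv k : (k < C)%N -> G k -> (e %| k)%N.
    by move=> kC Gk; apply: contraLR kC => nk; rewrite -leqNgt (leq_trans Cb) // bmin.
  have G2 : G (C - 2)%N.
    apply/sym; first by lia.
    by rewrite (_ : (_ - _ = 1)%N); [exact: not_G1|lia].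
  have G3 : G (C - 3)%N.
    apply/sym; first by lia.
    by rewrite (_ : (_ - _ = 2)%N) //; lia.
  have d2 : (e %| C - 2)%N by apply: dv => //; lia.
  have d3 : (e %| C - 3)%N by apply: dv => //; lia.
  have e21 : (C - 2 - (C - 3) = 1)%N by clear -jC n4; lia.
  have : (e %| 1)%N by rewrite -e21 dvdn_sub.
  by rewrite dvdn1 => /eqP e1; rewrite e1 in e3.
have uniq_window m : (s <= m < s + e)%N -> G m -> m = s.
  move=> /andP[sm me] Gm; have Gms : G (m - s)%N.
    by apply: shift; [lia|rewrite subnKC].
  by have := emin _ Gms; lia.
have es : (e %| s)%N.
  pose m := ((s + e.-1) %/ e * e)%N.
  have <- : m = s by apply: uniq_window; [rewrite /m; have := divn_eq (s + e.-1) e;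
    have := ltn_pmod (s + e.-1) e0; lia|exact: GM].
  exact: dvdn_mull.
case/negP: nb.
pose m := (b + (s - b + e.-1) %/ e * e)%N.
have em : m = s.
  apply: uniq_window; last by apply: GD.
  rewrite /m; have := divn_eq (s - b + e.-1) e; have := ltn_pmod (s - b + e.-1) e0; lia.
by move: es; rewrite -em /m dvdn_addl // dvdn_mull.
Qed.

End Semigroup.

(** * Rational polynomials and divisibility *)

Section RationalPolynomials.
Implicit Types (P Q : {poly rat}) (a b : rat).

Definition dvq (N : nat) a : Prop := a / N%:R \is a Num.int.

Lemma dvq0 N : dvq N 0. Proof. by rewrite /dvq mul0r rpred0. Qed.
Lemma dvqD N a b : dvq N a -> dvq N b -> dvq N (a + b).
Proof. by rewrite /dvq mulrDl; exact: rpredD. Qed.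
Lemma dvqN N a : dvq N a -> dvq N (- a).
Proof. by rewrite /dvq mulNr; exact: rpredNr. Qed.
Lemma dvqB N a b : dvq N a -> dvq N b -> dvq N (a - b).
Proof. by move=> da db; apply: dvqD => //; exact: dvqN. Qed.
Lemma dvq_sum N (I : Type) (r : seq I) (p : pred I) (G : I -> rat) :
  (forall i, p i -> dvq N (G i)) -> dvq N (\sum_(i <- r | p i) G i).
Proof. by move=> H; apply: (big_ind (dvq N)) => //; [exact: dvq0|exact: dvqD]. Qed.
Lemma dvqM M N a b : dvq M a -> dvq N b -> dvq (M * N) (a * b).
Proof. by rewrite /dvq natrM invfM mulrACA; exact: rpredM. Qed.
Lemma dvq1 a : a \is a Num.int -> dvq 1 a.
Proof. by rewrite /dvq divr1. Qed.
Lemma dvq_nat N n : (0 < N)%N -> (N %| n)%N -> dvq N n%:R.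
Proof.
move=> N0 /dvdnP[k ->]; rewrite /dvq natrM mulfK ?rpred_nat //.
by rewrite pnatr_eq0 -lt0n.
Qed.
Lemma dvq_int q k : (0 < q)%N -> dvq (q ^ k) (q%:R ^+ k).
Proof. by move=> q0; rewrite -natrX; apply: dvq_nat; rewrite ?expn_gt0 ?q0. Qed.
Lemma dvqW q m n a : (0 < q)%N -> (m <= n)%N -> dvq (q ^ n) a -> dvq (q ^ m) a.
Proof.
move=> q0 mn; rewrite -(subnK mn) expnD /dvq => d.
have q0' : (q ^ (n - m))%:R != 0 :> rat by rewrite pnatr_eq0 -lt0n expn_gt0 q0.
have -> : a / (q ^ m)%:R = a / (q ^ (n - m) * q ^ m)%:R * (q ^ (n - m))%:R.
  by rewrite natrM invfM mulrA [RHS]mulrAC divfK.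
by rewrite rpredM // rpred_nat.
Qed.

Lemma dvq_mulXn q k m a : (0 < q)%N -> dvq (q ^ k) a -> dvq (q ^ (m + k)) (q%:R ^+ m * a).
Proof. by move=> q0 da; rewrite expnD; apply: dvqM => //; exact: dvq_int. Qed.

Lemma dvq_cancel q k a : (0 < q)%N -> dvq (q ^ k.+1) (q%:R * a) -> dvq (q ^ k) a.
Proof.
move=> q0; rewrite /dvq expnS natrM invfM mulrA [q%:R * a]mulrC mulfK //.
by rewrite pnatr_eq0 -lt0n.
Qed.

(** The constant term is divisible by arbitrarily large [q], hence zero; then [Q]
    is divided by ['X]. *)
Lemma poly_low_coef Q m :
  (forall N : nat, exists q : nat, (N < q)%N /\ dvq (q ^ m) Q.[q%:R]) ->
  forall i, (i < m)%N -> Q`_i = 0.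
Proof.
elim: m Q => // m IH Q H.
(* After clearing denominators, infinitely many [q] divide the integer [p`_0]. *)
have [p [d d0 eQ]] := rat_poly_scale Q.
have Q0 : Q`_0 = 0.
  have [q [qN dq]] := H (absz p`_0).
  have q0 : (0 < q)%N by exact: leq_ltn_trans qN.
  have dpq : (q%:Z %| p.[q%:Z])%Z.
    have dQ : d%:~R * Q.[q%:R] = (p.[q%:Z])%:~R :> rat.
      rewrite eQ hornerZ mulrA mulfV ?intr_eq0 // mul1r.
      by rewrite -(rmorph_nat (intr : {rmorphism int -> rat})) horner_map natz.
    have /intrP[k kE] : dvq (q ^ 1) (p.[q%:Z])%:~R.
      have : dvq (1 * q ^ 1) (d%:~R * Q.[q%:R]).
        apply: dvqM; first by apply: dvq1; exact: intr_int.
        exact: dvqW dq.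
      by rewrite dQ mul1n.
    apply/dvdzP; exists k; apply: (@intr_inj rat); rewrite rmorphM /= -kE expn1.
    by rewrite -pmulrn divfK // pnatr_eq0 -lt0n.
  have dp0 : (q%:Z %| p`_0)%Z.
    have e : p.[q%:Z] = p`_0 + (\sum_(i < (size p).-1) p`_i.+1 * q%:Z ^+ i) * q%:Z.
      have [->|pn0] := eqVneq p 0.
        by rewrite horner0 coef0 size_poly0 big_ord0 mul0r addr0.
      rewrite horner_coef -(prednK (_ : 0 < size p)%N) ?size_poly_gt0 //.
      rewrite big_ord_recl expr0 mulr1 mulr_suml; congr (_ + _).
      by apply: eq_bigr => i _; rewrite /= exprSr mulrA.
    by move: dpq; rewrite e rpredDr // dvdz_mull.
  have p0 : p`_0 = 0.
    apply/eqP; rewrite -absz_eq0; apply: contraTT dp0 => n0.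
    by rewrite dvdzE /= gtnNdvd // lt0n.
  by rewrite eQ coefZ coef_map p0 mulr0.
pose Q' := \poly_(i < (size Q).-1) Q`_i.+1.
have eQ' : Q = Q' * 'X.
  apply/polyP => -[|i]; rewrite coefMX //= coef_poly; case: ltnP => // si.
  by rewrite nth_default //; move: si; case: (size Q).
case=> [//|i] im; rewrite eQ' coefMX /=; apply: IH => // N.
have [q [qN dq]] := H N; exists q; split=> //.
apply: dvq_cancel; first exact: leq_ltn_trans qN.
by move: dq; rewrite {1}eQ' hornerM hornerX mulrC.
Qed.

Lemma coef_factor c P k :
  ((1 - c%:P * 'X) * P)`_k = P`_k - c * (if k is k'.+1 then P`_k' else 0).
Proof.
rewrite mulrBl mul1r coefB -mulrA coefCM coefXM.
by case: k.
Qed.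

Definition rank_poly (q m : nat) : {poly rat} :=
  \prod_(i < m) (1 - (q%:R ^+ i)%:P * 'X).

Lemma rank_polyS q m k : (rank_poly q m.+1)`_k =
  (rank_poly q m)`_k - q%:R ^+ m * (if k is k'.+1 then (rank_poly q m)`_k' else 0).
Proof. by rewrite /rank_poly big_ord_recr /= mulrC coef_factor. Qed.

(** The monomials of the coefficient are products of [k] distinct powers of [q]. *)
Lemma rank_poly_dvq q m k : (0 < q)%N -> dvq (q ^ k.-1) (rank_poly q m)`_k.
Proof.
move=> q0; elim: m k => [|m IH] k.
  rewrite /rank_poly big_ord0 coef1; case: k => [|k] /=; last exact: dvq0.
  by rewrite expn0; apply: dvq1; rewrite rpred1.
rewrite rank_polyS; apply: dvqB => //; case: k => [|k]; first by rewrite mulr0; exact: dvq0.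
case: m IH => [|m] IH.
  rewrite /rank_poly big_ord0 coef1 expr0 mul1r; case: k => [|k] /=; last exact: dvq0.
  by rewrite expn0; apply: dvq1; rewrite rpred1.
have le : (k <= m.+1 + k.-1)%N by lia.
by apply: (dvqW q0 le); exact: dvq_mulXn.
Qed.

(** Modulo [q ^ k] only the first two factors contribute to the coefficient of
    degree [k]. *)
Lemma rank_poly_mod q m k : (0 < q)%N -> dvq (q ^ k) ((rank_poly q m)`_k
  + ((0 < m) && (k == 1))%N%:R - q%:R * ((1 < m) && (k == 2))%N%:R).
Proof.
move=> q0; have E0 j : (rank_poly q 0)`_j = (j == 0%N)%:R.
  by rewrite /rank_poly big_ord0 coef1.
have E1 j : (rank_poly q 1)`_j = (j == 0%N)%:R - (j == 1%N)%:R.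
  by rewrite rank_polyS E0 expr0 mul1r; case: j => [|j]; rewrite ?E0.
have dq : dvq (q ^ 1) (- q%:R) by apply: dvqN; rewrite -[q%:R]expr1; exact: dvq_int.
case: m => [|[|m]].
- rewrite E0 /= addr0 mulr0 subr0; case: k => [|k]; last exact: dvq0.
  by apply: dvq1; rewrite rpred1.
- rewrite E1 /= mulr0 subr0 subrK; case: k => [|k]; last exact: dvq0.
  by apply: dvq1; rewrite rpred1.
elim: m => [|m IH].
  rewrite rank_polyS expr1 /=; case: k => [|[|[|k]]]; rewrite !E1 /=.
  - by rewrite [X in dvq _ X](_ : _ = 1); [apply: dvq1; rewrite rpred1|rewrite /=; ring].
  - by rewrite [X in dvq _ X](_ : _ = - q%:R) //=; ring.
  - by rewrite [X in dvq _ X](_ : _ = 0); [exact: dvq0|rewrite /=; ring].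
  - by rewrite [X in dvq _ X](_ : _ = 0); [exact: dvq0|rewrite /=; ring].
rewrite rank_polyS; set w := q%:R ^+ _ * _.
rewrite [X in dvq _ X](_ : _ = (rank_poly q m.+2)`_k + (k == 1%N)%:R -
  q%:R * (k == 2)%N%:R - w); last by rewrite /=; ring.
apply: dvqB; first exact: IH.
rewrite /w; case: k {w IH} => [|k]; first by rewrite mulr0; exact: dvq0.
have le : (k.+1 <= m.+2 + k.-1)%N by lia.
apply: (dvqW q0 le).
by apply: dvq_mulXn => //; exact: rank_poly_dvq.
Qed.

Lemma rank_polyE q m : (0 < q)%N ->
  \prod_(i < m) (1 + q%:R ^+ i.+1 * - ((q%:R : rat)^-1 *: 'X)) = rank_poly q m.
Proof.
move=> q0; apply: eq_bigr => i _; congr (1 + _).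
have -> : (q%:R : {poly rat}) = (q%:R : rat)%:P by rewrite polyC_natr.
rewrite mulrN -mul_polyC mulrA -rmorphXn -rmorphM /= exprSr mulfK //.
by rewrite pnatr_eq0 -lt0n.
Qed.

End RationalPolynomials.

Section TwoVariables.
Implicit Types H : {poly {poly rat}}.

Lemma coef_mono i j k l : (mono i j)`_l`_k = ((k == i) && (l == j))%:R.
Proof.
rewrite /mono coefCM coefXn; case: (l == j); last by rewrite mulr0 coef0 andbF.
by rewrite mulr1 coefXn andbT.
Qed.

Lemma coef_scaled_mono (c : rat) i j k l :
  (c%:P%:P * mono i j)`_l`_k = c * ((k == i) && (l == j))%:R.
Proof. by rewrite coefCM coefCM coef_mono. Qed.

Lemma monoM i j k l : mono i j * mono k l = mono (i + k) (j + l).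
Proof. by rewrite /mono mulrACA -rmorphM -!exprD. Qed.

Lemma coef_diagonal k H i j :
  (diagonal_part k H)`_j`_i = if (i + k == j)%N then H`_j`_i else 0.
Proof.
rewrite /diagonal_part coef_sum coef_sum.
transitivity (\sum_(l < size H) \sum_(m < size H`_l | (m + k == l)%N)
     H`_l`_m * ((i == m) && (j == l :> nat))%:R).
  apply: eq_bigr => l _; rewrite coef_sum coef_sum; apply: eq_bigr => m _.
  by rewrite coef_scaled_mono.
have zero (l : nat) : l != j -> \sum_(m < size H`_l | (m + k == l)%N)
     H`_l`_m * ((i == m) && (j == l))%:R = 0.
  by move=> lj; rewrite big1 // => m _; rewrite [j == l]eq_sym (negPf lj) andbF mulr0.
have [jH|Hj] := ltnP j (size H); last first.
  rewrite [H`_j]nth_default // coef0 if_same big1 // => l _; apply: zero.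
  by rewrite neq_ltn (leq_trans (ltn_ord l)).
rewrite (bigD1 (Ordinal jH)) //= [X in _ + X]big1 ?addr0; last first.
  by move=> l lj; apply: zero; apply: contraNneq lj => e; apply/eqP/val_inj.
have [iH|Hi] := ltnP i (size H`_j); last first.
  rewrite [H`_j`_i]nth_default // if_same big1 // => m _.
  by rewrite (_ : (i == m) = false) ?mulr0 // gtn_eqF // (leq_trans (ltn_ord m)).
rewrite big_mkcond (bigD1 (Ordinal iH)) //= !eqxx mulr1 [X in _ + X]big1 ?addr0 // => m mi.
case: ifP => // _; rewrite (_ : (i == m) = false) ?mulr0 //.
by apply: contraNF mi => /eqP e; apply/eqP/val_inj.
Qed.

Lemma at_qD q H H' : at_q q (H + H') = at_q q H + at_q q H'.
Proof. by rewrite /at_q rmorphD. Qed.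
Lemma at_q_sum q (I : Type) (r : seq I) (p : pred I) (G : I -> {poly {poly rat}}) :
  at_q q (\sum_(i <- r | p i) G i) = \sum_(i <- r | p i) at_q q (G i).
Proof. by rewrite /at_q rmorph_sum. Qed.
Lemma at_qCX q (p : {poly rat}) d : at_q q (p%:P * 'X^d) = p.[q] *: 'X^d.
Proof.
by rewrite /at_q rmorphM /= map_polyC map_polyXn /= mul_polyC.
Qed.
Lemma at_q1 q : at_q q 1 = 1. Proof. by rewrite /at_q rmorph1. Qed.

Lemma coef_at_q q H j : (at_q q H)`_j = (H`_j).[q].
Proof. by rewrite /at_q coef_map. Qed.

Lemma coef_at_q_diagonal (q : rat) n i :
  (at_q q (\sum_(k < n) mono k k))`_i = (i < n)%N%:R * q ^+ i.
Proof.
rewrite at_q_sum coef_sum.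
rewrite (eq_bigr (fun k : 'I_n => (i == k)%:R * q ^+ i)) => [|k _]; last first.
  by rewrite /mono at_qCX hornerXn coefZ coefXn mulrC; case: eqP => [->|]; rewrite ?mul0r.
rewrite -mulr_suml; congr (_ * _); have [ni|nin] := ltnP i n.
  rewrite (bigD1 (Ordinal ni)) //= eqxx big1 ?addr0 // => k ki.
  by rewrite (_ : (i == k) = false) //; apply: contraNF ki => /eqP e; apply/eqP/val_inj.
by rewrite big1 // => k _; rewrite gtn_eqF // (leq_trans (ltn_ord k)).
Qed.

Lemma coef_shifted_diagonal a n i j :
  (\sum_(k < n) mono a a.+1 * mono k k)`_j`_i = ((j == i.+1) && (a <= i < n + a)%N)%:R.
Proof.
rewrite !coef_sum; transitivity (\sum_(k < n) ((i == a + k) && (j == a.+1 + k))%N%:R : rat).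
  by apply: eq_bigr => k _; rewrite monoM coef_mono.
have [/andP[/eqP -> /andP[ai ian]]|ne] := boolP ((j == i.+1) && _).
  have lt : (i - a < n)%N by lia.
  rewrite (bigD1 (Ordinal lt)) //= subnKC // eqxx addSn subnKC // eqxx big1 ?addr0 // => k ki.
  rewrite (_ : (i == _) = false) //; apply: contraNF ki => /eqP e.
  by apply/eqP/val_inj; rewrite /= e addKn.
rewrite big1 // => k _; case: eqP => //= ei; case: eqP => // ej; exfalso.
by move/negP: ne; apply; rewrite ei ej addSn eqxx leq_addr addnC ltn_add2r ltn_ord.
Qed.

End TwoVariables.

(** * Extremal terms of the cells *)

Section CellTerms.
Variables (F : finFieldType) (x y : series F) (C : nat).
Hypotheses (x0 : x 0%N = 0) (y0 : y 0%N = 0) (C1 : (1 < C)%N).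
Local Notation G := (Gamma x y).
Hypotheses (C_gap : ~ G C.-1) (GC : forall n, (C <= n)%N -> G n).
Local Notation delta := (delta x y).

Section OneExtension.
Variables (L : finFieldType) (iota : {rmorphism F -> L}).
Local Notation xL := (base_change iota x).
Local Notation yL := (base_change iota y).

Lemma extension_conductor : conductor_at xL yL C.
Proof. by apply: base_change_conductor => //; exact: ltnW. Qed.

Lemma extension_Gamma : Gamma xL yL = G.
Proof. exact: Gamma_base_change. Qed.

Lemma extension_gap : ~ Gamma xL yL C.-1.
Proof. by rewrite extension_Gamma. Qed.

End OneExtension.

Lemma Gamma_unit : G 0%N. Proof. exact: Gamma0. Qed.

Lemma Gamma_add m n : G m -> G n -> G (m + n)%N.
Proof.
move=> [f Rf fm] [g Rg gn]; exists (f * g); [exact: branch_mul|exact: valM].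
Qed.

Lemma Gamma_sym h : (h < C)%N -> G h <-> ~ G (C.-1 - h)%N.
Proof.
have HC := extension_conductor (idfun : {rmorphism F -> F}).
have gap := @extension_gap F (idfun : {rmorphism F -> F}).
have [rho [rP rR]] := residue_branch HC gap.
have := Gamma_symmetric HC gap rP rR (h := h).
by rewrite !(extension_Gamma (idfun : {rmorphism F -> F})).
Qed.

Definition special (D : set nat) : bool :=
  `[< exists n, D = truncated_semigroup G n >].

(** The cell is [q ^ gaps D] times the unital cell, which is a point for the
    truncated semigroups and has a multiple of [q] points otherwise. *)
Lemma J0_mod (L : finFieldType) (iota : {rmorphism F -> L}) D : standard_gamma G D ->
  dvq (#|L| ^ (gaps D).+1)
    ((ncard (J0 (base_change iota x) (base_change iota y) D))%:R
     - (special D)%:R * #|L|%:R ^+ gaps D).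
Proof.
move=> SD; have [D0 _] := SD; have HC := extension_conductor iota.
have q0 : (0 < #|L|)%N by apply/card_gt0P; exists 0.
rewrite (J0_ncard HC D0) natrM natrX [X in _ - X]mulrC -mulrBr.
rewrite -addn1; apply: dvq_mulXn => //; rewrite /special expn1.
case: asboolP => [[n eD]|nD].
  have -> : D = truncated_semigroup (Gamma (base_change iota x) (base_change iota y)) n.
    by rewrite extension_Gamma.
  rewrite (unital_cell_truncated HC) ncard1 subrr; exact: dvq0.
rewrite subr0; apply: dvq_nat => //; apply: (dvdn_unital_cell HC).
  by rewrite extension_Gamma.
by move=> n eD; apply: nD; exists n; rewrite eD extension_Gamma.
Qed.

Lemma standard_gamma_sub D : standard_gamma G D -> G `<=` D.
Proof. by move=> [D0 DG] k Gk; rewrite -[k]addn0; exact: DG. Qed.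

Lemma finite_standard_gamma : finite_set (standard_gamma G).
Proof.
pose dec (S : {set 'I_C}) : set nat :=
  [set k | forall kC : (k < C)%N, Ordinal kC \in S].
apply: (@finset_fintype _ _ dec) => D SD.
exists (finset (fun i : 'I_C => `[< D i >])); apply/seteqP; split=> k /=.
  move=> H; have [kC|/GC] := ltnP k C; last exact: standard_gamma_sub.
  by have := H kC; rewrite inE => /asboolP.
by move=> Dk kC; rewrite inE; apply/asboolP.
Qed.

Lemma gaps_finite D : standard_gamma G D -> finite_set (~` D).
Proof.
move=> SD; apply: (@finite_bounded _ C) => k nDk; rewrite ltnNge; apply/negP => /GC Gk.
by apply: nDk; exact: standard_gamma_sub Gk.
Qed.

Lemma gaps_truncated n : gaps (truncated_semigroup G n) = elements_below (~` G) n.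
Proof.
rewrite /gaps -[LHS]/(ncard _); congr (ncard _); apply/seteqP; split=> k /=.
  by move=> /not_orP[nG /= nk]; split=> //; rewrite ltnNge; apply/negP.
by move=> [nG kn] [//|/=]; rewrite leqNgt kn.
Qed.

Lemma truncated_standard n : standard_gamma G (truncated_semigroup G n).
Proof.
split; first by left; exact: Gamma_unit.
move=> m k Gm [Gk|/= nk]; first by left; exact: Gamma_add.
by right; rewrite /= (leq_trans nk) // leq_addl.
Qed.

Lemma truncated_inj n m : gaps (truncated_semigroup G n) = gaps (truncated_semigroup G m) ->
  truncated_semigroup G n = truncated_semigroup G m.
Proof.
wlog nm : n m / (n <= m)%N.
  by move=> H; have [/H//|/ltnW /H E /esym /E] := leqP n m.
move=> e; apply: setC_inj; apply: ncard_sub_eq; last by rewrite -![ncard _]/(gaps _) e.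
  exact/gaps_finite/truncated_standard.
apply: subsetC => k [Gk|/= mk]; [by left|by right; exact: leq_trans mk].
Qed.

Lemma truncated_le n : (gaps (truncated_semigroup G n) <= delta)%N.
Proof.
rewrite gaps_truncated /Defs.delta /gaps; apply: ncard_sub; last by move=> k [].
by apply: (@finite_bounded _ C) => k nG; rewrite ltnNge; apply/negP => /GC.
Qed.

Lemma truncated_ex i : (i <= delta)%N -> exists n, gaps (truncated_semigroup G n) = i.
Proof.
move=> id; have gS n : (elements_below (~` G) n.+1 <= (elements_below (~` G) n).+1)%N.
  have fn : finite_set [set k | (~` G) k /\ (k < n)%N] by apply: (@finite_bounded _ n) => k [].
  apply: (@leq_trans (ncard ([set k | (~` G) k /\ (k < n)%N] `|` [set n]))).
    apply: ncard_sub; first by rewrite finite_setU; split=> //; exact: finite_set1.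
    move=> k [nG]; rewrite ltnS leq_eqVlt => /orP[/eqP->|kn]; [by right|by left].
  rewrite (ncardU fn (finite_set1 n)) ?ncard1 ?addn1 //.
  by apply/seteqP; split=> // k [[_ kn] /= e]; rewrite e ltnn in kn.
have ex : exists n, (i <= elements_below (~` G) n)%N.
  exists C; rewrite gaps_below_conductor //.
have [n ni nmin] := ex_minnP ex; exists n; rewrite gaps_truncated.
apply/eqP; rewrite eqn_leq ni andbT; case: n ni nmin => [|n] ni nmin.
  by rewrite /elements_below (_ : [set k | _] = set0) ?ncard0 //; apply/seteqP; split=> k [].
apply: (leq_trans (gS n)); rewrite ltnNge; apply/negP => /nmin.
by rewrite ltnn.
Qed.

(** The number of gaps of [truncated_semigroup G n] grows with [n] by steps of at
    most one, and it determines the set. *)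
Lemma special_sum i :
  \sum_(D \in standard_gamma G) (((gaps D == i) && special D)%:R : rat) =
  (i <= delta)%N%:R.
Proof.
have [id|di] := leqP i delta; last first.
  rewrite fsbig1 // => D _; case: eqP => // e; rewrite /special.
  by case: asboolP => //= -[n eD]; have := truncated_le n; rewrite -eD e leqNgt di.
have [n en] := truncated_ex id.
rewrite (fsbigD1 (truncated_semigroup G n)); [|exact: finite_standard_gamma|exact: truncated_standard].
rewrite en eqxx /special asboolT /=; last by exists n.
rewrite fsbig1 ?addr0 // => D [_ /= nD]; case: eqP => // e.
case: asboolP => //= -[m eD]; case: nD; rewrite eD; apply: truncated_inj.
by rewrite -eD e en.
Qed.

(** ** The part at a = 0 *)

Variable P : set nat -> {poly rat}.
Hypothesis hP : forall D, standard_gamma G D ->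
  forall (L : finFieldType) (iota : {rmorphism F -> L}),
    (P D).[#|L|%:R] = (ncard (J0 (base_change iota x) (base_change iota y) D))%:R.

(** The congruence [J0_mod] holds for unboundedly many [q]. *)
Lemma cell_low_coef D i : standard_gamma G D -> (i <= gaps D)%N ->
  (P D)`_i = ((i == gaps D) && special D)%:R.
Proof.
move=> SD ig; pose Q := P D - (special D)%:R%:P * 'X^(gaps D).
have := @poly_low_coef Q (gaps D).+1 _ i; rewrite ltnS => /(_ _ ig) H.
have : Q`_i = 0.
  apply: H => N; have [L [iota NL]] := unbounded_extensions F N.
  exists #|L|; split=> //; rewrite /Q hornerD hornerN hornerM hornerC hornerXn.
  by rewrite (hP SD iota); exact: J0_mod.
rewrite /Q coefB coefCM coefXn => /eqP; rewrite subr_eq0 => /eqP ->.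
by case: (special D); case: (i == _); rewrite /= ?mulr1 ?mul1r ?mulr0 ?mul0r.
Qed.

Definition H_zero : {poly {poly rat}} :=
  \sum_(D \in standard_gamma G) (P D)%:P * 'X^(gaps D).

Lemma H_zero_is_Hmot : is_Hmot x y (fun=> 0) H_zero.
Proof.
move=> L iota; have HC := extension_conductor iota.
have fG := finite_standard_gamma; have fS := finite_standard HC.
rewrite (Hmot_top HC) /H_zero fsbig_finite // at_q_sum -fsbig_finite //.
rewrite (fsum_fib _ fS fG (p := fun M => Delta M)); last first.
  by move=> M stM; have := standard_Delta stM; rewrite extension_Gamma.
apply: eq_fsum => D SD; rewrite at_qCX (hP SD iota).
rewrite (fsum_cst (c := 'X^(gaps D))) ?scaler_nat //.
- exact: finite_setIl.
- move=> M [stM dM]; rewrite big1 ?mulr1; last by move=> i _; rewrite mulr0 addr0.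
  by rewrite (deg_gaps HC stM) dM.
Qed.

Lemma coef_H_zero i j : H_zero`_j`_i =
  \sum_(D \in standard_gamma G) (if gaps D == j then (P D)`_i else 0).
Proof.
have fG := finite_standard_gamma.
rewrite /H_zero fsbig_finite // [RHS]fsbig_finite // !coef_sum; apply: eq_bigr => D _.
rewrite coefCM coefXn eq_sym; case: eqP => _; by rewrite ?mulr1 ?mulr0 ?coef0.
Qed.

Lemma H_zero_low i j : H_zero`_j`_i != 0 -> (j <= i)%N.
Proof.
rewrite coef_H_zero => nz; rewrite leqNgt; apply/negP => ij; move/eqP: nz; apply.
apply: fsbig1 => D SD; case: eqP => [e|_]; last exact: erefl.
have ig : (i <= gaps D)%N by rewrite e ltnW.
by rewrite (cell_low_coef SD ig) e (ltn_eqF ij).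
Qed.

Lemma H_zero_diagonal : diagonal_part 0 H_zero = \sum_(i < delta.+1) mono i i.
Proof.
apply/polyP => j; apply/polyP => i; rewrite coef_diagonal addn0.
have -> : (\sum_(k < delta.+1) mono k k)`_j`_i =
    ((i == j) && (j <= delta)%N)%:R.
  rewrite !coef_sum (eq_bigr (fun k : 'I_delta.+1 => ((i == j) && (j == k))%:R)).
    have [jd|dj] := leqP j delta; last first.
      rewrite andbF big1 // => k _; rewrite (_ : (j == k) = false) ?andbF //.
      by rewrite gtn_eqF // (leq_trans (ltn_ord k)).
    rewrite (bigD1 (inord j)) //= inordK ?eqxx ?andbT ?ltnS // big1 ?addr0 // => k kj.
    rewrite (_ : (j == k) = false) ?andbF //; apply: contraNF kj => /eqP ->.
    by rewrite inord_val.
  move=> k _; rewrite coef_mono; congr ((_ : bool)%:R).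
  by case: (j =P k :> nat) => [->|_]; rewrite ?andbF.
case: eqP => [->|//]; rewrite coef_H_zero -special_sum; apply: eq_fsum => D SD.
by case: eqP => //= e; rewrite cell_low_coef ?e // eqxx.
Qed.

End CellTerms.

(** * The specialization a = -t/q *)

Section DaggerTerms.
Variables (F : finFieldType) (x y : series F) (C : nat).
Hypotheses (x0 : x 0%N = 0) (y0 : y 0%N = 0) (C1 : (1 < C)%N).
Local Notation G := (Gamma x y).
Hypotheses (C_gap : ~ G C.-1) (GC : forall n, (C <= n)%N -> G n).
Local Notation delta := (delta x y).

Let G0 : G 0%N. Proof. exact: Gamma_unit. Qed.
Let GD m n : G m -> G n -> G (m + n)%N. Proof. exact: Gamma_add. Qed.
Let sym h : (h < C)%N -> G h <-> ~ G (C.-1 - h)%N.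
Proof. exact: (Gamma_sym x0 y0 C1 C_gap GC). Qed.

Local Notation below s := (elements_below G (C - s)).
Local Notation gaps_below s := (elements_below (~` G) (C - s)).

(** The summand [1] comes from [F[[z]]], and the summand of [s] from the modules
    [perp rho (cyc b)] with [b] of valuation [s]; see [tau1_sum]. *)
Definition H_dagger : {poly {poly rat}} :=
  1 + \sum_(s < C | `[< G s >])
        ('X^(gaps_below s) - 'X^((gaps_below s).-1))%R%:P * 'X^(below s).

Lemma tau_prod q t : (0 < q)%N ->
  \prod_(i < t) (1 + q%:R ^+ i * (- (q%:R : rat)^-1)%:P) =
  (t == 0%N)%:R + (t == 1%N)%:R * (1 - (q%:R : rat)^-1)%:P :> {poly rat}.
Proof.
move=> q0; have q1 : (q%:R : rat) != 0 by rewrite pnatr_eq0 -lt0n.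
case: t => [|[|t]].
- by rewrite big_ord0 mul0r addr0.
- by rewrite big_ord1 expr0 mul1r add0r mul1r polyCB polyCN.
- rewrite big_ord_recl big_ord_recl expr1 mul0r addr0.
  suff -> : 1 + q%:R * (- (q%:R : rat)^-1)%:P = 0 :> {poly rat} by rewrite mul0r mulr0.
  rewrite (_ : q%:R = (q%:R : rat)%:P); last by rewrite polyC_natr.
  by rewrite -polyCM mulrN mulfV // polyCN subrr.
Qed.

(** At [a = -t/q] the product over [i < tau N] in [Hmot_bottom] has the factor
    [1 - q ^ (i - 1)], which vanishes for [i = 1]. *)
Lemma H_dagger_is_Hmot : is_Hmot x y (fun q => - (q^-1 *: 'X)) H_dagger.
Proof.
move=> L iota; have HC := extension_conductor x0 y0 C1 GC iota.
have gap : ~ Gamma (base_change iota x) (base_change iota y) C.-1.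
  by rewrite extension_Gamma.
have q0 : (0 < #|L|)%N by apply/card_gt0P; exists 0.
have fS := finite_standard HC.
have [rho [rP rR]] := residue_branch HC gap.
have [t0 stT] := tau_setT (base_change iota x) (base_change iota y).
have -> : - ((#|L|%:R : rat)^-1 *: 'X) = 'X * (- (#|L|%:R : rat)^-1)%:P.
  by rewrite mulrC mul_polyC scaleNr.
rewrite (Hmot_bottom HC) (fsbigID [set N | tau (base_change iota x) (base_change iota y) N = 1%N]) //=.
rewrite addrC (fsbigD1 setT) /=; first last.
- by split=> //=; rewrite t0.
- exact: finite_setIl.
rewrite tau_prod // t0 eqxx /= mul0r addr0 mulr1 (deg_gaps HC stT).
have -> : gaps (Delta (setT : set (series L))) = 0%N.
  rewrite /gaps (_ : ~` _ = set0) ?fset_set0 ?cardfs0 //.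
  apply/seteqP; split=> // k; apply; exists (zn L k) => //.
  exact: val_zn.
rewrite expr0 fsbig1 ?addr0; last first.
  move=> N [[stN /= t1] nT]; rewrite tau_prod //.
  have -> : (tau (base_change iota x) (base_change iota y) N == 0%N) = false.
    by apply/eqP => t00; apply: nT; exact: (tau0 HC stN t00).
  by move/eqP/negbTE: t1 => ->; rewrite mul0r addr0 mulr0.
rewrite /H_dagger at_qD at_q1 at_q_sum; congr (1 + _).
transitivity ((\sum_(N \in [set N | standard (base_change iota x) (base_change iota y) N /\
     tau (base_change iota x) (base_change iota y) N = 1%N]) ('X^(deg N) : {poly rat}))
   * (1 - (#|L|%:R : rat)^-1)%:P); last first.
  rewrite mulrC fsum_mull; last by apply: sub_finite_set fS => N [].
  apply: eq_fsum => N [_ t1]; rewrite tau_prod // t1 eqxx add0r mul1r.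
  by rewrite mulrC.
rewrite (tau1_sum HC gap rP rR (fun n => ('X^n : {poly rat}))) extension_Gamma.
have -> : [set s | G s /\ (s < C)%N] = `I_C `&` G by apply/seteqP; split=> s [].
rewrite fsbig_mkcondr -fsbig_ord mulr_suml big_mkcond; apply: eq_bigr => s _ /=.
case: asboolP => Gs; last by rewrite memNset // mul0r.
rewrite mem_set // at_qCX hornerD hornerN !hornerXn.
have g0 : (0 < gaps_below s)%N by exact: (gaps_below_gt0 G0 GD C1 C_gap).
rewrite mulrnAl mulrC mul_polyC -scaler_nat scalerA natrX mulrBr mulr1; congr (_ *: _).
congr (_ - _); case: (elements_below _ _) g0 => // g _.
by rewrite exprSr mulfK // pnatr_eq0 -lt0n.
Qed.

Lemma coef_H_dagger i j : H_dagger`_j`_i = ((i == 0%N) && (j == 0%N))%:R +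
  \sum_(s < C | `[< G s >])
     ((i == gaps_below s)%:R - (i == (gaps_below s).-1)%:R) * (j == below s)%:R.
Proof.
rewrite /H_dagger coefD coefD coef1 coef_sum coef_sum; congr (_ + _).
  by case: (j == 0%N); rewrite ?coef1 ?coef0 ?andbT ?andbF.
apply: eq_bigr => s _; rewrite coefCM coefXn; case: (j == _).
  by rewrite !mulr1 coefB !coefXn.
by rewrite !mulr0 coef0.
Qed.

Lemma H_dagger_int i j : H_dagger`_j`_i \is a Num.int.
Proof.
rewrite coef_H_dagger rpredD ?rpred_nat // rpred_sum // => s _.
by rewrite rpredM ?rpredB ?rpred_nat.
Qed.

Lemma H_dagger_low i j : H_dagger`_j`_i != 0 -> (j <= i.+1)%N.
Proof.
move=> nz; rewrite leqNgt; apply/negP => ij; move/eqP: nz; apply.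
rewrite coef_H_dagger [j == 0%N]gtn_eqF ?(leq_ltn_trans _ ij) // andbF add0r.
apply: big1 => s /asboolP Gs; case: (j =P below s) => [e|_]; last by rewrite mulr0.
have le := below_le_gaps GD C1 C_gap Gs (ltn_ord s); rewrite -e in le.
have lt := leq_trans ij le.
rewrite (ltn_eqF (ltnW lt)) (_ : (i == _) = false) ?subrr ?mul0r //.
by rewrite ltn_eqF // -ltnS prednK // (leq_ltn_trans _ lt).
Qed.

Definition bal (j : nat) : bool := `[< balanced G C j >].

Lemma H_dagger_extremal i : H_dagger`_(i.+1)`_i = - (bal i.+1)%:R.
Proof.
rewrite coef_H_dagger andbF add0r.
(* As [below s <= gaps_below s], only the exponent [(gaps_below s).-1] can reach
   the diagonal, and then the two numbers agree. *)
transitivity (\sum_(s < C | `[< G s >]) - ((below s == i.+1) && (gaps_below s == i.+1))%:R : rat).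
  apply: eq_bigr => s /asboolP Gs; rewrite [i.+1 == _]eq_sym.
  case: (below s =P i.+1) => [e|_]; last by rewrite mulr0 oppr0.
  have le := below_le_gaps GD C1 C_gap Gs (ltn_ord s); rewrite e in le.
  rewrite mulr1 (ltn_eqF le) sub0r; congr (- (_ : bool)%:R).
  by rewrite eq_sym -eqSS prednK //; exact: leq_trans le.
rewrite sumrN; congr (- _); rewrite /bal; case: asboolP => [[jC [Gs bj]]|nb].
  have sC : (C - i.+1.*2 < C)%N by lia.
  have eC : (C - (C - i.+1.*2) = i.+1.*2)%N by rewrite subKn.
  have := elements_below_split G (i.+1.*2); rewrite bj => gj.
  rewrite (bigD1 (Ordinal sC)) /=; last exact/asboolP.
  rewrite eC bj eqxx (_ : (_ == _) = true); last by apply/eqP; lia.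
  rewrite big1 ?addr0 // => s /andP[/asboolP Gs' ns].
  case: eqP => // e1; case: eqP => // e2; exfalso; move/eqP: ns; apply; apply/val_inj => /=.
  by have := elements_below_split G (C - s); have := ltn_ord s; rewrite e1 e2; lia.
rewrite big1 // => s /asboolP Gs; case: eqP => // e1; case: eqP => // e2; case: nb.
have := elements_below_split G (C - s); rewrite e1 e2 addnn => e.
have sC := ltnW (ltn_ord s).
by split; [rewrite e leq_subr|rewrite e subKn].
Qed.

Lemma H_dagger_mod q j : (0 < q)%N ->
  dvq (q ^ j.+1) ((H_dagger`_j.+1).[q%:R] + (bal j.+1)%:R * q%:R ^+ j).
Proof.
move=> q0; pose Q := H_dagger`_j.+1 + (bal j.+1)%:R%:P * 'X^j.
have -> : (H_dagger`_j.+1).[q%:R] + (bal j.+1)%:R * q%:R ^+ j = Q.[q%:R].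
  by rewrite /Q hornerD hornerM hornerC hornerXn.
rewrite horner_coef; apply: dvq_sum => i _.
have Qi : Q`_i = H_dagger`_j.+1`_i + (bal j.+1)%:R * (i == j :> nat)%:R.
  by rewrite /Q coefD coefCM coefXn.
have [ij|ji|e] := ltngtP i j.
- rewrite Qi (ltn_eqF ij) mulr0 addr0; suff -> : H_dagger`_j.+1`_i = 0 by rewrite mul0r; exact: dvq0.
  by apply/eqP; apply: contraTT ij => /H_dagger_low; rewrite ltnS -leqNgt.
- rewrite mulrC; apply: (dvqW q0 ji); rewrite -[X in (_ ^ X)%N]addn0.
  apply: dvq_mulXn => //; rewrite expn0; apply: dvq1.
  by rewrite Qi rpredD ?H_dagger_int // rpredM ?rpred_nat.
- by rewrite Qi e eqxx mulr1 H_dagger_extremal addNr mul0r; exact: dvq0.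
Qed.

(** ** The ranks *)

Section Ranks.
Variables (L : finFieldType) (iota : {rmorphism F -> L}).
Local Notation xL := (base_change iota x).
Local Notation yL := (base_change iota y).
Local Notation q := #|L|.

Let HC : conductor_at xL yL C. Proof. exact: (extension_conductor x0 y0 C1 GC iota). Qed.
Let q0 : (0 < q)%N. Proof. by apply/card_gt0P; exists 0. Qed.

Lemma coef_rank_ge_sum r i : (rank_ge_sum xL yL r)`_i =
  \sum_(M \in standard xL yL) (((r <= qrank xL yL M)%N && (deg M == i))%:R : rat).
Proof.
have fS := finite_standard HC; rewrite /rank_ge_sum.
have -> : [set M | standard xL yL M /\ (r <= qrank xL yL M)%N] =
  standard xL yL `&` [set M | (r <= qrank xL yL M)%N] by [].
rewrite fsbig_mkcondr fsbig_finite // coef_sum -fsbig_finite //.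
apply: eq_fsum => M _; case: ifPn => [/set_mem /= ->|/negP nr].
  by rewrite coefXn eq_sym.
by rewrite coef0 (_ : (r <= _)%N = false) //; apply/negP => rM; apply: nr; rewrite inE.
Qed.

Lemma labels_branch : labels xL yL (branch_ring xL yL) = [set 0%N].
Proof.
have [X0 Y0 _ _] := HC; have sR := submodule_branch HC.
have stR : standard xL yL (branch_ring xL yL).
  by apply/standardP; split=> //; exact: Gamma0.
apply/seteqP; split=> k; last by move=> ->; exact: (labels0 stR).
move=> [[f Rf [fk tf]] nm] /=; apply: contrapT => k0; apply: nm; exists f => //.
rewrite -[f]mulr1; apply: mulm_in; last exact: branch1.
by split=> //; apply: tf; rewrite lt0n; apply/eqP.
Qed.

(** A module of rank one is principal, hence of the maximal degree. *)
Lemma rank_ge2 M : standard xL yL M -> (1 < qrank xL yL M)%N = (deg M < delta)%N.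
Proof.
move=> stM; have [sM [f Mf f1]] := stM; have sMv := submodule_subspace sM.
have f0 : f 0%N != 0 by rewrite f1 oner_neq0.
have [v fv] := series_inv f0.
have sR := submodule_branch HC.
have stR : standard xL yL (branch_ring xL yL).
  by apply/standardP; split=> //; exact: Gamma0.
set Y := scale f (branch_ring xL yL).
have stY : standard xL yL Y by exact: (scale_standard fv stR).
have [sY _] := stY; have tY := standard_tailK HC stY.
have YM : Y `<=` M by move=> _ [r Rr ->]; rewrite mulrC; exact: (submoduleM sM Rr Mf).
have dY : Delta Y = G by rewrite (Delta_scale _ fv); exact: extension_Gamma.
have degY : deg Y = delta by rewrite (deg_gaps HC stY) dY.
have qY : qrank xL yL Y = 1%N.
  by rewrite (qrank_scale HC fv stR) (qrankE HC stR) labels_branch ncard1.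
have fl : finite_set (labels xL yL M).
  by apply: (@finite_bounded _ (C + C)) => l; exact: (labels_lt HC stM).
have l0 := labels0 stM.
apply/idP/idP => [r2|dM].
  rewrite ltnNge; apply/negP => dM; suff e : Y = M by rewrite -e qY in r2.
  have fM := standard_gaps_finite HC stM.
  apply: (Delta_sub_eq (submodule_subspace sY) sMv tY YM).
  have fY := standard_gaps_finite HC stY.
  have sub : ~` Delta M `<=` ~` Delta Y by apply: subsetC; exact: Delta_sub.
  have e : ~` Delta M = ~` Delta Y.
    apply: (ncard_sub_eq fY sub); rewrite -![ncard _]/(gaps _).
    by rewrite -(deg_gaps HC stY) -(deg_gaps HC stM) degY.
  by rewrite -[Delta M]setCK e setCK.
rewrite ltnNge; apply/negP => r1; move: dM; rewrite -degY; suff -> : Y = M by rewrite ltnn.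
apply: esym.
have eL : [set 0%N] = labels xL yL M.
  apply: (ncard_sub_eq fl); first by move=> _ ->.
  by rewrite ncard1 -(qrankE HC stM).
have smv := submodule_subspace (mulm_submodule sM).
(* With one label, [M] is the line of [f] modulo the maximal ideal. *)
apply: (nakayama (C := C) sM sY tY YM).
have sl := subspace_line f.
have eM : addS (line f) (max_ideal_mul xL yL M) = M.
  apply: (@Delta_sub_eq _ (C + C)) => //.
  - exact: subspace_add.
  - by move=> g /(mulm_tailK HC stM); exact: (addSr sl).
  - move=> _ [_ [m [[c ->] mm ->]]]; apply: (subspaceD sMv); last exact: (mulm_sub sM).
    exact: (subspaceZ sMv).
  move=> k Mk; have [mk|nmk] := pselect (Delta (max_ideal_mul xL yL M) k).
    exact: (Delta_sub (addSr sl)).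
  have : labels xL yL M k by [].
  rewrite -eL => /= ->; exists f; first by apply: (addSl smv); exact: line_self.
  by split=> //; rewrite f1 oner_neq0.
rewrite -{1}eM => _ [_ [m [[c ->] mm ->]]]; exists (c *: f), m; split=> //.
exists (c *: (1 : series L)); last by rewrite scaler_mulr mulr1.
have [X0 Y0 _ _] := HC.
by apply: subspaceZ; [exact: branch_subspace|exact: branch1].
Qed.

(** The factor of a module of rank [m.+1] in [Hmot_top], less the terms that it
    contributes for having rank at least 2 and at least 3. *)
Definition rank_defect (m : nat) : {poly rat} :=
  rank_poly q m + (0 < m)%N%:R *: 'X - (q%:R * (1 < m)%N%:R) *: 'X^2.

Lemma rank_defect_mod m k : dvq (q ^ k) (rank_defect m)`_k.
Proof.
rewrite /rank_defect coefB coefD !coefZ coefX coefXn.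
have := rank_poly_mod m k q0; congr (dvq _ (_ + _ - _)).
  by case: (0 < m)%N; case: (k == _); rewrite /= ?mulr1 ?mulr0 ?mul0r.
by case: (1 < m)%N; case: (k == _); rewrite /= ?mulr1 ?mulr0 ?mul0r.
Qed.

(** The modules with a given [Delta M] and rank number a multiple of [q] to the
    degree, by [cell_mod], and [rank_defect_mod] supplies the missing powers. *)
Lemma Hmot_rank_congr j : congr_mod (q ^ j)
   (Hmot xL yL 'X (- ((q%:R : rat)^-1 *: 'X)))`_j
   (- ('X * rank_ge_sum xL yL 2) + (q%:R : rat) *: ('X^2 * rank_ge_sum xL yL 3))`_j.
Proof.
have fS := finite_standard HC.
have fR r : finite_set [set M | standard xL yL M /\ (r <= qrank xL yL M)%N].
  by apply: sub_finite_set fS => M [].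
have rE r (p : {poly rat}) : p * rank_ge_sum xL yL r =
    \sum_(M \in standard xL yL) ('X^(deg M) * ((r <= qrank xL yL M)%N%:R *: p)).
  rewrite /rank_ge_sum (fsum_mull _ _ (fR r)).
  have -> : [set M | standard xL yL M /\ (r <= qrank xL yL M)%N] =
    standard xL yL `&` [set M | (r <= qrank xL yL M)%N] by [].
  rewrite fsbig_mkcondr; apply: eq_fsum => M _.
  case: ifPn => [/set_mem /= ->|/negP nr]; first by rewrite scale1r mulrC.
  rewrite (_ : (r <= _)%N = false) ?scale0r ?mulr0 //.
  by apply/negP => rM; apply: nr; rewrite inE.
rewrite /congr_mod -coefB (Hmot_top HC) !rE.
have lin (g1 g2 g3 : set (series L) -> {poly rat}) :
    \sum_(M \in standard xL yL) g1 M - (- (\sum_(M \in standard xL yL) g2 M) +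
      (q%:R : rat) *: (\sum_(M \in standard xL yL) g3 M)) =
    \sum_(M \in standard xL yL) (g1 M + g2 M - (q%:R : rat) *: g3 M).
  have fsE (g : set (series L) -> {poly rat}) : \sum_(M \in standard xL yL) g M =
      \sum_(M <- fset_set (standard xL yL)) g M := fsbig_finite _ _ fS.
  by rewrite !fsE scaler_sumr opprD opprK addrA -big_split -sumrB.
rewrite lin; have e M : standard xL yL M -> 'X^(deg M) *
      \prod_(i < (qrank xL yL M).-1) (1 + q%:R ^+ i.+1 * - ((q%:R : rat)^-1 *: 'X)) +
    'X^(deg M) * ((2 <= qrank xL yL M)%N%:R *: 'X) -
    (q%:R : rat) *: ('X^(deg M) * ((3 <= qrank xL yL M)%N%:R *: 'X^2)) =
    'X^(deg M) * rank_defect (qrank xL yL M).-1 :> {poly rat}.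
  move=> _; rewrite rank_polyE // /rank_defect scalerAr scalerA -mulrDr -mulrBr.
  by case: (qrank xL yL M).
rewrite (eq_fsum e) {e lin rE fR}.
(* The summands depend only on the valuations and the rank. *)
pose p (M : set (series L)) := (Delta M, qrank xL yL M).
have fB : finite_set (p @` standard xL yL) by exact: finite_image.
rewrite (fsum_fib _ fS fB (p := p)); last by move=> M stM; exists M.
rewrite fsbig_finite // coef_sum -/(dvq _ _) big_seq; apply: dvq_sum => -[D r].
rewrite in_fset_set // inE => -[M0 stM0 [dM0 rM0]].
have fT : finite_set (standard xL yL `&` [set M | p M = (D, r)]) by exact: finite_setIl.
rewrite (fsum_cst (c := 'X^(gaps D) * rank_defect r.-1) fT); last first.
  by move=> M [stM [dM rM]]; rewrite (deg_gaps HC stM) dM rM.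
rewrite coefMn coefXnM; case: ltnP => jg; first by rewrite mul0rn; exact: dvq0.
rewrite -mulr_natl -{1}(subnKC jg) expnD; apply: dvqM; last exact: rank_defect_mod.
apply: dvq_nat; first by rewrite expn_gt0 q0.
have D0 : D 0%N by rewrite -dM0; case: (standard_Delta stM0).
have := @cell_mod _ _ _ _ HC D (fun M => qrank xL yL M = r) _ D0.
rewrite (_ : [set M | _] = standard xL yL `&` [set M | p M = (D, r)]); last first.
  by apply/seteqP; split=> M [stM]; [move=> dM rM; split=> //; rewrite /= /p dM rM|move=> [dM rM]].
by apply=> u v M uv stM rM; rewrite (qrank_scale HC uv stM).
Qed.

(** By [rank_ge2] the modules of degree less than [delta] all have rank at least
    2, so that [J0_mod] counts them. *)
Lemma rank_ge2_congr i : dvq (q ^ i.+1)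
  ((rank_ge_sum xL yL 2)`_i - (i < delta)%N%:R * q%:R ^+ i).
Proof.
have fS := finite_standard HC; rewrite coef_rank_ge_sum.
have [iD|di] := ltnP i delta; last first.
  rewrite mul0r subr0 fsbig1; first exact: dvq0.
  move=> M stM; case: eqP => [e|_]; last by rewrite andbF.
  by rewrite rank_ge2 // e ltnNge di.
have fG := finite_standard_gamma GC.
have E : (\sum_(M \in standard xL yL) (((1 < qrank xL yL M)%N && (deg M == i))%:R : rat)) =
   (\sum_(D \in standard_gamma G) (if gaps D == i then (ncard (J0 xL yL D))%:R else 0 : rat)).
  rewrite (fsum_fib _ fS fG (p := fun M => Delta M)); last first.
    by move=> M stM; have := standard_Delta stM; rewrite extension_Gamma.
  apply: eq_fsum => D SD.
  rewrite (fsum_cst (c := (gaps D == i)%:R)); [|exact: finite_setIl|].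
    by case: eqP; rewrite ?mul0rn.
  move=> M [stM dM]; rewrite rank_ge2 // (deg_gaps HC stM) dM.
  by case: eqP => [->|_]; rewrite ?iD ?andbF.
rewrite E mul1r -[q%:R ^+ i]mul1r -[X in X * _](_ : (i <= delta)%N%:R = 1); last by rewrite ltnW.
rewrite -(special_sum x0 y0 GC) !fsbig_finite // mulr_suml -sumrB big_seq.
apply: dvq_sum => D; rewrite in_fset_set // inE => SD.
case: eqP => [e|_] /=; last by rewrite mul0r subrr; exact: dvq0.
by rewrite -e; exact: (J0_mod x0 y0 C1 GC).
Qed.

(** The three congruences above determine the coefficient of [t ^ (i + 2)], where
    rank at least 3 enters with the factor [q]. *)
Lemma rank_ge3_congr i : dvq (q ^ i.+1)
  ((rank_ge_sum xL yL 3)`_i - ((i.+1 < delta)%N%:R - (bal i.+2)%:R) * q%:R ^+ i).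
Proof.
apply: (dvq_cancel q0); have T1 := Hmot_rank_congr i.+2.
have T2 := rank_ge2_congr i.+1; have T3 := H_dagger_mod i.+1 q0.
rewrite -(H_dagger_is_Hmot iota) coef_at_q in T1.
have e (A B : {poly rat}) (c : rat) :
    (- ('X * A) + c *: ('X^2 * B))`_i.+2 = - A`_i.+1 + c * B`_i.
  by rewrite coefD coefN coefXM coefZ coefXnM /= subn2.
rewrite e in T1; set r3 := _`_i in T1 *; set r2 := _`_i.+1 in T1 T2.
set h := (H_dagger`_i.+2).[_] in T3; set b := (bal _)%:R in T3 *; set d := _%:R in T2 *.
have {}T1 : dvq (q ^ i.+2) (h - (- r2 + q%:R * r3)) := T1.
have -> : q%:R * (r3 - (d - b) * q%:R ^+ i) =
  (h + b * q%:R ^+ i.+1) + (r2 - d * q%:R ^+ i.+1) - (h - (- r2 + q%:R * r3)).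
  by rewrite exprS; ring.
by apply: dvqB => //; apply: dvqD.
Qed.

End Ranks.

Lemma rank2_extremal : rank_ge_extremal x y 2 (\sum_(i < delta) mono i i).
Proof.
move=> L iota i; rewrite /congr_mod coef_at_q_diagonal.
exact: rank_ge2_congr.
Qed.

Lemma rank3_extremal n :
  (forall i, ((i.+1 < delta)%N%:R - (bal i.+2)%:R : rat) = (i < n)%N%:R) ->
  rank_ge_extremal x y 3 (\sum_(i < n) mono i i).
Proof.
move=> H L iota i; rewrite /congr_mod coef_at_q_diagonal -H.
exact: rank_ge3_congr.
Qed.

Lemma delta_double : C = delta.*2.
Proof. exact: (conductor_double C1 GC sym). Qed.

Lemma bal_le j : bal j -> (j <= delta)%N.
Proof. by move=> /asboolP[jC _]; rewrite -leq_double -delta_double. Qed.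

Lemma bal_G2 j : G 2%N -> bal j = (j <= delta)%N.
Proof.
move=> G2; apply/idP/idP; first exact: bal_le.
by move=> jd; apply/asboolP; exact: (balanced_G2 G0 GD C1 GC sym).
Qed.

Lemma bal_not_G2 j : ~ G 2%N \/ (delta <= 2)%N -> (0 < j)%N ->
  bal j = (j == 1%N) || (j == delta).
Proof.
move=> H j0; apply/idP/orP => [bj|[/eqP->|/eqP->]].
- case: H => [nG2|d2].
    by case: (balanced_not_G2 G0 GD C1 C_gap GC sym nG2 j0 (asboolW bj)) => ->; [left|right].
  by have := bal_le bj; case: j j0 {bj} => [|[|[|j]]] // _ jd; [left|right; lia|lia].
- exact/asboolP/(balanced1 G0 GD C1 C_gap sym).
- exact/asboolP/(balanced_delta G0 C1 GC sym).
Qed.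

Lemma diagonal_coef i j :
  (diagonal_part 1 H_dagger)`_j`_i = if j == i.+1 then - (bal i.+1)%:R else 0.
Proof.
rewrite coef_diagonal addn1 eq_sym; case: eqP => // ->.
exact: H_dagger_extremal.
Qed.

End DaggerTerms.
Theorem theorem5p4 (F : finFieldType) (x y : series F)
  (hR : unibranch_plane x y) (hdelta : (1 <= delta x y)%N)
  (* P D is the polynomial giving the number of points of the cell of D *)
  (P : set nat -> {poly rat})
  (hP : forall D, standard_gamma (Gamma x y) D ->
     forall (L : finFieldType) (iota : {rmorphism F -> L}),
       let J := J0 (base_change iota x) (base_change iota y) D in
       (P D).[#|L|%:R] = (#|` fset_set J|)%:R) :
  (* (i) *)
  (exists H0 : {poly {poly rat}},
    [/\ is_Hmot x y (fun=> 0) H0 /\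
          H0 = \sum_(D \in standard_gamma (Gamma x y)) (P D)%:P * 'X^(gaps D),
        forall D, standard_gamma (Gamma x y) D ->
          forall i, (P D)`_i != 0 ->
            (gaps D <= i)%N /\
            (i = gaps D ->
             exists n : nat, D = Gamma x y `|` [set m | (n <= m)%N]),
        forall i j : nat, H0`_j`_i != 0 -> (j <= i)%N &
        diagonal_part 0 H0 = \sum_(i < (delta x y).+1) mono i i]) /\
  (* (ii) *)
  (exists Hd : {poly {poly rat}},
    [/\ is_Hmot x y (fun q => - (q^-1 *: 'X)) Hd,
        forall i j : nat, Hd`_j`_i \is a Num.int /\
          (Hd`_j`_i != 0 -> (j <= i.+1)%N),
        (* the extremal terms q^i t^(i+1), which are those not vanishing
           modulo q^j in t-degree j, only come from q-ranks >= 2 and >= 3 *)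
        forall (L : finFieldType) (iota : {rmorphism F -> L}) (j : nat),
          let xL := base_change iota x in
          let yL := base_change iota y in
          congr_mod (#|L| ^ j)
            (Hmot xL yL 'X (- (#|L|%:R^-1 *: 'X)))`_j
            (- ('X * rank_ge_sum xL yL 2)
             + #|L|%:R *: ('X^2 * rank_ge_sum xL yL 3))`_j,
        rank_ge_extremal x y 2 (\sum_(i < delta x y) mono i i) &
        (~ Gamma x y 2%N \/ (delta x y <= 2)%N ->
         [/\ rank_ge_extremal x y 3 (\sum_(i < delta x y - 2) mono i i),
             diagonal_part 1 Hd =
               - (\sum_(i < delta x y) mono 0 1 * mono i i)
               + \sum_(i < delta x y - 2) mono 1 2 * mono i i &
             diagonal_part 1 Hd =
               if delta x y == 1%N then - mono 0 1
               else - mono 0 1 - mono (delta x y).-1 (delta x y)]) /\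
        (* if 2 is in Gamma, then all q-ranks are at most 2, and the
           q-rank 3 terms (hence the cancellations) are absent *)
        (Gamma x y 2%N ->
         rank_ge_extremal x y 3 0 /\
         diagonal_part 1 Hd = - (\sum_(i < delta x y) mono 0 1 * mono i i))]).
Proof.
have [x0 y0 _] := hR.
have [C [C1 C_gap GC]] := unibranch_conductor hR hdelta.
have low := cell_low_coef x0 y0 C1 GC hP.
split.
  exists (H_zero x y P); split.
  - by split; [exact: (H_zero_is_Hmot x0 y0 C1 GC hP)|].
  - move=> D SD i Pi; split.
      rewrite leqNgt; apply/negP => ig; move/eqP: Pi; apply.
      by rewrite (low D i SD (ltnW ig)) (ltn_eqF ig).
    move=> e; move: Pi; rewrite e (low _ _ SD (leqnn _)) eqxx /= /special.
    by case: asboolP => // -[n ->] _; exists n.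
  - by move=> i j; exact: (H_zero_low x0 y0 C1 GC hP).
  - exact: (H_zero_diagonal x0 y0 C1 GC hP).
have dE := diagonal_coef x0 y0 C1 C_gap.
exists (H_dagger x y C); split.
- exact: (H_dagger_is_Hmot x0 y0 C1 C_gap GC).
- move=> i j; split; first exact: H_dagger_int.
  exact: (H_dagger_low x0 y0 C1 C_gap).
- by move=> L iota j; exact: (Hmot_rank_congr x0 y0 C1 GC).
- exact: (rank2_extremal x0 y0 C1 GC).
split=> [H|G2].
  have bE j : bal x y C j.+1 = (j == 0%N) || (j.+1 == delta x y).
    by rewrite (bal_not_G2 x0 y0 C1 C_gap GC H).
  split.
  - apply: (rank3_extremal x0 y0 C1 C_gap GC) => i; rewrite bE /=.
    by rewrite ltn_subRL add2n [(i.+1 < _)%N]leq_eqVlt; case: ltngtP; rewrite ?subrr ?subr0.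
  - apply/polyP => j; apply/polyP => i; rewrite dE coefD coefD !coefN.
    rewrite !coef_shifted_diagonal bE addn0 addn1.
    case: (j == _); rewrite /= ?oppr0 ?addr0 //.
    have [->|i0] := posnP i; first by rewrite hdelta addr0.
    rewrite [(i < _.+1)%N](_ : _ = (i.+1 < delta x y)%N); last by lia.
    by rewrite [(i < delta x y)%N]leq_eqVlt; case: ltngtP; rewrite /= ?addNr ?oppr0 ?addr0.
  - apply/polyP => j; apply/polyP => i; rewrite dE.
    have m1 : (mono 0 1)`_j`_i = ((j == i.+1) && (i == 0%N))%:R.
      by rewrite coef_mono andbC; case: (i =P 0%N) => [->|_]; rewrite ?andbF.
    have md : (mono (delta x y).-1 (delta x y))`_j`_i =
        ((j == i.+1) && (i.+1 == delta x y))%:R.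
      rewrite coef_mono -{2 3}(prednK hdelta) eqSS andbC.
      by case: (i =P (delta x y).-1) => [->|_]; rewrite ?andbF.
    case: (eqVneq (delta x y) 1%N) => d1'.
      by rewrite !coefN m1 bE d1' eqSS orbb; case: (j == _); rewrite ?oppr0.
    rewrite !coefB !coefN m1 md bE; case: (j == _); rewrite /= ?oppr0 ?subr0 //.
    have [->|i0] := posnP i; first by rewrite eq_sym (negPf d1') subr0.
    by rewrite oppr0 sub0r.
have bE j : bal x y C j = (j <= delta x y)%N.
  exact: (bal_G2 x0 y0 C1 C_gap GC).
split.
  have := rank3_extremal x0 y0 C1 C_gap GC (n := 0).
  rewrite big_ord0; apply=> i; rewrite bE.
  by rewrite subrr.
apply/polyP => j; apply/polyP => i; rewrite dE coefN coefN coef_shifted_diagonal bE.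
by rewrite addn0; case: (j == _); rewrite /= ?oppr0.
Qed.
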